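(* Assume the setting and standing assumptions described in the context. Suppose that there exists $\beta_*>0$ such that $$\sup_{v\in\mathcal{V}_h\setminus\{0\}}\frac{b(v,q)}{\|v\|_{\mathcal{V}}}\ge\beta_*\|q\|_{\mathcal{Q}}\quad\forall q\in\mathcal{H}_h^\perp,\qquad \sup_{q\in\mathcal{Q}_h\setminus\{0\}}\frac{b(v,q)}{\|q\|_{\mathcal{Q}}}\ge\beta_*\|v\|_{\mathcal{V}}\quad\forall v\in\mathcal{K}_h^\perp.$$ Then for every $f\in L^1_{\mathcal{J}}(\mathcal{V}')$ and $g\in L^1_{\mathcal{J}}(\mathcal{Q}')$ there is a unique $(u_h,p_h)\in L^1_{\mathcal{J}}(\mathcal{V}_h)\times L^1_{\mathcal{J}}(\mathcal{Q}_h)$ such that, for a.e. $t\in\mathcal{J}$ and all $(v,q)\in\mathcal{V}_h\times\mathcal{Q}_h$, $$\begin{aligned}a(u_h(t),v)+b(v,p_h(t))&=\langle f(t),v\rangle_{\mathcal{V}}+\int_0^t\big[k_1(t,s)a(u_h(s),v)+k_2(t,s)b(v,p_h(s))\big]ds,\\ b(u_h(t),q)-c(p_h(t),q)&=\langle g(t),q\rangle_{\mathcal{Q}}+\int_0^t\big[k_3(t,s)b(u_h(s),q)-k_4(t,s)c(p_h(s),q)\big]ds.\end{aligned}\tag{D}$$ Moreover, let $(u,p)\in L^1_{\mathcal{J}}(\mathcal{V}\times\mathcal{Q})$ be a solution of the continuous problem, i.e. of the same two equations with $(u_h,p_h)$ replaced by $(u,p)$ and for all $(v,q)\in\mathcal{V}\times\mathcal{Q}$.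 Then for every $u_I\in L^1_{\mathcal{J}}(\mathcal{V}_h)$ and every $p_I\in L^1_{\mathcal{J}}(\mathcal{Q}_h)$, with $\xi_u=u_h-u_I$, $\xi_p=p_h-p_I$ and $\mathcal{F},\mathcal{G}$ as in the context, $$\|\overline{\xi}_u\|_{L^1_{\mathcal{J}}(\mathcal{V})}\le C_9\|\overline{\mathcal{F}}\|_{L^1_{\mathcal{J}}(\mathcal{V}')}+C_{13}\|\mathcal{F}_0\|_{L^1_{\mathcal{J}}(\mathcal{V}')}+C_3\|\overline{\mathcal{G}}\|_{L^1_{\mathcal{J}}(\mathcal{Q}')}+C_7\|\mathcal{G}_0\|_{L^1_{\mathcal{J}}(\mathcal{Q}')},$$ $$\|\xi_u^0\|_{L^1_{\mathcal{J}}(\mathcal{V})}\le C_{10}\|\overline{\mathcal{F}}\|_{L^1_{\mathcal{J}}(\mathcal{V}')}+C_{14}\|\mathcal{F}_0\|_{L^1_{\mathcal{J}}(\mathcal{V}')}+C_4\|\overline{\mathcal{G}}\|_{L^1_{\mathcal{J}}(\mathcal{Q}')}+C_8\|\mathcal{G}_0\|_{L^1_{\mathcal{J}}(\mathcal{Q}')},$$ $$\|\overline{\xi}_p\|_{L^1_{\mathcal{J}}(\mathcal{Q})}\le C_{11}\|\overline{\mathcal{F}}\|_{L^1_{\mathcal{J}}(\mathcal{V}')}+C_{15}\|\mathcal{F}_0\|_{L^1_{\mathcal{J}}(\mathcal{V}')}+C_1\|\overline{\mathcal{G}}\|_{L^1_{\mathcal{J}}(\mathcal{Q}')}+C_5\|\mathcal{G}_0\|_{L^1_{\mathcal{J}}(\mathcal{Q}')},$$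 $$\|\xi_p^0\|_{L^1_{\mathcal{J}}(\mathcal{Q})}\le C_{12}\|\overline{\mathcal{F}}\|_{L^1_{\mathcal{J}}(\mathcal{V}')}+C_{16}\|\mathcal{F}_0\|_{L^1_{\mathcal{J}}(\mathcal{V}')}+C_2\|\overline{\mathcal{G}}\|_{L^1_{\mathcal{J}}(\mathcal{Q}')}+C_6\|\mathcal{G}_0\|_{L^1_{\mathcal{J}}(\mathcal{Q}')},$$ where $C_1,\dots,C_{16}$ are positive constants depending on $\alpha_*^0,\beta_*,\gamma_*^0$, the continuity constants $\|a\|,\|c\|$, the kernel constants $C_{k_i}$, $i=1,2,3,4$, and $T$. Moreover, $$\|u_h-u\|_{L^1_{\mathcal{J}}(\mathcal{V})}+\|p_h-p\|_{L^1_{\mathcal{J}}(\mathcal{Q})}\le C\Big(\inf_{v\in L^1_{\mathcal{J}}(\mathcal{V}_h)}\|u-v\|_{L^1_{\mathcal{J}}(\mathcal{V})}+\inf_{q\in L^1_{\mathcal{J}}(\mathcal{Q}_h)}\|p-q\|_{L^1_{\mathcal{J}}(\mathcal{Q})}\Big),$$ where $C>0$ is a constant depending on the $C_i$ (and on $\|a\|,\|b\|,\|c\|$, the $C_{k_i}$ and $T$).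
   Context: $\mathcal{V},\mathcal{Q}$ are real Hilbert spaces with duals $\mathcal{V}',\mathcal{Q}'$ and duality pairings $\langle\cdot,\cdot\rangle_{\mathcal{V}},\langle\cdot,\cdot\rangle_{\mathcal{Q}}$. $\mathcal{J}=[0,T]$ with $T\in[0,\infty)$; $L^1_{\mathcal{J}}(\mathcal{B})$ denotes the Bochner space $L^1(\mathcal{J};\mathcal{B})$. Let $a:\mathcal{V}\times\mathcal{V}\to\mathbb{R}$, $b:\mathcal{V}\times\mathcal{Q}\to\mathbb{R}$, $c:\mathcal{Q}\times\mathcal{Q}\to\mathbb{R}$ be continuous bilinear forms with norms $\|a\|,\|b\|,\|c\|$; $a$ and $c$ are symmetric and positive semi-definite; $a$ is coercive on $\mathcal{K}=\{v\in\mathcal{V}:b(v,q)=0\ \forall q\in\mathcal{Q}\}$ and $c$ is coercive on $\mathcal{H}=\{q\in\mathcal{Q}:b(v,q)=0\ \forall v\in\mathcal{V}\}$ (with constants $\alpha_0,\gamma_0>0$). The kernels $k_i$, $i=1,2,3,4$, are continuous real functions on the triangle $\{(t,s):0\le s\le t\le T\}$ with $|k_i|\le C_{k_i}$. Discrete spaces: $\mathcal{V}_h\subset\mathcal{V}$ and $\mathcal{Q}_h\subset\mathcal{Q}$ are finite-dimensional subspaces ($h$ a discretization parameter), with $$\mathcal{K}_h=\{v_h\in\mathcal{V}_h:b(v_h,q_h)=0\ \forall q_h\in\mathcal{Q}_h\},\quad \mathcal{H}_h=\{q_h\in\mathcal{Q}_h:b(v_h,q_h)=0\ \forall v_h\in\mathcal{V}_h\},$$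 and there are $\alpha_*^0,\gamma_*^0>0$, independent of $h$, with $a(v,v)\ge\alpha_*^0\|v\|_{\mathcal{V}}^2$ for all $v\in\mathcal{K}_h$ and $c(q,q)\ge\gamma_*^0\|q\|_{\mathcal{Q}}^2$ for all $q\in\mathcal{H}_h$. $\mathcal{K}_h^\perp$ and $\mathcal{H}_h^\perp$ are the orthogonal complements of $\mathcal{K}_h$ in $\mathcal{V}_h$ and of $\mathcal{H}_h$ in $\mathcal{Q}_h$. Splittings: $\xi_u=\xi_u^0+\overline{\xi}_u$ with $\xi_u^0\in\mathcal{K}_h$, $\overline{\xi}_u\in\mathcal{K}_h^\perp$; $\xi_p=\xi_p^0+\overline{\xi}_p$ with $\xi_p^0\in\mathcal{H}_h$, $\overline{\xi}_p\in\mathcal{H}_h^\perp$. With $\eta_u=u-u_I$ and $\eta_p=p-p_I$, define for a.e. $t$ and $v\in\mathcal{V}_h$, $q\in\mathcal{Q}_h$ $$\langle\mathcal{F}(t),v\rangle=a(\eta_u(t),v)+b(v,\eta_p(t))-\int_0^t\big[k_1(t,s)a(\eta_u(s),v)+k_2(t,s)b(v,\eta_p(s))\big]ds,$$ $$\langle\mathcal{G}(t),q\rangle=b(\eta_u(t),q)-c(\eta_p(t),q)-\int_0^t\big[k_3(t,s)b(\eta_u(s),q)-k_4(t,s)c(\eta_p(s),q)\big]ds.$$ For $v=v^0+\overline{v}$ ($v^0\in\mathcal{K}_h,\overline{v}\in\mathcal{K}_h^\perp$), $\langle\mathcal{F}_0,v\rangle=\langle\mathcal{F},v^0\rangle$ and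 $\langle\overline{\mathcal{F}},v\rangle=\langle\mathcal{F},\overline{v}\rangle$; for $q=q^0+\overline{q}$ ($q^0\in\mathcal{H}_h,\overline{q}\in\mathcal{H}_h^\perp$), $\langle\mathcal{G}_0,q\rangle=\langle\mathcal{G},q^0\rangle$ and $\langle\overline{\mathcal{G}},q\rangle=\langle\mathcal{G},\overline{q}\rangle$. These functionals act on $\mathcal{V}_h$, $\mathcal{Q}_h$, and their dual norms (written $\|\cdot\|_{\mathcal{V}'},\|\cdot\|_{\mathcal{Q}'}$) are taken as suprema over these spaces with the norms of $\mathcal{V}$, $\mathcal{Q}$. *)

(* Defs.v *)
From HB Require Import structures.
From mathcomp Require Import all_boot all_order all_algebra.
From mathcomp Require Import all_classical all_reals all_analysis.

Set Implicit Arguments.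
Unset Strict Implicit.
Unset Printing Implicit Defensive.

Import Order.TTheory GRing.Theory Num.Theory.
Import numFieldNormedType.Exports.

Local Open Scope classical_set_scope.
Local Open Scope ring_scope.

HB.mixin Record isHilbert (R : realType) V & CompleteNormedModule R V := {
  inner : {dot V for idfun} ;
  inner_normE : forall v : V, inner v v = `|v| ^+ 2
}.

#[short(type="hilbertType")]
HB.structure Definition Hilbert (R : realType) :=
  {V of CompleteNormedModule R V & isHilbert R V}.

(* Dual norm of l over the subspace A. In MathComp-Analysis sup set0 = 0, so
   every functional on the zero subspace has norm 0. *)
Definition dnorm (R : realType) (V : normedModType R) (A : set V)
    (l : V -> R) : R :=
  sup [set `|l v| / `|v| | v in A `\ 0].

Section Dual.
Context {R : realType} (V : normedModType R).

Definition is_dual : {pred V -> R^o} :=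
  fun l => `[< linear l /\ continuous l >].

Fact is_dual_submod_closed : submod_closed is_dual.
Proof.
split.
  apply/asboolP; split; last exact: cst_continuous.
  by move=> k x y; change ((0 : R^o) = k *: 0 + 0); rewrite scaler0 addr0.
move=> k f g /asboolP[lf cf] /asboolP[lg cg]; apply/asboolP; split.
  move=> m x y; change (k *: f (m *: x + y) + g (m *: x + y) =
    m *: (k *: f x + g x) + (k *: f y + g y)).
  rewrite lf lg !scalerDr !scalerA (mulrC k) -!addrA.
  by congr (_ + _); rewrite addrCA.
move=> x; apply: (@cvgD _ _ _ _ _ (fun z => k *: f z) g); last exact: cg.
by apply: cvgZr; exact: cf.
Qed.
HB.instance Definition _ :=
  GRing.isSubmodClosed.Build R (V -> R^o) is_dual is_dual_submod_closed.

Record dual := Dual { dual_fun :> V -> R^o ; _ : dual_fun \in is_dual }.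

HB.instance Definition _ := [isSub for dual_fun].
HB.instance Definition _ := gen_eqMixin dual.
HB.instance Definition _ := [Choice of dual by <:].
HB.instance Definition _ := [SubChoice_isSubLmodule of dual by <:].

Fact dual_linear (l : dual) : linear (dual_fun l).
Proof. by case: l => l /= /asboolP[]. Qed.
HB.instance Definition _ (l : dual) :=
  GRing.isLinear.Build R V R^o _ (dual_fun l) (dual_linear l).

Fact dual_continuous (l : dual) : continuous (dual_fun l).
Proof. by case: l => l /= /asboolP[]. Qed.

Fact dual_bounded (l : dual) : exists M, forall v, `|l v| <= M * `|v|.
Proof.
have /linear_bounded_continuous/linear_boundedP := @dual_continuous l.
by move=> /pinfty_ex_gt0[M _ lM]; exists M.
Qed.

Fact dnorm_has_ubound (A : set V) (l : dual) :
  has_ubound [set `|l v| / `|v| | v in A `\ 0].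
Proof.
have [M lM] := dual_bounded l; exists M => _ [v [_ /eqP v0] <-].
by rewrite ler_pdivrMr ?normr_gt0.
Qed.

Fact dnorm_ge0 (A : set V) (l : V -> R) : 0 <= dnorm A l.
Proof.
rewrite /dnorm; set S := (X in sup X); have [hS|/sup_out] := pselect (has_sup S).
  have [[x Sx] _] := hS; apply: (@le_trans _ _ x); last exact: sup_upper_bound.
  by case: Sx => v _ <-; rewrite divr_ge0.
by move=> ->.
Qed.

Fact dnorm_ub (l : dual) v : `|l v| <= dnorm setT l * `|v|.
Proof.
have [->|v0] := eqVneq v 0; first by rewrite linear0 !normr0 mulr0.
rewrite -ler_pdivrMr ?normr_gt0//; apply: ub_le_sup.
  exact: dnorm_has_ubound.
by exists v => //; split => //; apply/eqP.
Qed.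

Fact dnorm_le (l : V -> R) M : 0 <= M ->
  (forall v, `|l v| <= M * `|v|) -> dnorm setT l <= M.
Proof.
move=> M0 lM; rewrite /dnorm; set S := (X in sup X).
have [->|/set0P ne] := eqVneq S set0; first by rewrite sup0.
apply: ge_sup => // _ [v [_ /eqP v0] <-].
by rewrite ler_pdivrMr ?normr_gt0.
Qed.

Fact dual_normD (f g : dual) :
  dnorm setT (f + g) <= dnorm setT f + dnorm setT g.
Proof.
apply: dnorm_le => [|v]; first by rewrite addr_ge0 ?dnorm_ge0.
rewrite mulrDl (le_trans (ler_normD (f v : R) (g v))) //.
by rewrite lerD ?dnorm_ub.
Qed.

Fact dual_normZ (k : R) (f : dual) :
  dnorm setT (k *: f) = `|k| * dnorm setT f.
Proof.
have le (c : R) (g : dual) : dnorm setT (c *: g) <= `|c| * dnorm setT g.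
  apply: dnorm_le => [|v]; first by rewrite mulr_ge0 ?dnorm_ge0.
  by rewrite (normrM c (g v)) -mulrA ler_wpM2l ?dnorm_ub.
apply/eqP; rewrite eq_le le /=.
have [->|k0] := eqVneq k 0; first by rewrite normr0 mul0r dnorm_ge0.
rewrite mulrC -ler_pdivlMr ?normr_gt0 // mulrC -normfV.
by rewrite -[X in dnorm _ (dual_fun X) <= _](scalerK k0) le.
Qed.

Fact dual_norm_eq0 (f : dual) : dnorm setT f = 0 -> f = 0.
Proof.
move=> f0; apply: val_inj; apply/funext => v; apply/eqP.
by rewrite -normr_le0 (le_trans (dnorm_ub f v)) // f0 mul0r.
Qed.

HB.instance Definition _ :=
  Lmodule_isNormed.Build R dual dual_normD dual_normZ dual_norm_eq0.
End Dual.

Section BilinearForms.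
Context {R : realType}.

Definition form_continuous (V W : normedModType R) (f : V -> W -> R) :=
  continuous (fun p : V * W => f p.1 p.2).

Definition form_norm (V W : normedModType R) (f : V -> W -> R) : R :=
  sup [set x | exists v w, [/\ `|v| <= 1, `|w| <= 1 & x = `|f v w|]].

Definition sym_psd (V : normedModType R) (f : V -> V -> R) :=
  (forall v w, f v w = f w v) /\ (forall v, 0 <= f v v).

Definition coercive_on (V : normedModType R) (f : V -> V -> R) (A : set V)
    (alpha : R) :=
  forall v, A v -> alpha * `|v| ^+ 2 <= f v v.

Definition kernel_l (V W : normedModType R) (b : V -> W -> R)
    (A : set V) (B : set W) : set V :=
  [set v | A v /\ forall w, B w -> b v w = 0].

Definition kernel_r (V W : normedModType R) (b : V -> W -> R)
    (A : set V) (B : set W) : set W :=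
  [set w | B w /\ forall v, A v -> b v w = 0].

Definition orthocompl (V : hilbertType R) (A K : set V) : set V :=
  [set v | A v /\ forall w, K w -> inner w v = 0].

Definition fin_dim_subspace (V : lmodType R) (A : set V) :=
  exists (n : nat) (e : 'I_n -> V),
    A = [set \sum_i x i *: e i | x in [set: 'I_n -> R]].

(* The A-component of v in a direct sum decomposition A + B; junk value 0 if v
   has none. *)
Definition component (V : zmodType) (A B : set V) (v : V) : V :=
  xget 0 [set w | A w /\ B (v - w)].

End BilinearForms.

Section Bochner.
Context {R : realType}.
Local Notation mu := (@lebesgue_measure R).

Definition simple_fun (X : Type) (A : set X) (s : R -> X) :=
  [/\ finite_set (range s), range s `<=` A &
      forall x, measurable (s @^-1` [set x])].

Definition strongly_measurable (X : normedModType R) (T : R) (A : set X)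
    (u : R -> X) :=
  exists s_ : nat -> R -> X, (forall n, simple_fun A (s_ n)) /\
    {ae mu, forall t, `[0, T]%classic t -> s_ n t @[n --> \oo] --> u t}.

Definition int_J (T : R) (phi : R -> R) : \bar R :=
  (\int[mu]_(t in `[0%R, T]) (phi t)%:E)%E.

Definition L1norm (X : normedModType R) (T : R) (u : R -> X) : \bar R :=
  int_J T (fun t => `|u t|).

(* Bochner space L^1([0, T]; A) for a closed subspace A of X, as a set of
   representatives: two of them are the same element when they are equal a.e.
   on [0, T]. *)
Definition bochner_L1 (X : normedModType R) (T : R) (A : set X) :
    set (R -> X) :=
  [set u | [/\ strongly_measurable T A u,
     {ae mu, forall t, `[0, T]%classic t -> A (u t)} &
     (L1norm T u < +oo)%E]].

End Bochner.

Section Problem.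
Context {R : realType} {V Q : hilbertType R}.
Variables (a : V -> V -> R) (b : V -> Q -> R) (c : Q -> Q -> R).
Variables (k1 k2 k3 k4 : R -> R -> R).
Local Notation mu := (@lebesgue_measure R).

Definition memory_V (u : R -> V) (p : R -> Q) (t : R) (v : V) : R :=
  \int[mu]_(s in `[0, t]) (k1 t s * a (u s) v + k2 t s * b v (p s)).

Definition memory_Q (u : R -> V) (p : R -> Q) (t : R) (q : Q) : R :=
  \int[mu]_(s in `[0, t]) (k3 t s * b (u s) q - k4 t s * c (p s) q).

Definition is_solution (T : R) (A : set V) (B : set Q)
    (f : R -> dual V) (g : R -> dual Q) (u : R -> V) (p : R -> Q) :=
  {ae mu, forall t, `[0, T]%classic t -> forall v q, A v -> B q ->
    a (u t) v + b v (p t) = f t v + memory_V u p t v /\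
    b (u t) q - c (p t) q = g t q + memory_Q u p t q}.

(* eu = u - u_I, ep = p - p_I *)
Definition functional_F (eu : R -> V) (ep : R -> Q) (t : R) (v : V) : R :=
  a (eu t) v + b v (ep t) - memory_V eu ep t v.

Definition functional_G (eu : R -> V) (ep : R -> Q) (t : R) (q : Q) : R :=
  b (eu t) q - c (ep t) q - memory_Q eu ep t q.

End Problem.

Definition triangle (R : realType) (T : R) : set (R * R) :=
  [set x | 0 <= x.2 /\ x.2 <= x.1 /\ x.1 <= T].

Definition bounded_kernel (R : realType) (T : R) (k : R -> R -> R) (Ck : R) :=
  {within triangle T, continuous (fun x : R * R => k x.1 x.2)} /\
  (forall t s, triangle T (t, s) -> `|k t s| <= Ck).

(* Main.v *)
Require Import Defs.
From mathcomp Require Import all_boot all_order all_algebra.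
From mathcomp Require Import all_classical all_reals all_analysis measurable_realfun ring lra.
Set Implicit Arguments.
Unset Strict Implicit.
Unset Printing Implicit Defensive.
Import Order.TTheory GRing.Theory Num.Theory.
Import numFieldNormedType.Exports.
Local Open Scope classical_set_scope.
Local Open Scope ring_scope.

(* For fixed t the discrete equations are a saddle point problem whose solution
   is bounded by the dual norms of the data: the inf-sup conditions control the
   components orthogonal to the kernels by the energy a(u,u) + c(p,p), which the
   data control, and coercivity on the kernels controls the rest.  Moving the
   memory terms into the data turns this into a Gronwall inequality in L^1, which
   is solved on time steps so short that the memory is absorbed.  Applied to the
   difference of two solutions it gives uniqueness; applied to the error equation,
   whose data are F and G, it gives the four bounds and the quasi-optimality.
   Existence is a Volterra equation of the second kind for the coordinates in
   orthonormal bases, solved by its Neumann series. *)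


(** * Calculus of functions and integrals up to null sets *)

Section AlmostEverywhere.
Context {R : realType}.
Local Notation mu := (@lebesgue_measure R).

(** What shapes the estimates is that the sixteen constants may depend on the norms of [a] and [c]
    but not on that of [b]. No estimate that enters them bounds [b] by its norm: the equations
    express [b v p] and [b u q] by the data and by values of [a] and [c], and the inf-sup conditions
    are applied to these expressions. As [a] and [c] are only semi-definite, their values are in
    turn bounded by the square root of the energy. The energy is at most the data times [|u| + |p|],
    so its root contains the unknown again, but only to the power one half, and Young's inequality
    absorbs it. The norm of [b] enters a constant only at the very end, when the functionals F and G
    are compared with the interpolation error. One constant serves as all of C_1, ..., C_16:
    orthogonal projections do not increase norms, so a bound on the sum of both full errors bounds
    each component, and the dual norm of F or G is at most the sum of those of its two parts. *)

Lemma ae_imp2 (P Q S : R -> Prop) :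
  {ae mu, forall t, P t} -> {ae mu, forall t, Q t} ->
  (forall t, P t -> Q t -> S t) -> {ae mu, forall t, S t}.
Proof.
move=> hP hQ PQS.
exact: (@filterS2 _ _ (ae_filter_ringOfSetsType mu) _ _ _ PQS hP hQ).
Qed.

Lemma ae_imp (P S : R -> Prop) :
  {ae mu, forall t, P t} -> (forall t, P t -> S t) -> {ae mu, forall t, S t}.
Proof.
move=> hP PS; exact: (@filterS _ _ (ae_filter_ringOfSetsType mu) _ _ PS hP).
Qed.

Import HBNNSimple.

(* Neither function is assumed to be measurable: Lebesgue measure lives on the
   Borel sigma-algebra, so a function which is a.e. equal to a measurable one
   need not be measurable. *)
Lemma ae_le_integral_ge0 (D : set R) (f g : R -> \bar R) :
  (forall x, D x -> (0 <= f x)%E) -> (forall x, D x -> (0 <= g x)%E) ->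
  {ae mu, forall x, D x -> (f x <= g x)%E} ->
  (\int[mu]_(x in D) f x <= \int[mu]_(x in D) g x)%E.
Proof.
move=> f0 g0 [N [mN N0 fgN]]; rewrite !ge0_integralE//.
apply: ge_ereal_sup => _ [h /= hf <-].
(* Setting a simple function below [f] to zero on the null set [N] puts it below [g] everywhere
   without changing its integral. *)
pose h' := proj_nnsfun h (measurableC mN).
apply: (@le_trans _ _ (sintegral mu h')); last first.
  apply: ereal_sup_ubound; exists h' => //= x.
  have pg0 : (0 <= (g \_ D) x)%E.
    by rewrite /patch; case: ifP => // /set_mem/g0.
  rewrite mindicE; case: (boolP (x \in ~` N)) => [xN|_]; last by rewrite mulr0.
  rewrite mulr1 (le_trans (hf x)) // /patch; case: ifPn => // /set_mem Dx.
  apply: contrapT => fg; move/set_mem: xN; apply; apply: fgN => /=.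
  by move=> /(_ Dx).
rewrite -!integralT_nnsfun le_eqVlt; apply/orP; left; apply/eqP.
apply: ae_eq_integral => //.
- exact/measurable_EFinP.
- exact/measurable_EFinP.
exists N; split => // x /= hx; apply: contrapT => xN; apply: hx => _.
by rewrite mindicE mem_set // mulr1.
Qed.

Lemma ae_eq_integral_ge0 (D : set R) (f g : R -> \bar R) :
  (forall x, D x -> (0 <= f x)%E) -> (forall x, D x -> (0 <= g x)%E) ->
  {ae mu, forall x, D x -> f x = g x} ->
  (\int[mu]_(x in D) f x = \int[mu]_(x in D) g x)%E.
Proof.
move=> f0 g0 fg; apply/eqP; rewrite eq_le; apply/andP; split;
  apply: ae_le_integral_ge0 => //; apply: (ae_imp fg) => x {}fg /fg -> //.
Qed.

Lemma ae_eq_Rintegral (D : set R) (f g : R -> R) :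
  {ae mu, forall x, D x -> f x = g x} ->
  \int[mu]_(x in D) f x = \int[mu]_(x in D) g x.
Proof.
move=> fg; congr fine; rewrite integralE [RHS]integralE.
congr (_ - _)%E; apply: ae_eq_integral_ge0 => //; apply: (ae_imp fg) => x {}fg Dx;
  by rewrite ?funeposE ?funenegE fg.
Qed.

(** Measurability for the completed measure on [[0, T]]. An a.e. limit of simple functions is in
    general only a.e. equal to a Borel function, and this class is stable under changes on null
    sets. *)
Definition ae_measurable (T : R) (f : R -> R) :=
  exists g : R -> R, measurable_fun [set: R] g /\
    {ae mu, forall t, `[0, T]%classic t -> f t = g t}.

Definition ae_integrable (T : R) (f : R -> R) :=
  exists g : R -> R, [/\ measurable_fun [set: R] g,
    mu.-integrable `[0, T] (EFin \o g) &
    {ae mu, forall t, `[0, T]%classic t -> f t = g t}].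

Section Fixed.
Variable T : R.

Lemma measurable_ae_measurable (f : R -> R) : measurable_fun [set: R] f -> ae_measurable T f.
Proof. by move=> mf; exists f; split => //; exact: aeW. Qed.

Lemma ae_measurable_cst k : ae_measurable T (cst k).
Proof. exact/measurable_ae_measurable. Qed.

Lemma ae_eq_ae_measurable (f g : R -> R) :
  {ae mu, forall t, `[0, T]%classic t -> f t = g t} ->
  ae_measurable T g -> ae_measurable T f.
Proof.
move=> fg [h [mh gh]]; exists h; split => //.
by apply: (ae_imp2 fg gh) => t {}fg {}gh Jt; rewrite fg// gh.
Qed.

Lemma ae_measurableD (f g : R -> R) :
  ae_measurable T f -> ae_measurable T g -> ae_measurable T (fun t => f t + g t).
Proof.
move=> [f' [mf ff]] [g' [mg gg]]; exists (fun t => f' t + g' t); split.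
  exact: measurable_funD.
by apply: (ae_imp2 ff gg) => t {}ff {}gg Jt; rewrite ff// gg.
Qed.

Lemma ae_measurableM (f g : R -> R) :
  ae_measurable T f -> ae_measurable T g -> ae_measurable T (fun t => f t * g t).
Proof.
move=> [f' [mf ff]] [g' [mg gg]]; exists (fun t => f' t * g' t); split.
  exact: measurable_funM.
by apply: (ae_imp2 ff gg) => t {}ff {}gg Jt; rewrite ff// gg.
Qed.

Lemma ae_measurable_comp (h f : R -> R) : continuous h ->
  ae_measurable T f -> ae_measurable T (fun t => h (f t)).
Proof.
move=> ch [f' [mf ff]]; exists (h \o f'); split.
  by apply: measurableT_comp => //; exact: continuous_measurable_fun.
by apply: (ae_imp ff) => t {}ff Jt; rewrite /= ff.
Qed.

Lemma ae_measurableN (f : R -> R) : ae_measurable T f -> ae_measurable T (fun t => - f t).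
Proof. move=> mf; under eq_fun do rewrite -mulN1r.
by apply: ae_measurableM => //; exact: ae_measurable_cst. Qed.

Lemma ae_measurableB (f g : R -> R) :
  ae_measurable T f -> ae_measurable T g -> ae_measurable T (fun t => f t - g t).
Proof. by move=> mf mg; apply: ae_measurableD => //; exact: ae_measurableN. Qed.

Lemma ae_measurable_norm (f : R -> R) : ae_measurable T f -> ae_measurable T (fun t => `|f t|).
Proof. by move=> mf; exact: (ae_measurable_comp (@norm_continuous _ R^o) mf). Qed.

Lemma ae_measurable_sum (I : Type) (r : seq I) (f : I -> R -> R) :
  (forall i, ae_measurable T (f i)) ->
  ae_measurable T (fun t => \sum_(i <- r) f i t).
Proof.
move=> mf; elim: r => [|i r IH].
  by under eq_fun do rewrite big_nil; exact: ae_measurable_cst.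
by under eq_fun do rewrite big_cons; exact: ae_measurableD.
Qed.

(** Outside one null Borel set the Borel representatives of all the [f_ n] converge to [f]; set to
    zero on it, they converge everywhere, to a Borel function. *)
Lemma ae_measurable_cvg (f_ : nat -> R -> R) (f : R -> R) :
  (forall n, ae_measurable T (f_ n)) ->
  {ae mu, forall t, `[0, T]%classic t -> f_ n t @[n --> \oo] --> f t} ->
  ae_measurable T f.
Proof.
move=> /choice[g_ fg] ff.
have gf : {ae mu, forall t, `[0, T]%classic t -> g_ n t @[n --> \oo] --> f t}.
  have : {ae mu, forall t, forall n, `[0, T]%classic t -> f_ n t = g_ n t}.
    by apply: ae_foralln => n; have [] := fg n.
  move=> e; apply: (ae_imp2 ff e) => {}t {}ff {}e Jt; have := ff Jt.
  by under eq_fun do rewrite e//.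
have [N [mN N0 sN]] := gf.
pose C := `[0%R, T]%classic `&` ~` N.
have mC : measurable C by apply: measurableI => //; exact: measurableC.
exists (f \_ C); split; last first.
  exists N; split => // t /= ft; apply: contrapT => tN; apply: ft => Jt.
  by rewrite patchE mem_set.
apply: (@measurable_fun_cvg _ _ _ _ (fun n => g_ n \_ C)).
  move=> n; apply/(measurable_restrictT _ _).1 => //.
  by apply: measurable_funTS; have [] := fg n.
move=> t _; rewrite patchE; case: ifPn => tC.
  under eq_fun do rewrite patchE tC.
  move/set_mem : tC => -[Jt tN].
  by apply: contrapT => ct; apply: tN; apply: sN => /= /(_ Jt).
by under eq_fun do rewrite patchE (negbTE tC); exact: cvg_cst.
Qed.

Lemma ae_measurable_ge0 (f : R -> R) : (forall t, 0 <= f t) -> ae_measurable T f ->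
  exists g : R -> R, [/\ measurable_fun [set: R] g, (forall t, 0 <= g t) &
    {ae mu, forall t, `[0, T]%classic t -> f t = g t}].
Proof.
move=> f0 [g [mg fg]]; exists (fun t => `|g t|); split => //.
  exact: measurableT_comp.
by apply: (ae_imp fg) => t {}fg Jt; rewrite -fg// ger0_norm.
Qed.

Lemma int_J_ge0 (f : R -> R) : (forall t, 0 <= f t) -> (0 <= int_J T f)%E.
Proof. by move=> f0; apply: integral_ge0 => t _; rewrite lee_fin. Qed.

Lemma le_int_J (f g : R -> R) : (forall t, 0 <= f t) -> (forall t, 0 <= g t) ->
  {ae mu, forall t, `[0, T]%classic t -> f t <= g t} ->
  (int_J T f <= int_J T g)%E.
Proof.
move=> f0 g0 fg; apply: ae_le_integral_ge0 => [t _|t _|]; rewrite ?lee_fin//.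
Qed.

Lemma eq_int_J (f g : R -> R) : (forall t, 0 <= f t) -> (forall t, 0 <= g t) ->
  {ae mu, forall t, `[0, T]%classic t -> f t = g t} ->
  int_J T f = int_J T g.
Proof.
move=> f0 g0 fg; apply: ae_eq_integral_ge0 => [t _|t _|]; rewrite ?lee_fin//.
by apply: (ae_imp fg) => t {}fg /fg ->.
Qed.

Lemma int_JD (f g : R -> R) : (forall t, 0 <= f t) -> (forall t, 0 <= g t) ->
  ae_measurable T f -> ae_measurable T g ->
  int_J T (fun t => f t + g t) = (int_J T f + int_J T g)%E.
Proof.
move=> f0 g0 /(ae_measurable_ge0 f0)[f' [mf f'0 ff]].
move=> /(ae_measurable_ge0 g0)[g' [mg g'0 gg]].
rewrite (eq_int_J f0 f'0 ff) (eq_int_J g0 g'0 gg).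
rewrite (@eq_int_J _ (fun t => f' t + g' t)) => [|t|t|]; rewrite ?addr_ge0//.
  rewrite /int_J -ge0_integralD//=.
  - by move=> t _; rewrite lee_fin.
  - exact/measurable_EFinP/measurable_funTS.
  - by move=> t _; rewrite lee_fin.
  - exact/measurable_EFinP/measurable_funTS.
by apply: (ae_imp2 ff gg) => t {}ff {}gg Jt; rewrite ff// gg.
Qed.

Lemma int_JZ (k : R) (f : R -> R) : 0 <= k -> (forall t, 0 <= f t) -> ae_measurable T f ->
  int_J T (fun t => k * f t) = (k%:E * int_J T f)%E.
Proof.
move=> k0 f0 /(ae_measurable_ge0 f0)[f' [mf f'0 ff]].
rewrite (eq_int_J f0 f'0 ff).
rewrite (@eq_int_J _ (fun t => k * f' t)) => [|t|t|]; rewrite ?mulr_ge0//.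
  rewrite /int_J -ge0_integralZl//.
  - exact/measurable_EFinP/measurable_funTS.
  - by move=> t _; rewrite lee_fin.
by apply: (ae_imp ff) => t {}ff Jt; rewrite ff.
Qed.

Lemma int_J_eq0 (f : R -> R) : (forall t, 0 <= f t) -> ae_measurable T f ->
  int_J T f = 0%E -> {ae mu, forall t, `[0, T]%classic t -> f t = 0}.
Proof.
move=> f0 /(ae_measurable_ge0 f0)[f' [mf f'0 ff]].
rewrite (eq_int_J f0 f'0 ff) => I0.
have : ae_eq mu `[0, T]%classic (EFin \o f') (cst 0%E).
  apply/ae_eq_integral_abs => //; first exact/measurable_EFinP/measurable_funTS.
  by rewrite -[RHS]I0; apply: eq_integral => t _; rewrite /= ger0_norm.
by move=> f'e; apply: (ae_imp2 ff f'e) => t {}ff {}f'e Jt; rewrite ff//; have [] := f'e Jt.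
Qed.

Lemma ae_integrable_measurable (f : R -> R) :
  ae_integrable T f -> ae_measurable T f.
Proof. by move=> [g [mg _ fg]]; exists g. Qed.

Lemma ae_integrable_int_J (f : R -> R) :
  ae_integrable T f -> (int_J T (fun t => `|f t|%R) < +oo)%E.
Proof.
move=> [g [mg /integrableP[_ ig] fg]].
rewrite (@eq_int_J _ (fun t => `|g t|))//.
by apply: (ae_imp fg) => t {}fg Jt; rewrite fg.
Qed.

Lemma ae_integrableP (f : R -> R) : ae_measurable T f ->
  (int_J T (fun t => `|f t|%R) < +oo)%E -> ae_integrable T f.
Proof.
move=> [g [mg fg]]; rewrite (@eq_int_J _ (fun t => `|g t|))//; last first.
  by apply: (ae_imp fg) => t {}fg Jt; rewrite fg.
move=> ig; exists g; split => //; apply/integrableP; split => //.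
exact/measurable_EFinP/measurable_funTS.
Qed.

Lemma ae_integrable_le (f g : R -> R) : ae_measurable T f ->
  {ae mu, forall t, `[0, T]%classic t -> `|f t| <= g t} ->
  ae_integrable T g -> ae_integrable T f.
Proof.
move=> mf fg ig; apply: ae_integrableP => //.
apply: le_lt_trans (ae_integrable_int_J ig); apply: le_int_J => //.
by apply: (ae_imp fg) => t {}fg Jt; rewrite (le_trans (fg Jt))// ler_norm.
Qed.

Lemma ae_integrable_norm (f : R -> R) :
  ae_integrable T f -> ae_integrable T (fun t => `|f t|).
Proof.
move=> fi; have fm := ae_integrable_measurable fi.
apply: ae_integrableP; first exact: ae_measurable_norm.
by under eq_fun do rewrite normr_id; exact: ae_integrable_int_J.
Qed.

Lemma ae_integrableD (f g : R -> R) : ae_integrable T f -> ae_integrable T g ->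
  ae_integrable T (fun t => f t + g t).
Proof.
move=> [f' [mf fi ff]] [g' [mg gi gg]]; exists (fun t => f' t + g' t); split.
- exact: measurable_funD.
- by have := @integrableD _ _ _ mu _ (measurable_itv `[0, T]) _ _ fi gi.
- by apply: (ae_imp2 ff gg) => t {}ff {}gg Jt; rewrite ff// gg.
Qed.

Lemma ae_integrableZ (k : R) (f : R -> R) : ae_integrable T f ->
  ae_integrable T (fun t => k * f t).
Proof.
move=> [f' [mf fi ff]]; exists (fun t => k * f' t); split.
- exact: measurable_funM.
- by have := @integrableZl _ _ _ mu _ (measurable_itv `[0, T]) k _ fi.
- by apply: (ae_imp ff) => t {}ff Jt; rewrite ff.
Qed.

Lemma ae_integrable0 : ae_integrable T (fun=> 0).
Proof.
exists (fun=> 0); split; [exact: measurable_cst| |exact: aeW].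
exact: integrable0.
Qed.

Lemma ae_integrable_sum (I : Type) (r : seq I) (f : I -> R -> R) :
  (forall i, ae_integrable T (f i)) ->
  ae_integrable T (fun t => \sum_(i <- r) f i t).
Proof.
move=> mf; elim: r => [|i r IH].
  by under eq_fun do rewrite big_nil; exact: ae_integrable0.
by under eq_fun do rewrite big_cons; exact: ae_integrableD.
Qed.

(** * Integrals over initial segments of [[0, T]] *)

Section Initial.
Variable t : R.
Hypothesis tT : t <= T.

Let sub0 : `[0%R, t]%classic `<=` `[0%R, T]%classic.
Proof. by move=> s /=; rewrite !in_itv /= => /andP[-> /le_trans->]. Qed.

Let aesub (P : R -> Prop) : {ae mu, forall s, `[0, T]%classic s -> P s} ->
  {ae mu, forall s, `[0, t]%classic s -> P s}.
Proof. by move=> h; apply: (ae_imp h) => s Ps /sub0. Qed.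

Let intsub (f : R -> R) : mu.-integrable `[0, T] (EFin \o f) ->
  mu.-integrable `[0, t] (EFin \o f).
Proof. by move=> fi; apply: integrableS fi. Qed.

Lemma Rintegral_aeD (f g : R -> R) : ae_integrable T f -> ae_integrable T g ->
  \int[mu]_(s in `[0, t]) (f s + g s) =
  \int[mu]_(s in `[0, t]) f s + \int[mu]_(s in `[0, t]) g s.
Proof.
move=> [f' [mf /intsub fi /aesub ff]] [g' [mg /intsub gi /aesub gg]].
rewrite (ae_eq_Rintegral ff) (ae_eq_Rintegral gg) -RintegralD//.
apply: ae_eq_Rintegral.
by apply: (ae_imp2 ff gg) => s {}ff {}gg Jt; rewrite ff// gg.
Qed.

Lemma Rintegral_aeZ (k : R) (f : R -> R) : ae_integrable T f ->
  \int[mu]_(s in `[0, t]) (k * f s) = k * \int[mu]_(s in `[0, t]) f s.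
Proof.
move=> [f' [mf /intsub fi /aesub ff]].
rewrite (ae_eq_Rintegral ff) -RintegralZl//; apply: ae_eq_Rintegral.
by apply: (ae_imp ff) => s {}ff Jt; rewrite ff.
Qed.

Lemma Rintegral_aeB (f g : R -> R) : ae_integrable T f -> ae_integrable T g ->
  \int[mu]_(s in `[0, t]) (f s - g s) =
  \int[mu]_(s in `[0, t]) f s - \int[mu]_(s in `[0, t]) g s.
Proof.
move=> fi gi; rewrite -mulN1r -Rintegral_aeZ// -Rintegral_aeD//.
  by under eq_Rintegral do rewrite -mulN1r.
exact: ae_integrableZ.
Qed.

Lemma Rintegral_ae_sum (I : Type) (r : seq I) (f : I -> R -> R) :
  (forall i, ae_integrable T (f i)) ->
  \int[mu]_(s in `[0, t]) (\sum_(i <- r) f i s) =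
  \sum_(i <- r) \int[mu]_(s in `[0, t]) f i s.
Proof.
move=> fi; elim: r => [|i r IH].
  by under eq_Rintegral do rewrite big_nil; rewrite big_nil Rintegral_cst// mul0r.
under eq_Rintegral do rewrite big_cons.
by rewrite big_cons Rintegral_aeD ?IH//; exact: ae_integrable_sum.
Qed.

Lemma le_ae_Rintegral (f g : R -> R) : ae_integrable T f -> ae_integrable T g ->
  {ae mu, forall s, `[0, T]%classic s -> f s <= g s} ->
  \int[mu]_(s in `[0, t]) f s <= \int[mu]_(s in `[0, t]) g s.
Proof.
move=> fi gi fg; rewrite -subr_ge0 -Rintegral_aeB//.
(* The absolute value makes the integrand nonnegative at every point and changes it only on a null
   set. *)
rewrite (@ae_eq_Rintegral _ _ (fun s => `|g s - f s|)).
  exact: Rintegral_ge0.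
move/aesub in fg; apply: (ae_imp fg) => s {}fg Jt.
by rewrite ger0_norm// subr_ge0 fg.
Qed.

Lemma normr_Rintegral_ae (f g : R -> R) :
  ae_integrable T f -> ae_integrable T g ->
  {ae mu, forall s, `[0, T]%classic s -> `|f s| <= g s} ->
  `|\int[mu]_(s in `[0, t]) f s| <= \int[mu]_(s in `[0, t]) g s.
Proof.
move=> fi gi fg; rewrite ler_norml; apply/andP; split; last first.
  apply: le_ae_Rintegral => //.
  by apply: (ae_imp fg) => s {}fg Jt; rewrite (le_trans (ler_norm _)) ?fg.
rewrite lerNl -mulN1r -Rintegral_aeZ//; apply: le_ae_Rintegral => //.
  exact: ae_integrableZ.
apply: (ae_imp fg) => s {}fg Jt; rewrite mulN1r.
by rewrite (le_trans (ler_norm _)) ?normrN ?fg.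
Qed.

Lemma Rintegral_ae_EFin (f : R -> R) : (forall s, 0 <= f s) ->
  ae_integrable T f ->
  (\int[mu]_(s in `[0, t]) f s)%:E = (\int[mu]_(s in `[0%R, t]) (f s)%:E)%E.
Proof.
move=> f0 fi; rewrite fineK// ge0_fin_numE; last first.
  by apply: integral_ge0 => s _; rewrite lee_fin.
apply: le_lt_trans (ae_integrable_int_J fi).
rewrite integral_mkcond [leRHS]integral_mkcond; apply: ae_le_integral_ge0.
- by move=> s _; rewrite patchE; case: ifP; rewrite ?lee_fin.
- by move=> s _; rewrite patchE; case: ifP; rewrite ?lee_fin.
apply: aeW => s _; rewrite !patchE; case: ifPn => [/set_mem/sub0/mem_set ->|_].
  by rewrite lee_fin ler_norm.
by case: ifP; rewrite ?lee_fin.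
Qed.

Lemma Rintegral_ae_le_J (f : R -> R) : (forall s, 0 <= f s) ->
  ae_integrable T f ->
  ((\int[mu]_(s in `[0, t]) f s)%:E <= int_J T f)%E.
Proof.
move=> f0 fi; rewrite Rintegral_ae_EFin//.
rewrite integral_mkcond /int_J [leRHS]integral_mkcond; apply: ae_le_integral_ge0.
- by move=> s _; rewrite patchE; case: ifP; rewrite ?lee_fin.
- by move=> s _; rewrite patchE; case: ifP; rewrite ?lee_fin.
apply: aeW => s _; rewrite !patchE; case: ifPn => [/set_mem/sub0/mem_set ->//|_].
by case: ifP; rewrite ?lee_fin.
Qed.

End Initial.
End Fixed.
End AlmostEverywhere.


Import HBSimple.

(** * Strongly measurable functions and Bochner spaces *)

Section StrongMeasurability.
Context {R : realType}.
Local Notation mu := (@lebesgue_measure R).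

Lemma simple_fun_comp (X Y : Type) (A : set X) (B : set Y) (h : X -> Y)
    (s : R -> X) :
  {homo h : x / A x >-> B x} -> simple_fun A s -> simple_fun B (h \o s).
Proof.
move=> hAB [fs sA ms]; split.
- have -> : range (h \o s) = h @` range s by rewrite image_comp.
  exact: finite_image.
- by move=> _ [t _ <-]; apply/hAB/sA; exists t.
- move=> y; have -> : (h \o s) @^-1` [set y] =
      \bigcup_(x in range s `&` h @^-1` [set y]) (s @^-1` [set x]).
    apply/seteqP; split => [t /= ht|t [x [_ /= hx] /= ->]//].
    by exists (s t) => //; split => //; exists t.
  by apply: fin_bigcup_measurable => //; exact: finite_setIl.
Qed.

Lemma simple_fun_pair (X Y : Type) (A : set X) (B : set Y) (s : R -> X)
    (s' : R -> Y) :
  simple_fun A s -> simple_fun B s' ->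
  simple_fun (A `*` B) (fun t => (s t, s' t)).
Proof.
move=> [fs sA ms] [fs' sB ms']; split.
- apply: (sub_finite_set (B := range s `*` range s')); last exact: finite_setX.
  by move=> _ [t _ <-]; split => /=; exists t.
- by move=> _ [t _ <-]; split => /=; [apply: sA|apply: sB]; exists t.
- move=> [x y].
  have -> : (fun t => (s t, s' t)) @^-1` [set (x, y)] =
      s @^-1` [set x] `&` s' @^-1` [set y].
    by apply/seteqP; split => [t /= [-> ->]|t [/= -> ->]].
  exact: measurableI.
Qed.

Variable T : R.

Lemma strongly_measurable_comp (X Y : normedModType R) (A : set X) (B : set Y)
    (h : X -> Y) (u : R -> X) : continuous h -> {homo h : x / A x >-> B x} ->
  strongly_measurable T A u -> strongly_measurable T B (h \o u).
Proof.
move=> ch hAB [s_ [ss su]]; exists (fun n => h \o s_ n); split.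
  by move=> n; exact: simple_fun_comp (ss n).
apply: (ae_imp su) => t {}su Jt.
by apply: (@cvg_comp _ _ _ (s_ ^~ t) h _ _ _ (su Jt)); exact: ch.
Qed.

Lemma strongly_measurable_pair (X Y : normedModType R) (A : set X) (B : set Y)
    (u : R -> X) (v : R -> Y) :
  strongly_measurable T A u -> strongly_measurable T B v ->
  strongly_measurable T (A `*` B) (fun t => (u t, v t) : X * Y).
Proof.
move=> [s_ [ss su]] [s'_ [ss' sv]]; exists (fun n t => (s_ n t, s'_ n t)); split.
  by move=> n; exact: simple_fun_pair.
by apply: (ae_imp2 su sv) => t {}su {}sv Jt; apply: cvg_pair; [exact: su|exact: sv].
Qed.

Lemma strongly_measurableD (X : normedModType R) (A B C : set X)
    (u v : R -> X) : (forall x y, A x -> B y -> C (x + y)) ->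
  strongly_measurable T A u -> strongly_measurable T B v ->
  strongly_measurable T C (fun t => u t + v t).
Proof.
move=> AB mu mv.
apply: (strongly_measurable_comp (h := fun x : X * X => x.1 + x.2) _ _
  (strongly_measurable_pair mu mv)).
- exact: add_continuous.
- by move=> [x y] [/= Ax By]; exact: AB.
Qed.

Lemma strongly_measurableB (X : normedModType R) (A B C : set X)
    (u v : R -> X) : (forall x y, A x -> B y -> C (x - y)) ->
  strongly_measurable T A u -> strongly_measurable T B v ->
  strongly_measurable T C (fun t => u t - v t).
Proof.
move=> AB mu mv; apply: (@strongly_measurableD _ A (-%R @` B) C) mu _.
  by move=> x _ Ax [y By <-]; exact: AB.
apply: (strongly_measurable_comp (h := -%R) _ _ mv).
- exact: opp_continuous.
- by move=> y By; exists y.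
Qed.

(** The passage from vector-valued to scalar functions of time: norms, and forms or functionals at a
    fixed test vector, are all of the shape [h (u t)]. A simple function takes finitely many values,
    so the preimage of any set under [h] composed with it is a finite union of measurable sets. *)
Lemma ae_measurable_continuous (X : normedModType R) (A : set X) (h : X -> R)
    (u : R -> X) : continuous (h : X -> R^o) ->
  strongly_measurable T A u -> ae_measurable T (fun t => h (u t)).
Proof.
move=> ch [s_ [ss su]].
apply: (@ae_measurable_cvg _ _ (fun n t => h (s_ n t))); last first.
  apply: (ae_imp su) => t {}su Jt.
  by apply: (@cvg_comp _ _ _ (s_ ^~ t) h _ _ _ (su Jt)); exact: ch.
move=> n; apply: measurable_ae_measurable => _ B mB; rewrite setTI.
have [fs _ ms] := ss n.
have -> : (fun t => h (s_ n t)) @^-1` B =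
    \bigcup_(x in range (s_ n) `&` h @^-1` B) (s_ n @^-1` [set x]).
  apply/seteqP; split => [t /= ht|t [x [_ /= hx] /= ->]//].
  by exists (s_ n t) => //; split => //; exists t.
by apply: fin_bigcup_measurable => //; exact: finite_setIl.
Qed.

(** The converse passage, from scalar coordinates to vectors: real simple functions approximating
    [f] are multiplied by the fixed vector [e]. *)
Lemma strongly_measurableZ (X : normedModType R) (A : set X) (f : R -> R)
    (e : X) : (forall x : R, A (x *: e)) -> ae_measurable T f ->
  strongly_measurable T A (fun t => f t *: e).
Proof.
move=> Ae [f' [mf ff]].
have [||g gf] := @approximation_sfun _ _ _ (EFin \o f') setT.
- exact: measurableT.
- exact/measurable_EFinP.
exists (fun n t => g n t *: e); split.
  move=> n; have sg : simple_fun (setT : set R^o) (g n).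
    split => [|y _ //|x]; first exact: fimfunP.
    by rewrite -[X in measurable X]setTI; exact: measurable_funP.
  by apply: (simple_fun_comp (h := fun x : R^o => x *: e) _ sg) => x _; exact: Ae.
apply: (ae_imp ff) => t {}ff Jt; apply: cvgZr_tmp; rewrite ff//.
by have /fine_cvgP[] := gf t Logic.I.
Qed.

Lemma strongly_measurable_cst (X : normedModType R) (A : set X) (x : X) :
  A x -> strongly_measurable T A (cst x).
Proof.
move=> Ax; exists (fun=> cst x); split; last by apply: aeW => t _; exact: cvg_cst.
move=> n; split => [|_ [t _ <-]//|y].
- by apply: (sub_finite_set (B := [set x])) => // _ [t _ <-].
- rewrite preimage_cst; case: ifP => _ //; exact: measurableT.
Qed.

Lemma strongly_measurable_sum (X : normedModType R) (A : set X) (I : Type)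
    (r : seq I) (u : I -> R -> X) :
  A 0 -> (forall x y, A x -> A y -> A (x + y)) ->
  (forall i, strongly_measurable T A (u i)) ->
  strongly_measurable T A (fun t => \sum_(i <- r) u i t).
Proof.
move=> A0 AD mu; elim: r => [|i r IH].
  by under eq_fun do rewrite big_nil; exact: strongly_measurable_cst.
by under eq_fun do rewrite big_cons; exact: strongly_measurableD (mu i) IH.
Qed.

Lemma bochner_norm (X : normedModType R) (A : set X) (u : R -> X) :
  bochner_L1 T A u -> ae_integrable T (fun t => `|u t|).
Proof.
move=> [mu _ iu]; apply: ae_integrableP.
  apply: (ae_measurable_continuous _ mu); exact: norm_continuous.
by under eq_fun do rewrite normr_id.
Qed.

Lemma bochner_L1_le (X : normedModType R) (A : set X) (u : R -> X) (w : R -> R) :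
  strongly_measurable T A u ->
  {ae mu, forall t, `[0, T]%classic t -> A (u t)} ->
  {ae mu, forall t, `[0, T]%classic t -> `|u t| <= w t} ->
  ae_integrable T w -> bochner_L1 T A u.
Proof.
move=> su uA uw iw; split => //.
apply: le_lt_trans (ae_integrable_int_J iw); apply: le_int_J => //.
by apply: (ae_imp uw) => t {}uw Jt; rewrite (le_trans (uw Jt))// ler_norm.
Qed.

Lemma bochner_L1B (X : normedModType R) (A B C : set X) (u v : R -> X) :
  (forall x y, A x -> B y -> C (x - y)) ->
  bochner_L1 T A u -> bochner_L1 T B v -> bochner_L1 T C (fun t => u t - v t).
Proof.
move=> AB bu bv; have := bochner_norm bu; have := bochner_norm bv.
have [su uA _] := bu; have [sv vB _] := bv => iv iu.
apply: (@bochner_L1_le _ _ _ (fun t => `|u t| + `|v t|)).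
- exact: strongly_measurableB AB su sv.
- by apply: (ae_imp2 uA vB) => t {}uA {}vB Jt; apply: AB; [exact: uA|exact: vB].
- by apply: aeW => t _; exact: ler_normB.
- exact: ae_integrableD.
Qed.

Lemma bochner_L1_comp (X Y : normedModType R) (A : set X) (B : set Y)
    (h : X -> Y) (u : R -> X) : continuous h -> {homo h : x / A x >-> B x} ->
  (forall x, `|h x| <= `|x|) -> bochner_L1 T A u -> bochner_L1 T B (h \o u).
Proof.
move=> ch hAB hle bu; have iu := bochner_norm bu; have [su uA _] := bu.
apply: (bochner_L1_le _ _ _ iu); first exact: strongly_measurable_comp su.
- by apply: (ae_imp uA) => t {}uA /uA; exact: hAB.
- by apply: aeW => t _; exact: hle.
Qed.

Lemma bochner_L1_fst (X Y : normedModType R) (u : R -> X) (p : R -> Y) :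
  bochner_L1 T setT (fun t => (u t, p t) : X * Y) -> bochner_L1 T setT u.
Proof.
move=> /(bochner_L1_comp (h := fst) (B := setT)); apply => //.
- by move=> x; exact: cvg_fst.
- by move=> x; rewrite prod_normE le_max lexx.
Qed.

Lemma bochner_L1_snd (X Y : normedModType R) (u : R -> X) (p : R -> Y) :
  bochner_L1 T setT (fun t => (u t, p t) : X * Y) -> bochner_L1 T setT p.
Proof.
move=> /(bochner_L1_comp (h := snd) (B := setT)); apply => //.
- by move=> x; exact: cvg_snd.
- by move=> x; rewrite prod_normE le_max lexx orbT.
Qed.

End StrongMeasurability.


(** * Bounds for continuous bilinear forms *)

Section Forms.
Context {R : realType}.

Lemma bilinear_linearl (V W : lmodType R) (f : {bilinear V -> W -> R^o}) k x y w :
  f (k *: x + y) w = k * f x w + f y w.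
Proof. by rewrite linearDl linearZl_LR. Qed.

Lemma bilinear_linearr (V W : lmodType R) (f : {bilinear V -> W -> R^o}) k x y v :
  f v (k *: x + y) = k * f v x + f v y.
Proof. by rewrite linearDr linearZr_LR. Qed.

Lemma bilinearZl (V W : lmodType R) (f : {bilinear V -> W -> R^o}) k x w :
  f (k *: x) w = k * f x w.
Proof. by rewrite linearZl_LR. Qed.

Lemma bilinearZr (V W : lmodType R) (f : {bilinear V -> W -> R^o}) k x v :
  f v (k *: x) = k * f v x.
Proof. by rewrite linearZr_LR. Qed.

Lemma bilinearBl (V W : lmodType R) (f : {bilinear V -> W -> R^o}) x y w :
  f (x - y) w = (f x w : R) - (f y w : R).
Proof. exact: linearBl. Qed.

Lemma bilinearBr (V W : lmodType R) (f : {bilinear V -> W -> R^o}) x y v :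
  f v (x - y) = (f v x : R) - (f v y : R).
Proof. exact: linearBr. Qed.

(** Stated for the three coefficients of a quadratic form, so that it serves the inner product as
    well as forms that are only semi-definite, where [vv] may vanish for a nonzero vector. *)
Lemma psd_cauchy_schwarz (uu uv vv : R) :
  (forall x y, 0 <= x ^+ 2 * uu + 2 * (x * y) * uv + y ^+ 2 * vv) ->
  uv ^+ 2 <= uu * vv.
Proof.
move=> h; have := h 0 1; rewrite expr0n expr1n /= !(mul0r, mulr0) !add0r mul1r.
rewrite le_eqVlt => /predU1P[vv0|vv0]; last first.
  (* For [vv > 0], the quadratic form at [(vv, - uv)] equals [vv * (uu * vv - uv ^+ 2)]. *)
  rewrite -subr_ge0 -(pmulr_rge0 _ vv0); have := h vv (- uv); nra.
(* For [vv = 0], this pair turns the quadratic form into [- uv ^+ 2], which forces [uv = 0]. *)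
have := h uv (- (uu + 1) / 2); rewrite -vv0; nra.
Qed.

(** [form_norm] is a real [sup], which is 0 for an unbounded set, so it bounds nothing before
    boundedness is known. Continuity at the origin bounds the form by 1 on a product of balls, and
    scaling both arguments into them gives the rest. *)
Lemma form_continuous_bounded (V W : normedModType R)
    (f : {bilinear V -> W -> R^o}) : form_continuous f ->
  exists M, forall v w, `|f v w| <= M * (`|v| * `|w|).
Proof.
move=> cf; have /cvgrPdist_lt/(_ 1 ltr01)/nbhs_ballP[/= d d0 hd] := cf (0, 0).
have [r r0 rd] : exists2 r : R, 0 < r & r < d by exists (d / 2); lra.
exists (r^-1 ^+ 2) => v w.
have [->|v0] := eqVneq v 0; first by rewrite linear0l !normr0 mul0r mulr0.
have [->|w0] := eqVneq w 0; first by rewrite linear0r !normr0 !mulr0.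
have vp : 0 < `|v| by rewrite normr_gt0.
have wp : 0 < `|w| by rewrite normr_gt0.
have bd (X : normedModType R) (x : X) : 0 < `|x| -> ball 0 d ((r / `|x|) *: x).
  move=> xp; rewrite -ball_normE /ball_ /= sub0r normrN normrZ ger0_norm.
    by rewrite divfK ?gt_eqF.
  by rewrite divr_ge0// ltW.
have := hd ((r / `|v|) *: v, (r / `|w|) *: w) (conj (bd _ _ vp) (bd _ _ wp)).
rewrite /= linear0l sub0r normrN bilinearZl bilinearZr !normrM !normfV !normr_id.
rewrite (ger0_norm (ltW r0)) => /ltW h.
have -> : `|f v w| = (r / `|v| * (r / `|w| * `|f v w|)) * (r^-1 ^+ 2 * (`|v| * `|w|)).
  by field; rewrite !gt_eqF.
by rewrite ler_piMl// !mulr_ge0// ?exprn_ge0// invr_ge0 ltW.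
Qed.

Lemma form_norm_ge0 (V W : normedModType R) (f : V -> W -> R) : 0 <= form_norm f.
Proof.
rewrite /form_norm; set S := (X in sup X).
have [hS|/sup_out] := pselect (has_sup S); last by move=> ->.
have [[x Sx] _] := hS; apply: (@le_trans _ _ x); last exact: sup_upper_bound.
by case: Sx => v [w [_ _ ->]].
Qed.

Lemma le_form_norm (V W : normedModType R) (f : {bilinear V -> W -> R^o}) v w :
  form_continuous f -> `|f v w| <= form_norm f * (`|v| * `|w|).
Proof.
move=> /form_continuous_bounded[M fM].
have [->|v0] := eqVneq v 0; first by rewrite linear0l !normr0 mul0r mulr0.
have [->|w0] := eqVneq w 0; first by rewrite linear0r !normr0 !mulr0.
rewrite -ler_pdivrMr ?mulr_gt0 ?normr_gt0//; apply: ub_le_sup.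
  exists `|M| => _ [x [y [x1 y1 ->]]]; rewrite (le_trans (fM _ _))//.
  rewrite (le_trans (ler_norm _))// normrM ler_piMr// normrM !normr_id.
  by rewrite mulr_ile1.
exists (`|v|^-1 *: v), (`|w|^-1 *: w); split.
- by rewrite normrZ normfV normr_id mulVf// normr_eq0.
- by rewrite normrZ normfV normr_id mulVf// normr_eq0.
rewrite bilinearZl bilinearZr !normrM !normfV !normr_id.
by rewrite invfM; ring.
Qed.

Lemma le_form_normM (V W : normedModType R) (f : {bilinear V -> W -> R^o}) v w x y :
  form_continuous f -> `|v| <= x -> `|w| <= y -> `|f v w| <= form_norm f * (x * y).
Proof.
move=> cf vx wy; rewrite (le_trans (le_form_norm _ _ cf))//.
by rewrite ler_wpM2l ?form_norm_ge0// ler_pM.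
Qed.

Lemma bounded_linear_continuous (V : normedModType R) (l : V -> R) M :
  (forall k x y, l (k *: x + y) = k * l x + l y) ->
  (forall v, `|l v| <= M * `|v|) -> continuous (l : V -> R^o).
Proof.
move=> ll lM x; apply/cvgrPdist_le => /= e e0; near=> y.
have -> : l x - l y = l (x - y).
  by have := ll (-1) y x; rewrite scaleN1r addrC mulN1r => ->; rewrite addrC.
rewrite (le_trans (lM _))//; have M1 : 0 < `|M| + 1 by rewrite ltr_pwDr.
apply: (@le_trans _ _ ((`|M| + 1) * `|x - y|)).
  by rewrite ler_wpM2r// (le_trans (ler_norm M))// lerDl.
rewrite mulrC -ler_pdivlMr//; near: y.
by apply: cvgr_dist_le; [exact: cvg_id|exact: divr_gt0].
Unshelve. all: by end_near. Qed.

Lemma form_continuousl (V W : normedModType R) (f : {bilinear V -> W -> R^o}) w :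
  form_continuous f -> continuous (f^~ w : V -> R^o).
Proof.
move=> cf; apply: (@bounded_linear_continuous _ _ (form_norm f * `|w|)).
  by move=> k x y; exact: bilinear_linearl.
by move=> v; rewrite -mulrA (mulrC `|w|) le_form_norm.
Qed.

Lemma form_continuousr (V W : normedModType R) (f : {bilinear V -> W -> R^o}) v :
  form_continuous f -> continuous (f v : W -> R^o).
Proof.
move=> cf; apply: (@bounded_linear_continuous _ _ (form_norm f * `|v|)).
  by move=> k x y; exact: bilinear_linearr.
by move=> w; rewrite -mulrA le_form_norm.
Qed.

End Forms.

(** * Orthonormal bases, dual norms and orthogonal components in finite dimension *)

Section Orthonormal.
Context {R : realType} {V : hilbertType R}.
Implicit Types (u v w : V) (W A K : set V).

Lemma innerC u v : inner u v = inner v u.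
Proof. by rewrite hermC expr0 mul1r. Qed.

Lemma innerDr u v w : inner u (v + w) = inner u v + inner u w.
Proof. exact: linearDr. Qed.

Lemma innerZr u k v : inner u (k *: v) = k * inner u v.
Proof. exact: linearZr_LR. Qed.

Lemma innerDl u v w : inner (u + v) w = inner u w + inner v w.
Proof. exact: linearDl. Qed.

Lemma innerZl k u v : inner (k *: u) v = k * inner u v.
Proof. exact: linearZl_LR. Qed.

Lemma innerNr u v : inner u (- v) = - inner u v.
Proof. by rewrite -scaleN1r innerZr mulN1r. Qed.

Lemma inner0r u : inner u 0 = 0.
Proof. by rewrite -(scale0r u) innerZr mul0r. Qed.

Lemma inner_sumr u (I : Type) (r : seq I) (v : I -> V) :
  inner u (\sum_(i <- r) v i) = \sum_(i <- r) inner u (v i).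
Proof. exact: linear_sumr. Qed.

Lemma inner_suml u (I : Type) (r : seq I) (v : I -> V) :
  inner (\sum_(i <- r) v i) u = \sum_(i <- r) inner (v i) u.
Proof. by rewrite innerC inner_sumr; apply: eq_bigr => i _; rewrite innerC. Qed.

Lemma inner_cauchy_schwarz u v : `|inner u v| <= `|u| * `|v|.
Proof.
rewrite -(@ler_pXn2r _ 2)// ?nnegrE ?mulr_ge0// real_normK ?num_real//.
rewrite exprMn -!inner_normE; apply: psd_cauchy_schwarz => x y.
have : 0 <= inner (x *: u + y *: v) (x *: u + y *: v).
  by rewrite inner_normE exprn_ge0.
rewrite !(innerDl, innerDr, innerZl, innerZr) (innerC v u).
set p := inner u u; set q := inner u v; set s := inner v v => h.
by apply: (le_trans h); rewrite le_eqVlt; apply/orP; left; apply/eqP; ring.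
Qed.

Lemma pythagoras u v : inner u v = 0 -> `|u + v| ^+ 2 = `|u| ^+ 2 + `|v| ^+ 2.
Proof.
move=> uv; rewrite -!inner_normE !(innerDl, innerDr) (innerC v u) uv.
by rewrite addr0 add0r.
Qed.

(** Linearity is asked on [W] only: a functional composed with [component] is linear on the discrete
    space, but [component] has a junk value on vectors that do not decompose. *)
Definition linear_on W (l : V -> R) :=
  forall k x y, W x -> W y -> l (k *: x + y) = k * l x + l y.

Definition subspace W := W 0 /\ forall k x y, W x -> W y -> W (k *: x + y).

Lemma subspaceZ W k x : subspace W -> W x -> W (k *: x).
Proof. by move=> [W0 WD] Wx; rewrite -[k *: x]addr0; exact: WD. Qed.

Lemma subspaceD W x y : subspace W -> W x -> W y -> W (x + y).
Proof. by move=> [W0 WD] Wx Wy; rewrite -[x]scale1r; exact: WD. Qed.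

Lemma subspaceB W x y : subspace W -> W x -> W y -> W (x - y).
Proof. by move=> [W0 WD] Wx Wy; rewrite addrC -scaleN1r; exact: WD. Qed.

Lemma subspace_sum W (I : Type) (r : seq I) (v : I -> V) :
  subspace W -> (forall i, W (v i)) -> W (\sum_(i <- r) v i).
Proof.
move=> sW Wv; elim: r => [|i r IH]; first by rewrite big_nil; case: sW.
by rewrite big_cons; exact: subspaceD.
Qed.

Lemma linear_on_sum W l (I : Type) (r : seq I) (x : I -> R) (v : I -> V) :
  subspace W -> linear_on W l -> (forall i, W (v i)) ->
  l (\sum_(i <- r) x i *: v i) = \sum_(i <- r) x i * l (v i).
Proof.
move=> sW lW Wv; elim: r => [|i r IH].
  rewrite !big_nil; have W0 : W 0 by case: sW.
  by have := lW (-1) 0 0 W0 W0; rewrite scaler0 addr0 mulN1r addNr.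
rewrite !big_cons lW ?IH//; apply: subspace_sum => // j; exact: subspaceZ.
Qed.

Definition orthonormal_basis W n (e : 'I_n -> V) :=
  [/\ forall i j, inner (e i) (e j) = (i == j)%:R, forall i, W (e i) &
      forall w, W w -> w = \sum_i inner (e i) w *: e i].

Lemma fin_dim_subspace_subspace A : fin_dim_subspace A -> subspace A.
Proof.
move=> [n [e ->]]; split.
  by exists (fun=> 0) => //; rewrite big1// => i _; rewrite scale0r.
move=> k _ _ [x _ <-] [y _ <-]; exists (fun i => k * x i + y i) => //.
rewrite scaler_sumr -big_split; apply: eq_bigr => i _ /=.
by rewrite scalerDl scalerA.
Qed.

(** An orthonormal family in [W] of maximal size is a basis, because the normalised residual [r] of
    a vector that it does not expand would extend it. Sizes are bounded by the number of generators
    of [A]. *)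
Lemma orthonormal_basis_exists A W : fin_dim_subspace A -> subspace W ->
  W `<=` A -> exists n (e : 'I_n -> V), orthonormal_basis W e.
Proof.
move=> [n [g Ag]] sW WA.
pose P k := `[< exists e : 'I_k -> V,
  (forall i j, inner (e i) (e j) = (i == j)%:R) /\ forall i, W (e i) >].
have P0 : exists k, P k.
  by exists 0%N; apply/asboolP; exists (fun=> 0); split => -[].
have Pn k : P k -> (k <= n)%N.
  move=> /asboolP[e [eo We]].
  have /choice[C eC] : forall i, exists x : 'I_n -> R, \sum_j x j *: g j = e i.
    by move=> i; have := WA _ (We i); rewrite Ag => -[x _ <-]; exists x.
  pose M := \matrix_(i < k, j < n) C i j.
  pose G := \matrix_(i < n, j < n) inner (g i) (g j).
  (* The Gram matrix of the orthonormal family is the identity of size [k], and it factors through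
     dimension [n]; comparing ranks gives [k <= n]. *)
  have : M *m G *m M^T = 1%:M.
    apply/matrixP => i j; rewrite !mxE -eo -!eC inner_sumr.
    apply: eq_bigr => l _; rewrite innerZr inner_suml !mxE mulrC; congr (_ * _).
    by apply: eq_bigr => m _; rewrite !mxE innerZl.
  by move/mulmx1_min_rank/leq_trans; apply; exact: rank_leq_row.
case: (ex_maxnP P0 Pn) => k /asboolP[e [eo We]] kmax.
exists k, e; split => // w Ww; apply: contrapT => hw.
pose r := w - \sum_i inner (e i) w *: e i.
have r0 : r != 0 by rewrite subr_eq0; exact/eqP.
have rp : 0 < `|r| by rewrite normr_gt0.
have Wr : W r.
  by apply: subspaceB => //; apply: subspace_sum => // i; exact: subspaceZ.
have er i : inner (e i) r = 0.
  rewrite innerDr innerNr inner_sumr (bigD1 i)//= innerZr eo eqxx mulr1.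
  rewrite big1 ?addr0 ?subrr// => j ji.
  by rewrite innerZr eo eq_sym (negbTE ji) mulr0.
suff /kmax : P k.+1 by rewrite ltnn.
apply/asboolP.
exists (fun i => if unlift ord_max i is Some j then e j else `|r|^-1 *: r).
split => [i j|i]; last first.
  by case: unliftP => [j _|_]; [exact: We|exact: subspaceZ].
case: unliftP => [i' ->|->]; case: unliftP => [j' ->|->].
- by rewrite eo (inj_eq lift_inj).
- by rewrite innerZr er mulr0 eq_sym (negbTE (neq_lift _ _)).
- by rewrite innerC innerZr er mulr0 (negbTE (neq_lift _ _)).
- rewrite innerZr innerZl inner_normE eqxx expr2 mulrA mulrA.
  by transitivity (1 : R) => //; field; rewrite gt_eqF.
Qed.

(** The vector [\sum_i l (e i) *: e i] is the Riesz representative of [l] on [W], and its norm is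
    the dual norm. The expression in coordinates is what makes the dual norm of a time-dependent
    functional measurable in time. *)
Lemma dnorm_orthonormal_basis W l n (e : 'I_n -> V) : subspace W ->
  orthonormal_basis W e -> linear_on W l ->
  dnorm W l = Num.sqrt (\sum_i l (e i) ^+ 2) /\
  forall v, W v -> `|l v| <= dnorm W l * `|v|.
Proof.
move=> sW [eo We eb] lW; pose r := \sum_i l (e i) *: e i.
have lr v : W v -> l v = inner r v.
  move=> Wv; rewrite {1}(eb v Wv) (linear_on_sum _ _ sW lW)// inner_suml.
  by apply: eq_bigr => i _; rewrite innerZl mulrC.
have rr : `|r| ^+ 2 = \sum_i l (e i) ^+ 2.
  rewrite -inner_normE inner_suml; apply: eq_bigr => i _.
  by rewrite innerZl innerC -lr// expr2.
have -> : Num.sqrt (\sum_i l (e i) ^+ 2) = `|r|.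
  by rewrite -rr sqrtr_sqr normr_id.
have Wr : W r by apply: subspace_sum => // i; exact: subspaceZ.
suff -> : dnorm W l = `|r|.
  by split => // v Wv; rewrite lr// inner_cauchy_schwarz.
have ub : ubound [set `|l v| / `|v| | v in W `\ 0] `|r|.
  move=> _ [v [Wv /eqP v0] <-]; rewrite ler_pdivrMr ?normr_gt0// lr//.
  exact: inner_cauchy_schwarz.
apply/eqP; rewrite eq_le; apply/andP; split.
  rewrite /dnorm; set S := (X in sup X).
  have [->|/set0P ne] := eqVneq S set0; first by rewrite sup0.
  exact: ge_sup.
have [->|r0] := eqVneq r 0; first by rewrite normr0; exact: Defs.dnorm_ge0.
apply: ub_le_sup; first by exists `|r|.
exists r; first by split => //; exact/eqP.
rewrite lr// inner_normE ger0_norm ?exprn_ge0// expr2 mulfK//.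
by rewrite normr_eq0.
Qed.

Section Decomposition.
Variables A K : set V.
Hypotheses (fA : fin_dim_subspace A) (sK : subspace K) (KA : K `<=` A).
Let sA := fin_dim_subspace_subspace fA.
Local Notation Kp := (orthocompl A K).

Lemma orthocompl_subspace : subspace Kp.
Proof.
split; first by split=> [|w _]; [case: sA|rewrite inner0r].
move=> k x y [Ax xK] [Ay yK]; split; first by case: sA => _; apply.
by move=> w Kw; rewrite innerDr innerZr xK// yK// mulr0 addr0.
Qed.

Lemma orthocompl_disjoint v : K v -> Kp v -> v = 0.
Proof.
move=> Kv [_ /(_ v Kv)]; rewrite inner_normE => /eqP.
by rewrite sqrf_eq0 normr_eq0 => /eqP.
Qed.

(** [component] chooses some decomposition, so its value is known only through uniqueness: the
    difference of two candidates lies in [K] and in its complement, hence is 0. *)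
Lemma componentD x y : K x -> Kp y ->
  component K Kp (x + y) = x /\ component Kp K (x + y) = y.
Proof.
move=> Kx Ky; split.
- apply: xget_unique; first by rewrite /= addrC addKr.
  move=> z [Kz Kpz]; apply/eqP; rewrite -subr_eq0; apply/eqP.
  apply: orthocompl_disjoint; first exact: subspaceB.
  have -> : z - x = y - (x + y - z) by rewrite opprB addrCA opprD [y + _]addrCA subrr addr0.
  exact: subspaceB orthocompl_subspace _ _.
- apply: xget_unique; first by rewrite /= addrK.
  move=> z [Kpz Kz]; apply/eqP; rewrite -subr_eq0; apply/eqP.
  apply: orthocompl_disjoint; last exact: subspaceB orthocompl_subspace _ _.
  have -> : z - y = x - (x + y - z).
    by rewrite opprB addrCA opprD [x + (_ + _)]addrA subrr add0r.
  exact: subspaceB.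
Qed.

(** The projection onto [K] is written in an orthonormal basis of [K]; subtracting it leaves a
    vector orthogonal to that basis. *)
Lemma component_spec v : A v -> [/\ K (component K Kp v), Kp (component Kp K v) &
  component K Kp v + component Kp K v = v].
Proof.
move=> Av; have [n [e [eo Ke eb]]] := orthonormal_basis_exists fA sK KA.
pose x := \sum_i inner (e i) v *: e i.
have Kx : K x by apply: subspace_sum => // i; exact: subspaceZ.
have Ky : Kp (v - x).
  split; first by apply: subspaceB => //; exact: KA.
  move=> w Kw; rewrite {1}(eb w Kw) inner_suml big1// => i _.
  rewrite innerZl innerDr innerNr inner_sumr (bigD1 i)//= innerZr eo eqxx mulr1.
  rewrite big1 ?addr0 ?subrr ?mulr0// => j ji.
  by rewrite innerZr eo eq_sym (negbTE ji) mulr0.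
have xv : x + (v - x) = v by rewrite addrC subrK.
by have [] := componentD Kx Ky; rewrite xv => -> ->.
Qed.

Lemma component_linear k x y : A x -> A y ->
  component K Kp (k *: x + y) = k *: component K Kp x + component K Kp y /\
  component Kp K (k *: x + y) = k *: component Kp K x + component Kp K y.
Proof.
move=> Ax Ay; have [Kx Kpx ex] := component_spec Ax.
have [Ky Kpy ey] := component_spec Ay.
rewrite -{1 3}ex -{1 3}ey scalerDr addrACA; apply: componentD.
  by case: sK => _; apply.
by case: orthocompl_subspace => _; apply.
Qed.

Lemma norm_component v : A v ->
  `|component K Kp v| <= `|v| /\ `|component Kp K v| <= `|v|.
Proof.
move=> Av; have [Kv [_ Kpv] e] := component_spec Av.
have := pythagoras (Kpv _ Kv); rewrite e => h.
by split; rewrite -(@ler_pXn2r _ 2)// ?nnegrE// h ?lerDl ?lerDr exprn_ge0.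
Qed.

End Decomposition.
End Orthonormal.


(** * Stability of the saddle point problem at a fixed time *)

Section Static.
Context {R : realType} {V Q : hilbertType R}.

(** When the bounds on the four components of [u] and [p] are added, [static_X] is the coefficient
    of the data size [d], and [static_Y] that of the energy root [E], whose square is
    [d * (|u| + |p|)]. [static_const] is what remains once [E] has been absorbed. *)
Definition static_X (alpha beta gamma na nc : R) :=
  alpha^-1 + gamma^-1 + (na / alpha + 1) / beta + (nc / gamma + 1) / beta.

Definition static_Y (alpha beta gamma na nc : R) :=
  (na / alpha + 1) * (nc + 1) / beta + (nc / gamma + 1) * (na + 1) / beta.

Definition static_const (alpha beta gamma na nc : R) :=
  2 * static_X alpha beta gamma na nc + static_Y alpha beta gamma na nc ^+ 2.

Lemma static_const_gt0 alpha beta gamma na nc : 0 < alpha -> 0 < beta ->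
  0 < gamma -> 0 <= na -> 0 <= nc -> 0 < static_const alpha beta gamma na nc.
Proof.
move=> a0 b0 g0 na0 nc0; rewrite /static_const /static_X.
by rewrite ltr_pwDl ?sqr_ge0// mulr_gt0// !ltr_pwDl ?invr_gt0//
  ?divr_ge0 ?addr_ge0 ?divr_ge0 ?invr_ge0 ?(ltW a0) ?(ltW b0) ?(ltW g0).
Qed.

Lemma kernel_l_subspace (b : {bilinear V -> Q -> R^o}) (A : set V) (B : set Q) :
  subspace A -> subspace (kernel_l b A B).
Proof.
move=> [A0 AD]; split; first by split => // q _; rewrite linear0l.
move=> k x y [Ax bx] [Ay hy]; split; first exact: AD.
by move=> q Bq; rewrite bilinear_linearl bx// hy// mulr0 addr0.
Qed.

Lemma kernel_r_subspace (b : {bilinear V -> Q -> R^o}) (A : set V) (B : set Q) :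
  subspace B -> subspace (kernel_r b A B).
Proof.
move=> [A0 AD]; split; first by split => // q _; rewrite linear0r.
move=> k x y [Ax bx] [Ay hy]; split; first exact: AD.
by move=> q Bq; rewrite bilinear_linearr bx// hy// mulr0 addr0.
Qed.

(** Cauchy-Schwarz for the semi-definite form: a bound on the energy of [u] controls [a u v] for
    every [v], without coercivity. The factor [form_norm a + 1] dominates the square root of
    [form_norm a]. *)
Lemma sym_psd_bound (W : hilbertType R) (a : {bilinear W -> W -> R^o}) u v E :
  form_continuous a -> sym_psd a -> 0 <= E -> a u u <= E ^+ 2 ->
  `|a u v| <= (form_norm a + 1) * E * `|v|.
Proof.
move=> ca [sa pa] E0 aE; set n := form_norm a.
have n0 : 0 <= n by exact: form_norm_ge0.
have CS : (a u v) ^+ 2 <= a u u * a v v.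
  apply: psd_cauchy_schwarz => x y.
  have := pa (x *: u + y *: v).
  rewrite bilinear_linearl bilinearZl (bilinear_linearr a x u _ u).
  rewrite (bilinear_linearr a x u _ v) (bilinearZr a y v u) (bilinearZr a y v v).
  rewrite (sa v u) => h.
  by apply: (le_trans h); rewrite le_eqVlt; apply/orP; left; apply/eqP; ring.
have avv : a v v <= n * `|v| ^+ 2.
  by rewrite (le_trans (ler_norm _))// expr2 le_form_norm.
rewrite -(@ler_pXn2r _ 2)// ?nnegrE ?mulr_ge0 ?addr_ge0//.
rewrite real_normK ?num_real//; apply: (le_trans CS).
apply: (@le_trans _ _ (E ^+ 2 * (n * `|v| ^+ 2))).
  by rewrite ler_pM// ?pa.
have -> : ((n + 1) * E * `|v|) ^+ 2 = E ^+ 2 * ((n + 1) ^+ 2 * `|v| ^+ 2) by ring.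
rewrite ler_wpM2l ?sqr_ge0//.
by rewrite ler_wpM2r ?sqr_ge0//; nra.
Qed.

Lemma sup_le_quotient (W : normedModType R) (A : set W) (l : W -> R) x M :
  x <= sup [set l v / `|v| | v in A `\ 0] -> 0 <= M ->
  (forall v, A v -> `|l v| <= M * `|v|) -> x <= M.
Proof.
move=> xl M0 lM; apply: (le_trans xl); set S := (X in sup X).
have [->|/set0P ne] := eqVneq S set0; first by rewrite sup0.
apply: ge_sup => // _ [v [Av /eqP v0] <-].
by rewrite ler_pdivrMr ?normr_gt0// (le_trans (ler_norm _))// lM.
Qed.

(** [E] is the geometric mean of [d] and [S], so [Y * E] is at most the arithmetic mean of
    [Y ^+ 2 * d] and [S]; the half of [S] that arises is absorbed on the left. *)
Lemma static_arith (X Y d S E : R) : 0 <= d -> 0 <= S -> 0 <= E -> 0 <= Y ->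
  E ^+ 2 = d * S -> S <= X * d + Y * E -> S <= (2 * X + Y ^+ 2) * d.
Proof.
move=> d0 S0 E0 Y0 ES SE.
suff : Y * E <= (Y ^+ 2 * d + S) / 2 by lra.
rewrite -(@ler_pXn2r _ 2)// ?nnegrE ?mulr_ge0 ?addr_ge0 ?mulr_ge0 ?sqr_ge0//.
rewrite exprMn ES; have := sqr_ge0 (Y ^+ 2 * d - S); lra.
Qed.

Variables (a : {bilinear V -> V -> R^o}) (b : {bilinear V -> Q -> R^o})
  (c : {bilinear Q -> Q -> R^o}) (Vh : set V) (Qh : set Q)
  (alpha beta gamma : R).
Hypotheses (ca : form_continuous a) (cc : form_continuous c)
  (pa : sym_psd a) (pc : sym_psd c)
  (fV : fin_dim_subspace Vh) (fQ : fin_dim_subspace Qh).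
Let Kh := kernel_l b Vh Qh.
Let Hh := kernel_r b Vh Qh.
Let Khp := orthocompl Vh Kh.
Let Hhp := orthocompl Qh Hh.
Hypotheses (alpha0 : 0 < alpha) (cK : coercive_on a Kh alpha)
  (gamma0 : 0 < gamma) (cH : coercive_on c Hh gamma) (beta0 : 0 < beta)
  (infsupQ : forall q, Hhp q ->
     sup [set b v q / `|v| | v in Vh `\ 0] >= beta * `|q|)
  (infsupV : forall v, Khp v ->
     sup [set b v q / `|q| | q in Qh `\ 0] >= beta * `|v|).

(** Meant for a kernel component [x0] used as its own test vector: the term in [b] then vanishes, so
    [f (x0 + xb) x0] is pure data, and it differs from the coercive [f x0 x0] by a term controlled
    by the complementary component [xb]. *)
Lemma coercive_component (W : hilbertType R) (f : {bilinear W -> W -> R^o})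
    x0 xb k d : form_continuous f -> 0 < k -> 0 <= d -> sym_psd f ->
  k * `|x0| ^+ 2 <= f x0 x0 -> `|f (x0 + xb) x0| <= d * `|x0| ->
  `|x0| <= (d + form_norm f * `|xb|) / k.
Proof.
move=> cf k0 d0 pf kx fd; rewrite ler_pdivlMr// mulrC.
have [->|x00] := eqVneq x0 0.
  by rewrite normr0 mulr0 addr_ge0// mulr_ge0// form_norm_ge0.
have xp : 0 < `|x0| by rewrite normr_gt0.
rewrite -(ler_pM2r xp) -mulrA -expr2 (le_trans kx)//.
have -> : f x0 x0 = f (x0 + xb) x0 - f xb x0 by rewrite linearDl /= addrK.
rewrite (le_trans (ler_norm _))// (le_trans (ler_normB _ _))// mulrDl lerD//.
by rewrite -mulrA le_form_norm.
Qed.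

(** Each value of [b] is replaced, through one of the equations, by data and a value of [a] or [c];
    this is why [form_norm b] does not occur in [static_const]. *)
Theorem static_stability (u : V) (p : Q) (d : R) (Phi : V -> R) (Gam : Q -> R) :
  Vh u -> Qh p -> 0 <= d ->
  (forall v, Vh v -> `|Phi v| <= d * `|v|) ->
  (forall q, Qh q -> `|Gam q| <= d * `|q|) ->
  (forall v, Vh v -> a u v + b v p = Phi v) ->
  (forall q, Qh q -> b u q - c p q = Gam q) ->
  `|u| + `|p| <= static_const alpha beta gamma (form_norm a) (form_norm c) * d.
Proof.
move=> Vu Qp d0 Phid Gamd eV eQ.
have sV := fin_dim_subspace_subspace fV.
have sQ := fin_dim_subspace_subspace fQ.
have [] := @component_spec _ _ _ Kh fV (kernel_l_subspace b Qh sV) _ u Vu.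
  by move=> x [].
set u0 := component _ _ _; set ub := component _ _ _ => Ku Kpu eu.
have [] := @component_spec _ _ _ Hh fQ (kernel_r_subspace b Vh sQ) _ p Qp.
  by move=> x [].
set p0 := component _ _ _; set pb := component _ _ _ => Hp Hpp ep.
have Vu0 : Vh u0 by case: Ku.
have Qp0 : Qh p0 by case: Hp.
set na := form_norm a; set nc := form_norm c.
have na0 : 0 <= na by exact: form_norm_ge0.
have nc0 : 0 <= nc by exact: form_norm_ge0.
set S := `|u| + `|p|; have S0 : 0 <= S by rewrite addr_ge0.
pose E := Num.sqrt (d * S).
have E0 : 0 <= E by exact: sqrtr_ge0.
have ES : E ^+ 2 = d * S by rewrite sqr_sqrtr// mulr_ge0.
(* Testing with [u] and [p] and subtracting the equations cancels [b u p]. *)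
have energy : a u u + c p p <= E ^+ 2.
  rewrite ES; have -> : a u u + c p p = Phi u - Gam p.
    by rewrite -eV// -eQ//; ring.
  rewrite (le_trans (ler_norm _))// (le_trans (ler_normB _ _))// mulrDr.
  by rewrite lerD// ?Phid ?Gamd.
have au : a u u <= E ^+ 2 by have := pc.2 p; lra.
have cp : c p p <= E ^+ 2 by have := pa.2 u; lra.
(* The kernel components are invisible to [b], so the inf-sup conditions, which concern the
   complements, apply to [pb] and [ub] with the values of [b] at [p] and [u]. *)
have bp v : Vh v -> b v p = b v pb.
  by move=> Vv; rewrite -ep linearDr /=; case: Hp => _ ->; rewrite ?add0r.
have bu q : Qh q -> b u q = b ub q.
  by move=> Qq; rewrite -eu linearDl /=; case: Ku => _ ->; rewrite ?add0r.
have hpb : beta * `|pb| <= d + (na + 1) * E.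
  apply: (sup_le_quotient (infsupQ Hpp)).
    by rewrite addr_ge0// mulr_ge0// addr_ge0.
  move=> v Vv; rewrite -bp//; have -> : b v p = Phi v - a u v.
    by rewrite -eV//; ring.
  rewrite (le_trans (ler_normB _ _))// mulrDl lerD// ?Phid//.
  exact: sym_psd_bound.
have hub : beta * `|ub| <= d + (nc + 1) * E.
  apply: (sup_le_quotient (infsupV Kpu)).
    by rewrite addr_ge0// mulr_ge0// addr_ge0.
  move=> q Qq; rewrite -bu//; have -> : b u q = Gam q + c p q.
    by rewrite -eQ//; ring.
  rewrite (le_trans (ler_normD _ _))// mulrDl lerD// ?Gamd//.
  exact: sym_psd_bound.
have hu0 : `|u0| <= (d + na * `|ub|) / alpha.
  apply: coercive_component => //; first exact: cK.
  rewrite eu; have -> : a u u0 = Phi u0.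
    by rewrite -eV//; case: Ku => _ ->; rewrite ?addr0.
  exact: Phid.
have hp0 : `|p0| <= (d + nc * `|pb|) / gamma.
  apply: coercive_component => //; first exact: cH.
  rewrite ep; have -> : c p p0 = - Gam p0.
    by rewrite -eQ//; case: Hp => _ ->; rewrite ?sub0r ?opprK.
  by rewrite normrN Gamd.
have hu : `|u| <= `|u0| + `|ub| by rewrite -eu ler_normD.
have hp : `|p| <= `|p0| + `|pb| by rewrite -ep ler_normD.
have ub_le : `|ub| <= (d + (nc + 1) * E) / beta by rewrite ler_pdivlMr// mulrC.
have pb_le : `|pb| <= (d + (na + 1) * E) / beta by rewrite ler_pdivlMr// mulrC.
apply: (static_arith d0 S0 E0 _ ES).
  by rewrite addr_ge0// mulr_ge0 ?invr_ge0 ?(ltW beta0)// mulr_ge0 ?addr_ge0//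
    mulr_ge0 ?invr_ge0// ltW.
have h1 : na / alpha * `|ub| <= na / alpha * ((d + (nc + 1) * E) / beta).
  by rewrite ler_wpM2l// divr_ge0// ltW.
have h2 : nc / gamma * `|pb| <= nc / gamma * ((d + (na + 1) * E) / beta).
  by rewrite ler_wpM2l// divr_ge0// ltW.
have e1 : (d + na * `|ub|) / alpha = d / alpha + na / alpha * `|ub|.
  by field; rewrite gt_eqF.
have e2 : (d + nc * `|pb|) / gamma = d / gamma + nc / gamma * `|pb|.
  by field; rewrite gt_eqF.
apply: (@le_trans _ _ (d / alpha + na / alpha * ((d + (nc + 1) * E) / beta) +
  (d + (nc + 1) * E) / beta + (d / gamma + nc / gamma *
  ((d + (na + 1) * E) / beta) + (d + (na + 1) * E) / beta))).
  by rewrite /S; lra.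
rewrite le_eqVlt; apply/orP; left; apply/eqP; rewrite /static_X /static_Y.
by field; rewrite !gt_eqF.
Qed.

End Static.


(** * A Gronwall inequality for integrals *)

Section Gronwall.
Context {R : realType}.
Local Notation mu := (@lebesgue_measure R).

(** With [n = Num.bound (2 * L * T)] there are [n.+1] time steps, short enough for [L] times their
    length to be at most one half. Each doubles a quantity that starts at twice the integral of the
    data, whence the exponent [n.+2]. *)
Definition gronwall_const (L T : R) : R := 2 ^+ (Num.bound (2 * L * T)).+2.

Lemma gronwall_const_gt0 L T : 0 < gronwall_const L T.
Proof. by rewrite exprn_gt0. Qed.

Lemma ae_measurableS (t T : R) (f : R -> R) :
  t <= T -> ae_measurable T f -> ae_measurable t f.
Proof.
move=> tT [g [mg fg]]; exists g; split => //; apply: (ae_imp fg) => s {}fg.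
by rewrite /= in_itv /= => /andP[s0 st]; apply: fg; rewrite /= in_itv /= s0 (le_trans st).
Qed.

Lemma ae_integrableS (t T : R) (f : R -> R) :
  t <= T -> ae_integrable T f -> ae_integrable t f.
Proof.
move=> tT fi; apply: ae_integrableP.
  exact: ae_measurableS tT (ae_integrable_measurable fi).
have fn := ae_integrable_norm fi.
rewrite /int_J -(Rintegral_ae_EFin tT _ fn); first exact: ltry.
by move=> s; exact: normr_ge0.
Qed.

Lemma le_Rintegral_itv (s t T : R) (f : R -> R) : s <= t -> t <= T ->
  (forall x, 0 <= f x) -> ae_integrable T f ->
  \int[mu]_(x in `[0, s]) f x <= \int[mu]_(x in `[0, t]) f x.
Proof.
move=> st tT f0 fi; rewrite -lee_fin (Rintegral_ae_EFin tT)//.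
exact: (Rintegral_ae_le_J st f0 (ae_integrableS tT fi)).
Qed.

Lemma Rintegral_indic_le (s t : R) (f : R -> R) : s <= t ->
  \int[mu]_(x in `[0, t]) (f x * (x <= s)%R%:R) = \int[mu]_(x in `[0, s]) f x.
Proof.
move=> st; have -> : `[0, s]%classic = `[0, t]%classic `&` [set x | x <= s].
  apply/seteqP; split => x /=; rewrite !in_itv /=.
    by move=> /andP[-> xs]; rewrite (le_trans xs st).
  by move=> [/andP[-> _] ->].
rewrite Rintegral_mkcondr; apply: eq_Rintegral => x _; rewrite patchE.
have -> : (x \in [set x0 | x0 <= s]) = (x <= s).
  by apply/idP/idP => [/set_mem|/mem_set].
by case: ifP; rewrite ?mulr1 ?mulr0.
Qed.

Lemma measurable_le_indic (t : R) :
  measurable_fun [set: R] (fun s : R => (s <= t)%R%:R : R).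
Proof.
rewrite (_ : (fun x => _) = \1_(`]-oo, t]%classic)); first exact: measurable_indic.
apply/funext => x; rewrite indicE; congr (_%:R); congr nat_of_bool.
by apply/idP/idP => [h|/set_mem]; [apply/mem_set|]; rewrite /= in_itv.
Qed.

Lemma ae_integrable_indic (T s : R) (f : R -> R) : ae_integrable T f ->
  ae_integrable T (fun x => f x * (x <= s)%R%:R).
Proof.
move=> fi; apply: (ae_integrable_le _ _ (ae_integrable_norm fi)); last first.
  apply: aeW => x _; rewrite normrM ler_piMr//.
  by case: (x <= s); rewrite ?normr1 ?normr0 ?ler01.
apply: ae_measurableM; first exact: ae_integrable_measurable.
apply: measurable_ae_measurable; exact: measurable_le_indic.
Qed.

Lemma ae_integrable_cst (T k : R) : ae_integrable T (fun=> k).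
Proof.
exists (fun=> k); split; [exact: measurable_cst| |exact: aeW].
apply: continuous_compact_integrable; first exact: segment_compact.
by apply: continuous_subspaceT => x; exact: cst_continuous.
Qed.

Lemma Rintegral_itv_cst (k t : R) : 0 <= t ->
  \int[mu]_(x in `[0, t]) k = k * t.
Proof.
move=> t0; rewrite Rintegral_cst//; congr (_ * _).
rewrite /= lebesgue_measure_itv /= lte_fin.
case: ltP => [_|t0']; first by rewrite -EFinB subr0.
by apply/esym/eqP; rewrite eq_le t0 t0'.
Qed.

Section Estimate.
Variables (T L : R) (M D : R -> R).
Hypotheses (L0 : 0 <= L) (M0 : forall t, 0 <= M t) (D0 : forall t, 0 <= D t)
  (Mi : ae_integrable T M) (Di : ae_integrable T D)
  (MD : {ae mu, forall t, `[0, T]%classic t ->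
     M t <= D t + L * \int[mu]_(s in `[0, t]) M s}).

Let I t := \int[mu]_(s in `[0, t]) M s.
Let delta := \int[mu]_(s in `[0, T]) D s.

Let I_ge0 t : 0 <= I t.
Proof. by apply: Rintegral_ge0 => s _; exact: M0. Qed.

(** [I] is nondecreasing, so on the step the memory term is at most [L * I t']. Integrated over the
    step it contributes at most half of [I t'], which is absorbed on the left. *)
Lemma gronwall_step t t' : 0 <= t -> t <= t' -> t' <= T ->
  L * (t' - t) <= 1 / 2 -> I t' <= 2 * (I t + delta).
Proof.
move=> t0 tt' t'T Lt.
have t'0 : 0 <= t' by exact: le_trans tt'.
have Mi' := ae_integrableS t'T Mi; have Di' := ae_integrableS t'T Di.
(* The majorant is [M + D] up to [t] and [D + L * I t'] after [t]. The indicators let every integral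
   start at 0. *)
pose J x := M x * (x <= t)%R%:R + (D x + (L * I t' + - (L * I t') * (x <= t)%R%:R)).
have ci : ae_integrable t' (fun x => - (L * I t') * (x <= t)%R%:R).
  exact: ae_integrable_indic (ae_integrable_cst _ _).
have ci2 := ae_integrableD (ae_integrable_cst t' (L * I t')) ci.
have Mt := ae_integrable_indic t Mi'.
have Dc := ae_integrableD Di' ci2.
have IJ : I t' <= \int[mu]_(x in `[0, t']) J x.
  apply: (le_ae_Rintegral (lexx t') Mi' (ae_integrableD Mt Dc)).
  apply: (ae_imp MD) => x MDx; rewrite /= in_itv /= => /andP[x0 xt'].
  have xT : x <= T by exact: le_trans t'T.
  case: (leP x t) => xt; rewrite /J /=.
    by rewrite !mulr1 addrN addr0 lerDl.
  rewrite !mulr0 addr0 add0r; apply: le_trans (MDx _) _.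
    by rewrite /= in_itv /= x0.
  by rewrite lerD2l ler_wpM2l//; exact: (le_Rintegral_itv xt' t'T).
have eJ : \int[mu]_(x in `[0, t']) J x =
    I t + (\int[mu]_(x in `[0, t']) D x + (L * I t' * t' - L * I t' * t)).
  rewrite (Rintegral_aeD (lexx t') Mt Dc) Rintegral_indic_le//; congr (_ + _).
  rewrite (Rintegral_aeD (lexx t') Di' ci2); congr (_ + _).
  rewrite (Rintegral_aeD (lexx t') (ae_integrable_cst _ _) ci).
  by rewrite (Rintegral_indic_le (fun=> _))// !Rintegral_itv_cst// mulNr.
have Dd : \int[mu]_(x in `[0, t']) D x <= delta by exact: le_Rintegral_itv Di.
have LI : L * (t' - t) * I t' <= 1 / 2 * I t' by rewrite ler_wpM2r.
rewrite eJ in IJ; nra.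
Qed.

Lemma gronwall_int_J : 0 <= T ->
  (int_J T M <= (gronwall_const L T)%:E * int_J T D)%E.
Proof.
move=> T0.
rewrite /int_J -(Rintegral_ae_EFin (lexx T) M0 Mi).
rewrite -(Rintegral_ae_EFin (lexx T) D0 Di) -EFinM lee_fin.
have d0 : 0 <= delta by apply: Rintegral_ge0 => s _; exact: D0.
pose n := Num.bound (2 * L * T); pose tau := T / n.+1%:R.
have tau0 : 0 <= tau by rewrite divr_ge0.
have nT : n.+1%:R * tau = T by rewrite mulrC divfK// pnatr_eq0.
have Ltau : L * tau <= 1 / 2.
  have : 2 * L * T < n%:R.
    by apply: le_lt_trans (archi_boundP _); rewrite ?ler_norm// !mulr_ge0.
  rewrite -nT -natr1; have n0 : 0 <= n%:R :> R by [].
  move=> h; rewrite leNgt; apply/negP => h2.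
  have : n%:R * (1 / 2) <= n%:R * (L * tau) by rewrite ler_wpM2l// ltW.
  have : 0 <= L * tau by rewrite mulr_ge0.
  nra.
(* [- 2 * delta] is the fixed point of the recursion that sends [x] to [2 * (x + delta)], so
   [I + 2 * delta] at most doubles at each step. *)
have step k : (k <= n.+1)%N -> I (k%:R * tau) <= 2 ^+ k.+1 * delta - 2 * delta.
  elim: k => [_|k IH kn].
    by rewrite mul0r /I set_itv1 Rintegral_set1 expr1 subrr.
  have := IH (ltnW kn); rewrite (exprS 2 k.+1) => {}IH.
  have h := @gronwall_step (k%:R * tau) (k.+1%:R * tau).
  have {}h : I (k.+1%:R * tau) <= 2 * (I (k%:R * tau) + delta).
    apply: h.
    - by rewrite mulr_ge0.
    - by rewrite ler_wpM2r// ler_nat.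
    - by rewrite -[leRHS]nT ler_wpM2r// ler_nat.
    - have -> : k.+1%:R * tau - k%:R * tau = tau by rewrite -natr1; ring.
      exact: Ltau.
  by apply: (le_trans h); rewrite -mulrA; lra.
have := step n.+1 (leqnn _); rewrite nT => /le_trans; apply.
by rewrite /gronwall_const -/n -/delta lerBlDr lerDl mulr_ge0.
Qed.

End Estimate.
End Gronwall.


(** * Extension of the kernels and regularity of the memory terms *)

Section Memory.
Context {R : realType}.
Local Notation mu := (@lebesgue_measure R).

Definition clamp (x t : R) : R := Num.min (Num.max t 0) x.

Lemma clampP x t : 0 <= x -> 0 <= clamp x t <= x.
Proof.
move=> x0; rewrite /clamp le_min le_max lexx orbT x0 /=.
by rewrite ge_min lexx orbT.
Qed.

Lemma clamp_id x t : 0 <= t <= x -> clamp x t = t.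
Proof. by move=> /andP[t0 tx]; rewrite /clamp max_l// min_l. Qed.

(** A kernel is controlled on the triangle only. For [0 <= T], composing it with a continuous
    retraction of the plane onto the triangle gives a kernel that is continuous everywhere, with the
    same bound and the same values on the triangle. *)
Definition clamp_kernel (T : R) (k : R -> R -> R) (t s : R) : R :=
  k (clamp T t) (clamp (clamp T t) s).

Definition continuous_kernel (K : R -> R -> R) (C : R) :=
  continuous (fun x : R * R => K x.1 x.2) /\ forall t s, `|K t s| <= C.

Lemma continuous_clamp (X : topologicalType) (f g : X -> R) :
  continuous f -> continuous g -> continuous (fun x => clamp (f x) (g x)).
Proof.
move=> cf cg x.
have cm : {for x, continuous (g \max (cst 0))}.
  by apply: continuous_max; [exact: cg|exact: cst_continuous].
exact: (continuous_min cm (cf x)).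
Qed.

Lemma continuous_kernel_clamp (T : R) (k : R -> R -> R) (C : R) : 0 <= T ->
  bounded_kernel T k C -> continuous_kernel (clamp_kernel T k) C.
Proof.
move=> T0 [ck kC].
have tri t s : triangle T (clamp T t, clamp (clamp T t) s).
  have /andP[t0 tT] := clampP t T0; have /andP[s0 st] := clampP s t0.
  by split => //=.
split => [x|t s]; last exact: kC.
pose g (y : R * R) : R * R := (clamp T y.1, clamp (clamp T y.1) y.2).
have cg : continuous g.
  have c1 : continuous (fun y : R * R => clamp T y.1).
    apply: continuous_clamp; first by move=> y; exact: cst_continuous.
    by move=> y; exact: cvg_fst.
  have c2 : continuous (fun y : R * R => clamp (clamp T y.1) y.2).
    by apply: continuous_clamp => // z; exact: cvg_snd.
  by move=> y; exact: (cvg_pair (c1 y) (c2 y)).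
have /subspace_continuousP ck' := ck.
move=> U /(ck' (g x) (tri _ _)) hU.
have {}hU : nbhs (g x) [set z : R * R | triangle T z -> U (k z.1 z.2)] := hU.
have := cg x _ hU; rewrite !nbhs_simpl /= => h.
by apply: (filterS _ h) => y; apply; exact: tri.
Qed.

Lemma clamp_kernelE (T : R) (k : R -> R -> R) t s : 0 <= s -> s <= t -> t <= T ->
  clamp_kernel T k t s = k t s.
Proof.
move=> s0 st tT; have t0 : 0 <= t by exact: le_trans st.
by rewrite /clamp_kernel (@clamp_id T t) ?t0// clamp_id// s0.
Qed.

Lemma bounded_kernel_ge0 (T : R) (k : R -> R -> R) (C : R) : 0 <= T ->
  bounded_kernel T k C -> 0 <= C.
Proof.
move=> T0 [_ kC]; apply: le_trans (kC 0 0 _); first exact: normr_ge0.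
by split => //=.
Qed.

Lemma cvg_kernel (K : R -> R -> R) C (Y : Type) (F : set_system Y) {FF : Filter F}
    (f g : Y -> R) (t s : R) : continuous_kernel K C ->
  f y @[y --> F] --> t -> g y @[y --> F] --> s -> K (f y) (g y) @[y --> F] --> K t s.
Proof.
move=> [cK _] ft gs.
exact: (cvg_comp (fun y => (f y, g y)) (fun x => K x.1 x.2) (cvg_pair ft gs) (cK (t, s))).
Qed.

Lemma continuous_kernel_section (K : R -> R -> R) C t :
  continuous_kernel K C -> continuous (K t).
Proof.
move=> cK s; apply: (cvg_kernel cK); [exact: cvg_cst|exact: cvg_id].
Qed.

(** The indicator replaces the moving domain [[0, t]] by a fixed one. For fixed [s] the integrand is
    continuous in the outer variable except at [s], so along a sequence tending to [t] convergence
    can fail only on the null set [[set t]], and dominated convergence applies. *)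
Lemma continuous_memory (T : R) (K : R -> R -> R) (C : R) (x : R -> R) :
  continuous_kernel K C -> measurable_fun [set: R] x ->
  mu.-integrable `[0, T] (EFin \o x) ->
  continuous (fun t => \int[mu]_(s in `[0, T]) (K t s * x s * (s <= t)%R%:R)).
Proof.
move=> cK mx ix t; apply/(@cvg_nbhsP _ R^o) => u ut.
pose F (t s : R) : R := K t s * x s * (s <= t)%R%:R.
have mF y : measurable_fun [set: R] (F y).
  apply: measurable_funM; last exact: measurable_le_indic.
  apply: measurable_funM => //.
  by apply: continuous_measurable_fun; exact: continuous_kernel_section cK.
have FC y s : `|F y s| <= C * `|x s|.
  rewrite /F !normrM (@le_trans _ _ (`|K y s| * `|x s|))//.
    by rewrite ler_piMr ?mulr_ge0//; case: (s <= y); rewrite ?normr1 ?normr0 ?ler01.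
  by rewrite ler_wpM2r//; case: cK.
have [//|||||//|i1 _ h] := @dominated_convergence _ _ _ mu `[0, T]%classic _
  (fun n s => (F (u n) s)%:E) (fun s => (F t s)%:E) (fun s => (C * `|x s|)%:E).
- by move=> n; apply/measurable_EFinP/measurable_funTS; exact: mF.
- by apply/measurable_EFinP/measurable_funTS; exact: mF.
- exists [set t]; split; [exact: measurable_set1|exact: lebesgue_measure_set1|].
  move=> s /= hs; apply: contrapT => st; apply: hs => _.
  apply: cvg_EFin; first by apply: nearW.
  apply: cvgM; first apply: cvgM; last 1 first.
  + have [h|h] := ltP s t.
      rewrite (ltW h); apply: cvg_near_cst.
      have : \forall n \near \oo, s < u n by apply: (cvgr_gt t).
      by apply: filterS => n /ltW ->.
    have {}h : t < s by rewrite lt_neqAle h andbT; apply/eqP => e; apply: st.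
    rewrite leNgt h; apply: cvg_near_cst.
    have : \forall n \near \oo, u n < s by apply: (cvgr_lt t).
    by apply: filterS => n; rewrite ltNge => /negbTE ->.
  + by apply: (cvg_kernel cK); [exact: ut|exact: cvg_cst].
  + exact: cvg_cst.
- have := @integrable_norm _ _ _ mu _ _ ix => /(@integrableZl _ _ _ mu _ (measurable_itv `[0, T]) C).
  exact.
- by apply: aeW => s n _; rewrite lee_fin FC.
rewrite /Rintegral; apply: fine_cvg; rewrite fineK; first exact: h.
exact: (integrable_fin_num _ i1).
Qed.

Lemma memory_clamp (T : R) (K : R -> R -> R) (x : R -> R) t : t <= T ->
  \int[mu]_(s in `[0, t]) (K t s * x s) =
  \int[mu]_(s in `[0, T]) (K t s * x s * (s <= t)%R%:R).
Proof. by move=> tT; rewrite Rintegral_indic_le. Qed.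

Lemma ae_integrable_kernel (T : R) (K : R -> R -> R) (C : R) (x : R -> R) t :
  continuous_kernel K C -> ae_integrable T x -> ae_integrable T (fun s => K t s * x s).
Proof.
move=> cK xi; apply: (ae_integrable_le _ _ (ae_integrableZ C (ae_integrable_norm xi))).
  apply: ae_measurableM; last exact: ae_integrable_measurable.
  apply: measurable_ae_measurable; apply: continuous_measurable_fun.
  exact: continuous_kernel_section cK.
by apply: aeW => s _; rewrite normrM ler_wpM2r//; case: cK.
Qed.

Lemma ae_measurable_memory (T : R) (K : R -> R -> R) (C : R) (x : R -> R) :
  continuous_kernel K C -> ae_integrable T x ->
  ae_measurable T (fun t => \int[mu]_(s in `[0, t]) (K t s * x s)).
Proof.
move=> cK [x' [mx ix xx]].
exists (fun t => \int[mu]_(s in `[0, T]) (K t s * x' s * (s <= t)%R%:R)); split.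
  by apply: continuous_measurable_fun; exact: continuous_memory cK mx ix.
apply: aeW => t; rewrite /= in_itv /= => /andP[t0 tT].
rewrite -memory_clamp//; apply: ae_eq_Rintegral.
apply: (ae_imp xx) => s {}xx; rewrite /= in_itv /= => /andP[s0 st].
by rewrite xx//= in_itv /= s0 (le_trans st).
Qed.

Lemma normr_memory_le (T : R) (K : R -> R -> R) (C : R) (x : R -> R) t : t <= T ->
  continuous_kernel K C -> ae_integrable T x ->
  `|\int[mu]_(s in `[0, t]) (K t s * x s)| <=
  C * \int[mu]_(s in `[0, t]) `|x s|.
Proof.
move=> tT cK xi; rewrite -(Rintegral_aeZ tT)//; last exact: ae_integrable_norm.
apply: (normr_Rintegral_ae tT).
- exact: ae_integrable_kernel cK xi.
- exact/ae_integrableZ/ae_integrable_norm.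
- by apply: aeW => s _; rewrite normrM ler_wpM2r//; case: cK.
Qed.

End Memory.


(** * Systems of Volterra equations of the second kind *)

Section Volterra.
Context {R : realType}.
Local Notation mu := (@lebesgue_measure R).

(** Integrating the weight [expR (lam * s)] costs only a factor [1 / lam]; a large [lam] therefore
    makes the memory operator a contraction on an interval of any length. *)
Lemma Rintegral_expR_le (lam t : R) : 0 < lam -> 0 <= t ->
  \int[mu]_(s in `[0, t]) expR (lam * s) <= expR (lam * t) / lam.
Proof.
move=> lam0; rewrite le_eqVlt => /predU1P[<-|t0].
  by rewrite set_itv1 Rintegral_set1 divr_ge0 ?expR_ge0// ltW.
have dF (x : R) : is_derive x 1 (fun s : R => expR (lam * s) / lam) (expR (lam * x)).
  have d1 : is_derive x 1 (fun s : R => lam * s) lam.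
    have := @is_deriveZ _ _ _ (@idfun R) lam x 1 1 (is_derive_id _ _).
    by rewrite /GRing.scale /= mulr1.
  have d2 := is_derive1_comp (is_derive_expR (lam * x)) d1.
  have := @is_deriveZ _ _ _ _ lam^-1 x 1 _ d2.
  rewrite /GRing.scale /= [in X in is_derive _ _ _ X -> _]mulrCA mulVf ?gt_eqF// mulr1.
  have -> : (fun s : R => expR (lam * s) / lam) = lam^-1 \*: (expR \o *%R lam).
    by apply/funext => s; rewrite /GRing.scale /= mulrC.
  by [].
have cF : continuous (fun s : R => expR (lam * s) / lam).
  move=> x; apply: differentiable_continuous; apply/derivable1_diffP.
  by have [] := dF x.
have ce : continuous (fun s : R => expR (lam * s)).
  move=> x; apply: (@continuous_comp _ _ _ (fun s => lam * s) expR).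
    exact: mulrl_continuous.
  exact: continuous_expR.
rewrite /Rintegral (@continuous_FTC2 _ _ (fun s : R => expR (lam * s) / lam))//=.
- by rewrite mulr0 expR0 gerBl divr_ge0// ltW.
- exact: continuous_subspaceT.
- split.
  + by move=> x _; have [] := dF x.
  + exact/cvg_at_right_filter/cF.
  + exact/cvg_at_left_filter/cF.
- by move=> x _; rewrite derive1E; have [] := dF x.
Qed.

Lemma sum_geometric_half_le (m : nat) : \sum_(n < m) (2^-1 : R) ^+ n <= 2.
Proof.
suff -> : \sum_(n < m) (2^-1 : R) ^+ n = 2 - 2 * 2^-1 ^+ m.
  by rewrite gerBl mulr_ge0// exprn_ge0// invr_ge0.
elim: m => [|m IH]; first by rewrite big_ord0 expr0 mulr1 subrr.
by rewrite big_ord_recr /= IH exprS; field.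
Qed.

Lemma measurable_integrable_ae (T : R) (f : R -> R) : measurable_fun [set: R] f ->
  ae_integrable T f -> mu.-integrable `[0, T] (EFin \o f).
Proof.
move=> mf fi; apply/integrableP; split; first exact/measurable_EFinP/measurable_funTS.
by have := ae_integrable_int_J fi.
Qed.

Lemma continuous_integrable (T : R) (f : R -> R) : continuous f ->
  mu.-integrable `[0, T] (EFin \o f).
Proof.
move=> cf; apply: continuous_compact_integrable; first exact: segment_compact.
exact: continuous_subspaceT.
Qed.

Variables (T : R) (N : nat) (K : 'I_N -> 'I_N -> R -> R -> R) (C : R)
  (P : 'M[R]_N) (r : 'I_N -> R -> R).
Hypotheses (cK : forall l j, continuous_kernel (K l j) C)
  (mr : forall l, measurable_fun [set: R] (r l))
  (ir : forall l, mu.-integrable `[0, T] (EFin \o r l)).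

(** The memory operator followed by multiplication by [P]. Integrating over all of [[0, T]] with an
    indicator defines it, and makes it continuous, at every real [t]. *)
Let mem (x : 'I_N -> R -> R) (i : 'I_N) (t : R) : R :=
  \sum_l (\sum_j \int[mu]_(s in `[0, T]) (K l j t s * x j s * (s <= t)%R%:R)) * P l i.

Let memE x i t : t <= T -> mem x i t =
  \sum_l (\sum_j \int[mu]_(s in `[0, t]) (K l j t s * x j s)) * P l i.
Proof.
move=> tT; apply: eq_bigr => l _; congr (_ * _); apply: eq_bigr => j _.
by rewrite (memory_clamp _ _ tT).
Qed.

(** The terms of the Neumann series: iterates of the memory operator applied to the datum [r]
    multiplied by [P]. *)
Let d := fix d (n : nat) : 'I_N -> R -> R :=
  if n is n'.+1 then mem (d n') else fun i t => \sum_l r l t * P l i.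

Let mem_continuous x i : (forall j, measurable_fun [set: R] (x j)) ->
  (forall j, mu.-integrable `[0, T] (EFin \o x j)) -> continuous (mem x i).
Proof.
move=> mx ix t; apply: cvg_big => [|l _]; first exact: add_continuous.
apply: cvgM; last exact: cvg_cst.
apply: cvg_big => [|j _]; first exact: add_continuous.
exact: continuous_memory (cK l j) (mx j) (ix j) t.
Qed.

Let d_good n : (forall i, measurable_fun [set: R] (d n i)) /\
  forall i, mu.-integrable `[0, T] (EFin \o d n i).
Proof.
elim: n => [|n [mn fin]] /=.
  have md i : measurable_fun [set: R] (fun t => \sum_l r l t * P l i).
    by apply: measurable_sum => l; exact: measurable_funM.
  split => // i; apply: measurable_integrable_ae => //.
  apply: ae_integrable_sum => l; under eq_fun do rewrite mulrC.
  by apply: ae_integrableZ; exists (r l); split => //; exact: aeW.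
split => i; last by apply: continuous_integrable; exact: mem_continuous.
by apply: continuous_measurable_fun; exact: mem_continuous.
Qed.

Let d_ae n i : ae_integrable T (d n i).
Proof. by have [m f] := d_good n; exists (d n i); split => //; exact: aeW. Qed.

Let del n t := \sum_i `|d n i t|.

Let del_ae n : ae_integrable T (del n).
Proof. by apply: ae_integrable_sum => i; exact/ae_integrable_norm/d_ae. Qed.

Let C0 (i : 'I_N) : 0 <= C.
Proof. by have [_ /(_ 0 0)] := cK i i; exact: le_trans. Qed.

Let kappa := \sum_(i < N) \sum_(l < N) `|P l i| * `|C|.

Let kappa0 : 0 <= kappa.
Proof. by apply: sumr_ge0 => i _; apply: sumr_ge0 => l _; rewrite mulr_ge0. Qed.

Let del_step n t : t <= T ->
  del n.+1 t <= kappa * \int[mu]_(s in `[0, t]) del n s.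
Proof.
move=> tT; rewrite /del /kappa mulr_suml; apply: ler_sum => i _ /=.
rewrite memE// mulr_suml (le_trans (ler_norm_sum _ _ _))//.
apply: ler_sum => l _; rewrite normrM mulrC -mulrA ler_wpM2l//.
rewrite (Rintegral_ae_sum tT) => [|j]; last exact/ae_integrable_norm/d_ae.
rewrite mulr_sumr (le_trans (ler_norm_sum _ _ _))//; apply: ler_sum => j _.
by rewrite (ger0_norm (C0 i)); exact: (normr_memory_le tT (cK l j) (d_ae n j)).
Qed.

(** Chosen so that [kappa / lam] is at most one half; the summand 1 keeps [lam] positive when
    [kappa = 0]. *)
Let lam := 2 * (kappa + 1).
Let W := \int[mu]_(s in `[0, T]) del 0 s.

Let lam0 : 0 < lam.
Proof. by rewrite mulr_gt0// ltr_wpDl. Qed.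

Let del_ge0 n t : 0 <= del n t.
Proof. by apply: sumr_ge0. Qed.

Let W0 : 0 <= W.
Proof. by apply: Rintegral_ge0 => t _; exact: del_ge0. Qed.

(** In the sup norm weighted by [expR (lam * t)] every iteration gains a factor one half. The bound
    begins with the second term of the series: the first is merely integrable, and it takes one
    application of the memory operator to make it bounded by [kappa * W]. *)
Let del_le n t : 0 <= t <= T ->
  del n.+1 t <= kappa * W * (2^-1) ^+ n * expR (lam * t).
Proof.
elim: n t => [|n IH] t /andP[t0 tT].
  apply: (le_trans (del_step 0 tT)); rewrite expr0 mulr1.
  apply: (@le_trans _ _ (kappa * W)).
    by rewrite ler_wpM2l//; apply: le_Rintegral_itv (del_ae 0).
  rewrite ler_peMr ?mulr_ge0// -expR0 ler_expR mulr_ge0// ltW//.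
apply: (le_trans (del_step _ tT)).
have ei : ae_integrable T (fun s => expR (lam * s)).
  have ce : continuous (fun s : R => expR (lam * s)).
    move=> x; apply: (@continuous_comp _ _ _ (fun s => lam * s) expR).
      exact: mulrl_continuous.
    exact: continuous_expR.
  exists (fun s => expR (lam * s)); split; last exact: aeW.
    exact: continuous_measurable_fun.
  exact: continuous_integrable.
apply: (@le_trans _ _ (kappa * (kappa * W * (2^-1) ^+ n * (expR (lam * t) / lam)))).
  rewrite ler_wpM2l//; apply: (@le_trans _ _
    (\int[mu]_(s in `[0, t]) (kappa * W * (2^-1) ^+ n * expR (lam * s)))).
    apply: (le_ae_Rintegral (lexx t)).
    - exact: ae_integrableS (del_ae _).
    - exact: ae_integrableS (ae_integrableZ _ ei).
    apply: aeW => s; rewrite /= in_itv /= => /andP[s0 st].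
    by apply: IH; rewrite s0 (le_trans st).
  rewrite (Rintegral_aeZ tT _ ei) ler_wpM2l ?Rintegral_expR_le//.
  by rewrite !mulr_ge0// exprn_ge0// invr_ge0.
rewrite exprS; set E := expR _; set z := _ ^+ n.
have E0 : 0 <= E by exact: expR_ge0.
have z0 : 0 <= z by rewrite exprn_ge0// invr_ge0.
have -> : kappa * (kappa * W * z * (E / lam)) = (kappa * W * z * E) * (kappa / lam).
  by field; rewrite gt_eqF.
have -> : kappa * W * (2^-1 * z) * E = (kappa * W * z * E) * 2^-1 by ring.
rewrite ler_wpM2l ?mulr_ge0//.
by rewrite ler_pdivrMr// /lam mulrA mulVf// mul1r lerDl.
Qed.

Let G := kappa * W * expR (lam * T).
Let G0 : 0 <= G.
Proof. by rewrite !mulr_ge0// expR_ge0. Qed.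

(** A single geometric bound for the integrable first term and the bounded later ones; the factor 2
    in [2 * G] pays for the index shift in [del_le]. It yields both pointwise convergence and an
    integrable majorant of the partial sums. *)
Let d_le n i t : 0 <= t <= T -> `|d n i t| <= (del 0 t + 2 * G) * (2^-1) ^+ n.
Proof.
move=> tT; apply: (@le_trans _ _ (del n t)).
  by rewrite /del (bigD1 i)//= lerDl sumr_ge0.
case: n => [|n]; first by rewrite expr0 mulr1 lerDl mulr_ge0.
apply: (le_trans (del_le n tT)); rewrite exprS.
have z0 : 0 <= (2^-1 : R) ^+ n by rewrite exprn_ge0// invr_ge0.
apply: (@le_trans _ _ (G * (2^-1) ^+ n)).
  rewrite /G -[leRHS]mulrA [expR _ * _]mulrC mulrA.
  rewrite ler_wpM2l ?mulr_ge0// ler_expR ler_wpM2l ?(ltW lam0)//.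
  by case/andP: tT.
have := mulr_ge0 (del_ge0 0 t) z0; set z := _ ^+ n; lra.
Qed.

Let S m j t := \sum_(n < m) d n j t.

Let S_le m j t : 0 <= t <= T -> `|S m j t| <= 2 * (del 0 t + 2 * G).
Proof.
move=> tT; apply: (le_trans (ler_norm_sum _ _ _)).
apply: (@le_trans _ _ (\sum_(n < m) (del 0 t + 2 * G) * (2^-1) ^+ n)).
  by apply: ler_sum => n _; exact: d_le.
rewrite -mulr_sumr mulrC ler_wpM2r ?sum_geometric_half_le//.
by rewrite addr_ge0// mulr_ge0.
Qed.

Let S_cvg j t : 0 <= t <= T -> cvgn (fun m => S m j t).
Proof.
move=> tT; have -> : (fun m => S m j t) = series (fun n => d n j t).
  by apply/funext => m; rewrite /series /= big_mkord.
apply: normed_cvg.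
apply: (series_le_cvg (v_ := geometric (del 0 t + 2 * G) 2^-1)) => [n|n|n|].
- exact: normr_ge0.
- by rewrite /geometric /= mulr_ge0 ?addr_ge0 ?mulr_ge0// exprn_ge0// invr_ge0.
- exact: d_le.
- by apply: is_cvg_geometric_series; rewrite ger0_norm ?invr_ge0// invf_lt1// ltr1n.
Qed.

Let x j t : R := if 0 <= t <= T then limn (fun m => S m j t) else 0.

Let S_x j t : 0 <= t <= T -> S m j t @[m --> \oo] --> x j t.
Proof. by move=> tT; rewrite /x tT; exact: S_cvg. Qed.

Let S_measurable m j : measurable_fun [set: R] (S m j).
Proof. by apply: measurable_sum => n; have [] := d_good n. Qed.

Let S_ae m j : ae_integrable T (S m j).
Proof. by apply: ae_integrable_sum => n; exact: d_ae. Qed.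

Let x_measurable j : measurable_fun [set: R] (x j).
Proof.
apply: (@measurable_fun_cvg _ _ _ _ (fun m => S m j \_ `[0%R, T])).
  by move=> m; apply/(measurable_restrictT _ _).1 => //; exact: measurable_funTS.
move=> t _; have [tT|tT] := boolP (0 <= t <= T).
  have tJ : t \in `[0, T]%classic by apply/mem_set; rewrite /= in_itv.
  by under eq_fun do rewrite patchE tJ; exact: S_x.
have tJ : t \in `[0, T]%classic = false.
  by apply/negbTE/negP => /set_mem; rewrite /= in_itv /=; exact/negP.
by under eq_fun do rewrite patchE tJ; rewrite /x (negbTE tT); exact: cvg_cst.
Qed.

Let bound_integrable (k t : R) : t <= T ->
  mu.-integrable `[0, t] (EFin \o fun s => k * (2 * (del 0 s + 2 * G))).
Proof.
move=> tT; apply: measurable_integrable_ae.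
  apply: measurable_funM => //; apply: measurable_funM => //.
  apply: measurable_funD => //; apply: measurable_sum => i.
  by apply: measurableT_comp => //; have [] := d_good 0.
apply: (ae_integrableS tT); apply/ae_integrableZ/ae_integrableZ/ae_integrableD => //.
exact: ae_integrable_cst.
Qed.

Let itvP (t s : R) : t <= T -> `[0, t]%classic s -> 0 <= s <= T.
Proof. by rewrite /= in_itv /= => tT /andP[-> st]; rewrite (le_trans st). Qed.

Let x_integrable j : mu.-integrable `[0, T] (EFin \o x j).
Proof.
have [//|||||//|i1 _ _] := @dominated_convergence _ _ _ mu `[0, T]%classic _
  (fun m s => (S m j s)%:E) (fun s => (x j s)%:E)
  (EFin \o fun s => 1 * (2 * (del 0 s + 2 * G))).
- by move=> m; apply/measurable_EFinP/measurable_funTS; exact: S_measurable.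
- by apply/measurable_EFinP/measurable_funTS; exact: x_measurable.
- apply: aeW => s sJ; apply: cvg_EFin; first exact: nearW.
  exact/S_x/(itvP (lexx T)).
- exact: bound_integrable.
- apply: aeW => s m sJ; rewrite /= lee_fin mul1r.
  exact/S_le/(itvP (lexx T)).
exact: i1.
Qed.

Let Phi (y : 'I_N -> R -> R) i t :=
  \sum_l (r l t + \sum_j \int[mu]_(s in `[0, t]) (K l j t s * y j s)) * P l i.

(** The partial sums are the Picard iterates started at 0, so the equation is obtained by passing to
    the limit on both sides. *)
Let S_Phi m i t : t <= T -> S m.+1 i t = Phi (S m) i t.
Proof.
move=> tT; elim: m => [|m IH].
  rewrite /S big_ord_recr big_ord0 /= add0r /Phi; apply: eq_bigr => l _.
  congr (_ * _); rewrite big1 ?addr0// => j _.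
  rewrite (_ : (fun _ => _) = cst 0); last by apply/funext => s /=; rewrite big_ord0 mulr0.
  by rewrite Rintegral_cst// mul0r.
have -> : S m.+2 i t = S m.+1 i t + d m.+1 i t by rewrite /S big_ord_recr.
have -> : d m.+1 i t = mem (d m) i t by [].
rewrite IH memE// /Phi -big_split /=.
apply: eq_bigr => l _; rewrite -mulrDl -addrA; congr ((_ + _) * _).
rewrite -big_split; apply: eq_bigr => j _ /=.
rewrite -(Rintegral_aeD tT); last 2 first.
- exact: ae_integrable_kernel (cK l j) (S_ae m j).
- exact: ae_integrable_kernel (cK l j) (d_ae m j).
by apply: eq_Rintegral => s _; rewrite -mulrDr /S big_ord_recr.
Qed.

Let Phi_cvg i t : 0 <= t <= T -> Phi (S m) i t @[m --> \oo] --> Phi x i t.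
Proof.
move=> /andP[t0 tT].
apply: cvg_big => [|l _]; first exact: add_continuous.
apply: cvgM; last exact: cvg_cst.
apply: cvgD; first exact: cvg_cst.
apply: cvg_big => [|j _]; first exact: add_continuous.
have mK : measurable_fun [set: R] (K l j t).
  by apply: continuous_measurable_fun; exact: continuous_kernel_section (cK l j).
have [//|||||//|i1 _ h] := @dominated_convergence _ _ _ mu `[0, t]%classic _
  (fun m s => (K l j t s * S m j s)%:E) (fun s => (K l j t s * x j s)%:E)
  (EFin \o fun s => C * (2 * (del 0 s + 2 * G))).
- move=> m; apply/measurable_EFinP/measurable_funTS.
  exact: measurable_funM mK (S_measurable m j).
- apply/measurable_EFinP/measurable_funTS.
  exact: measurable_funM mK (x_measurable j).
- apply: aeW => s sJ; apply: cvg_EFin; first exact: nearW.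
  by apply: cvgM; [exact: cvg_cst|exact/S_x/(itvP tT)].
- exact: bound_integrable.
- apply: aeW => s m sJ; rewrite /= lee_fin normrM ler_pM//.
    by case: (cK l j).
  exact/S_le/(itvP tT).
rewrite /Rintegral; apply: fine_cvg; rewrite fineK; first exact: h.
exact: (integrable_fin_num _ i1).
Qed.

Theorem volterra_solution : exists x : 'I_N -> R -> R,
  [/\ forall i, measurable_fun [set: R] (x i),
      forall i, mu.-integrable `[0, T] (EFin \o x i) &
      forall i t, 0 <= t <= T -> x i t =
        \sum_l (r l t + \sum_j \int[mu]_(s in `[0, t]) (K l j t s * x j s)) * P l i].
Proof.
exists x; split => [||i t tT]; [exact: x_measurable|exact: x_integrable|].
have h := @Phi_cvg i t tT.
have h2 : S m.+1 i t @[m --> \oo] --> x i t.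
  by have := @S_x i t tT; rewrite -(cvg_shiftS (fun m => S m i t)).
have tT' : t <= T by case/andP: tT.
have e : (fun m => S m.+1 i t) = (fun m => Phi (S m) i t).
  by apply/funext => m; exact: S_Phi.
rewrite e in h2; rewrite -(cvg_lim (@Rhausdorff R) h2).
exact: (cvg_lim (@Rhausdorff R) h).
Qed.

End Volterra.


(** * Memory terms at a fixed test vector *)

Section ScalarMemory.
Context {R : realType}.
Local Notation mu := (@lebesgue_measure R).
Variables (T : R) (k l : R -> R -> R) (Ck Cl : R).
Hypotheses (T0 : 0 <= T) (bk : bounded_kernel T k Ck) (bl : bounded_kernel T l Cl).

Let ck := continuous_kernel_clamp T0 bk.
Let cl := continuous_kernel_clamp T0 bl.

(** The common shape of [memory_V] and [memory_Q] once the test vector is fixed; for the latter, [g]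
    carries the minus sign of [c]. *)
Definition scalar_memory (f g : R -> R) (t : R) : R :=
  \int[mu]_(s in `[0, t]) (k t s * f s + l t s * g s).

Lemma scalar_memoryE (f g : R -> R) t :
  ae_integrable T f -> ae_integrable T g -> t <= T ->
  scalar_memory f g t =
    \int[mu]_(s in `[0, t]) (clamp_kernel T k t s * f s) +
    \int[mu]_(s in `[0, t]) (clamp_kernel T l t s * g s).
Proof.
move=> fi gi tT.
rewrite -(Rintegral_aeD tT); last 2 first.
- exact: ae_integrable_kernel ck fi.
- exact: ae_integrable_kernel cl gi.
apply: eq_Rintegral => s /set_mem; rewrite /= in_itv /= => /andP[s0 st].
by rewrite !clamp_kernelE.
Qed.

Lemma scalar_memory_linear (r : R) (f g f' g' : R -> R) t :
  ae_integrable T f -> ae_integrable T g ->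
  ae_integrable T f' -> ae_integrable T g' -> t <= T ->
  scalar_memory (fun s => r * f s + f' s) (fun s => r * g s + g' s) t =
  r * scalar_memory f g t + scalar_memory f' g' t.
Proof.
move=> fi gi fi' gi' tT.
have rfi := ae_integrableD (ae_integrableZ r fi) fi'.
have rgi := ae_integrableD (ae_integrableZ r gi) gi'.
rewrite !scalar_memoryE//.
have lin (K : R -> R -> R) (C : R) (x x' : R -> R) : continuous_kernel K C ->
    ae_integrable T x -> ae_integrable T x' ->
    \int[mu]_(s in `[0, t]) (K t s * (r * x s + x' s)) =
    r * \int[mu]_(s in `[0, t]) (K t s * x s) +
    \int[mu]_(s in `[0, t]) (K t s * x' s).
  move=> cK xi xi'; have Kx := ae_integrable_kernel t cK xi.
  have Kx' := ae_integrable_kernel t cK xi'.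
  rewrite -(Rintegral_aeZ tT _ Kx) -(Rintegral_aeD tT (ae_integrableZ r Kx) Kx').
  by apply: eq_Rintegral => s _; ring.
by rewrite (lin _ _ _ _ ck)// (lin _ _ _ _ cl)//; ring.
Qed.

Lemma ae_measurable_scalar_memory (f g : R -> R) :
  ae_integrable T f -> ae_integrable T g -> ae_measurable T (scalar_memory f g).
Proof.
move=> fi gi.
apply: ae_eq_ae_measurable (ae_measurableD (ae_measurable_memory ck fi)
  (ae_measurable_memory cl gi)).
apply: aeW => t; rewrite /= in_itv /= => /andP[t0 tT].
exact: scalar_memoryE.
Qed.

Lemma normr_scalar_memory (f g w : R -> R) t :
  ae_integrable T f -> ae_integrable T g -> ae_integrable T w -> t <= T ->
  {ae mu, forall s, `[0, T]%classic s -> Ck * `|f s| + Cl * `|g s| <= w s} ->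
  `|scalar_memory f g t| <= \int[mu]_(s in `[0, t]) w s.
Proof.
move=> fi gi wi tT fgw; rewrite scalar_memoryE//.
have fn := ae_integrable_norm fi; have gn := ae_integrable_norm gi.
rewrite (le_trans (ler_normD _ _))//.
rewrite (le_trans (lerD (normr_memory_le tT ck fi) (normr_memory_le tT cl gi)))//.
rewrite -(Rintegral_aeZ tT _ fn) -(Rintegral_aeZ tT _ gn).
rewrite -(Rintegral_aeD tT (ae_integrableZ _ fn) (ae_integrableZ _ gn)).
apply: (le_ae_Rintegral tT) => //.
exact: ae_integrableD (ae_integrableZ _ fn) (ae_integrableZ _ gn).
Qed.

End ScalarMemory.

(** * Measurability, linearity and bounds of the memory functionals *)

Section Evolution.
Context {R : realType} {V Q : hilbertType R}.
Local Notation mu := (@lebesgue_measure R).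

Lemma ae_integrable_forml (X Y : normedModType R) (f : {bilinear X -> Y -> R^o})
    (T : R) (A : set X) (u : R -> X) y : form_continuous f ->
  bochner_L1 T A u -> ae_integrable T (fun t => f (u t) y).
Proof.
move=> cf bu; have [su _ _] := bu.
apply: (@ae_integrable_le _ _ _ (fun t => form_norm f * `|y| * `|u t|)).
- apply: (ae_measurable_continuous (h := fun x => f x y) _ su).
  exact: form_continuousl.
- by apply: aeW => t _; rewrite -mulrA [`|y| * _]mulrC le_form_norm.
- exact/ae_integrableZ/(bochner_norm bu).
Qed.

Lemma ae_integrable_formr (X Y : normedModType R) (f : {bilinear X -> Y -> R^o})
    (T : R) (A : set Y) (u : R -> Y) x : form_continuous f ->
  bochner_L1 T A u -> ae_integrable T (fun t => f x (u t)).
Proof.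
move=> cf bu; have [su _ _] := bu.
apply: (@ae_integrable_le _ _ _ (fun t => form_norm f * `|x| * `|u t|)).
- apply: (ae_measurable_continuous (h := f x) _ su).
  exact: form_continuousr.
- by apply: aeW => t _; rewrite -mulrA le_form_norm.
- exact/ae_integrableZ/(bochner_norm bu).
Qed.

Lemma dnorm_le_on (W : normedModType R) (A : set W) (l : W -> R) M : 0 <= M ->
  (forall v, A v -> `|l v| <= M * `|v|) -> dnorm A l <= M.
Proof.
move=> M0 lM; rewrite /dnorm; set S := (X in sup X).
have [->|/set0P ne] := eqVneq S set0; first by rewrite sup0.
apply: ge_sup => // _ [v [Av /eqP v0] <-].
by rewrite ler_pdivrMr ?normr_gt0// lM.
Qed.

Lemma ae_measurable_dnorm (W : hilbertType R) (A : set W) (T : R)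
    (F : R -> W -> R) : fin_dim_subspace A ->
  {ae mu, forall t, `[0, T]%classic t -> linear_on A (F t)} ->
  (forall v, A v -> ae_measurable T (F^~ v)) ->
  ae_measurable T (fun t => dnorm A (F t)).
Proof.
move=> fA lF mF; have sA := fin_dim_subspace_subspace fA.
have [n [e eb]] := orthonormal_basis_exists fA sA (@subset_refl _ _).
apply: (@ae_eq_ae_measurable _ _ _ (fun t => Num.sqrt (\sum_i F t (e i) ^+ 2))).
  apply: (ae_imp lF) => t {}lF Jt.
  by have [] := dnorm_orthonormal_basis sA eb (lF Jt).
apply: (ae_measurable_comp (h := Num.sqrt)); first exact: sqrt_continuous.
apply: ae_measurable_sum => i; under eq_fun do rewrite expr2.
by have [_ eA _] := eb; apply: ae_measurableM; exact: mF.
Qed.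

Lemma dnorm_bound (W : hilbertType R) (A : set W) (l : W -> R) :
  fin_dim_subspace A -> linear_on A l ->
  forall v, A v -> `|l v| <= dnorm A l * `|v|.
Proof.
move=> fA lA; have sA := fin_dim_subspace_subspace fA.
have [n [e eb]] := orthonormal_basis_exists fA sA (@subset_refl _ _).
by have [] := dnorm_orthonormal_basis sA eb lA.
Qed.

Variables (a : {bilinear V -> V -> R^o}) (b : {bilinear V -> Q -> R^o})
  (c : {bilinear Q -> Q -> R^o}) (k1 k2 k3 k4 : R -> R -> R)
  (Ck1 Ck2 Ck3 Ck4 T : R).
Hypotheses (T0 : 0 <= T) (ca : form_continuous a) (cb : form_continuous b)
  (cc : form_continuous c) (pa : sym_psd a) (pc : sym_psd c)
  (bk1 : bounded_kernel T k1 Ck1) (bk2 : bounded_kernel T k2 Ck2)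
  (bk3 : bounded_kernel T k3 Ck3) (bk4 : bounded_kernel T k4 Ck4).

Lemma memory_VE u p t v : memory_V a b k1 k2 u p t v =
  scalar_memory k1 k2 (fun s => a (u s) v) (fun s => b v (p s)) t.
Proof. by []. Qed.

Lemma memory_QE u p t q : memory_Q b c k3 k4 u p t q =
  scalar_memory k3 k4 (fun s => b (u s) q) (fun s => - c (p s) q) t.
Proof. by apply: eq_Rintegral => s _; rewrite mulrN. Qed.

Section Pair.
Variables (A : set V) (B : set Q) (u : R -> V) (p : R -> Q).
Hypotheses (bu : bochner_L1 T A u) (bp : bochner_L1 T B p).

Lemma ae_integrable_memory_args v q :
  [/\ ae_integrable T (fun s => a (u s) v), ae_integrable T (fun s => b v (p s)),
      ae_integrable T (fun s => b (u s) q) & ae_integrable T (fun s => - c (p s) q)].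
Proof.
split.
- exact: ae_integrable_forml ca bu.
- exact: ae_integrable_formr cb bp.
- exact: ae_integrable_forml cb bu.
- under eq_fun do rewrite -mulN1r.
  exact/ae_integrableZ/(ae_integrable_forml _ cc bp).
Qed.

Lemma memory_linear t : t <= T ->
  linear_on setT (memory_V a b k1 k2 u p t) /\
  linear_on setT (memory_Q b c k3 k4 u p t).
Proof.
move=> tT; split=> r x y _ _.
  have [xa xb _ _] := ae_integrable_memory_args x 0.
  have [ya yb _ _] := ae_integrable_memory_args y 0.
  rewrite !memory_VE -(scalar_memory_linear T0 bk1 bk2)//.
  apply: eq_Rintegral => s _.
  by rewrite bilinear_linearl (bilinear_linearr a r x y).
have [_ _ xa xb] := ae_integrable_memory_args 0 x.
have [_ _ ya yb] := ae_integrable_memory_args 0 y.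
rewrite !memory_QE -(scalar_memory_linear T0 bk3 bk4)//.
apply: eq_Rintegral => s _.
rewrite (bilinear_linearr b r x y) (bilinear_linearr c r x y).
ring.
Qed.

Lemma ae_measurable_memoryVQ v q :
  ae_measurable T (fun t => memory_V a b k1 k2 u p t v) /\
  ae_measurable T (fun t => memory_Q b c k3 k4 u p t q).
Proof.
have [xa xb ya yb] := ae_integrable_memory_args v q; split.
  exact: (ae_measurable_scalar_memory T0 bk1 bk2 xa xb).
under eq_fun do rewrite memory_QE.
exact: (ae_measurable_scalar_memory T0 bk3 bk4 ya yb).
Qed.

(** The dominating function [w] is left free: the stability estimate uses a multiple of the Gronwall
    quantity, the consistency estimate a multiple of the interpolation error. *)
Lemma normr_memory w t v q : ae_integrable T w -> t <= T ->
  {ae mu, forall s, `[0, T]%classic s ->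
    Ck1 * `|a (u s) v| + Ck2 * `|b v (p s)| <= w s * `|v|} ->
  {ae mu, forall s, `[0, T]%classic s ->
    Ck3 * `|b (u s) q| + Ck4 * `|c (p s) q| <= w s * `|q|} ->
  `|memory_V a b k1 k2 u p t v| <= \int[mu]_(s in `[0, t]) w s * `|v| /\
  `|memory_Q b c k3 k4 u p t q| <= \int[mu]_(s in `[0, t]) w s * `|q|.
Proof.
move=> wi tT hV hQ; have [xa xb ya yb] := ae_integrable_memory_args v q.
have wZ (x : R) : ae_integrable T (fun s => w s * x).
  by under eq_fun do rewrite mulrC; exact: ae_integrableZ.
have eZ (x : R) : \int[mu]_(s in `[0, t]) w s * x = \int[mu]_(s in `[0, t]) (w s * x).
  by rewrite mulrC -(Rintegral_aeZ tT _ wi); apply: eq_Rintegral => s _; rewrite mulrC.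
rewrite !eZ; split.
  rewrite memory_VE; exact: (normr_scalar_memory T0 bk1 bk2 xa xb (wZ _) tT hV).
rewrite memory_QE; apply: (normr_scalar_memory T0 bk3 bk4 ya yb (wZ _) tT).
by apply: (ae_imp hQ) => s {}hQ Js; rewrite normrN; exact: hQ.
Qed.

End Pair.

Lemma memory_sub (A A' : set V) (B B' : set Q) (u u' : R -> V) (p p' : R -> Q) t v q :
  bochner_L1 T A u -> bochner_L1 T B p ->
  bochner_L1 T A' u' -> bochner_L1 T B' p' -> t <= T ->
  memory_V a b k1 k2 (fun s => u s - u' s) (fun s => p s - p' s) t v =
    memory_V a b k1 k2 u p t v - memory_V a b k1 k2 u' p' t v /\
  memory_Q b c k3 k4 (fun s => u s - u' s) (fun s => p s - p' s) t q =
    memory_Q b c k3 k4 u p t q - memory_Q b c k3 k4 u' p' t q.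
Proof.
move=> bu bp bu' bp' tT.
have [xa xb ya yb] := ae_integrable_memory_args bu bp v q.
have [xa' xb' ya' yb'] := ae_integrable_memory_args bu' bp' v q.
rewrite !memory_VE !memory_QE; split.
  rewrite addrC -mulN1r -(scalar_memory_linear T0 bk1 bk2)//.
  apply: eq_Rintegral => s _; rewrite (bilinearBl a) (bilinearBr b).
  ring.
rewrite addrC -mulN1r -(scalar_memory_linear T0 bk3 bk4)//.
apply: eq_Rintegral => s _; rewrite (bilinearBl b) (bilinearBl c).
ring.
Qed.

End Evolution.


(** * Stability of the discrete evolution problem *)

Section Stability.
Context {R : realType} {V Q : hilbertType R}.
Local Notation mu := (@lebesgue_measure R).

(** For data of size [d], the static estimate bounds [|u| + |p|] by [static_const * d], and the
    equations bound the two dual norms of [b] by [d + na * |u|] and [d + nc * |p|]; this is the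
    factor of [d] in the sum. *)
Definition amplification (alpha beta gamma na nc : R) : R :=
  (1 + na + nc) * static_const alpha beta gamma na nc + 2.

(** Only values of [a] and [c] cost a norm: [Ck2] and [Ck3] multiply dual norms of [b] that are
    themselves summands of the Gronwall quantity. *)
Definition memory_rate (na nc Ck1 Ck2 Ck3 Ck4 : R) : R :=
  Ck1 * na + Ck2 + Ck3 + Ck4 * nc.

Definition stability_const (alpha beta gamma na nc Ck1 Ck2 Ck3 Ck4 T : R) : R :=
  gronwall_const (amplification alpha beta gamma na nc *
    memory_rate na nc Ck1 Ck2 Ck3 Ck4) T * amplification alpha beta gamma na nc.

Lemma amplification_gt0 alpha beta gamma na nc : 0 < alpha -> 0 < beta ->
  0 < gamma -> 0 <= na -> 0 <= nc -> 0 < amplification alpha beta gamma na nc.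
Proof.
move=> a0 b0 g0 na0 nc0; rewrite /amplification ltr_wpDl//.
have s0 := static_const_gt0 a0 b0 g0 na0 nc0.
by apply: mulr_ge0; [rewrite !addr_ge0|exact: ltW].
Qed.

Lemma stability_const_gt0 alpha beta gamma na nc Ck1 Ck2 Ck3 Ck4 T :
  0 < alpha -> 0 < beta -> 0 < gamma -> 0 <= na -> 0 <= nc ->
  0 < stability_const alpha beta gamma na nc Ck1 Ck2 Ck3 Ck4 T.
Proof.
by move=> *; rewrite mulr_gt0 ?gronwall_const_gt0 ?amplification_gt0.
Qed.

Variables (a : {bilinear V -> V -> R^o}) (b : {bilinear V -> Q -> R^o})
  (c : {bilinear Q -> Q -> R^o}) (k1 k2 k3 k4 : R -> R -> R)
  (Ck1 Ck2 Ck3 Ck4 T alpha beta gamma : R) (Vh : set V) (Qh : set Q).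
Hypotheses (T0 : 0 <= T) (ca : form_continuous a) (cb : form_continuous b)
  (cc : form_continuous c) (pa : sym_psd a) (pc : sym_psd c)
  (bk1 : bounded_kernel T k1 Ck1) (bk2 : bounded_kernel T k2 Ck2)
  (bk3 : bounded_kernel T k3 Ck3) (bk4 : bounded_kernel T k4 Ck4)
  (fV : fin_dim_subspace Vh) (fQ : fin_dim_subspace Qh).
Let Kh := kernel_l b Vh Qh.
Let Hh := kernel_r b Vh Qh.
Hypotheses (alpha0 : 0 < alpha) (cK : coercive_on a Kh alpha)
  (gamma0 : 0 < gamma) (cH : coercive_on c Hh gamma) (beta0 : 0 < beta)
  (infsupQ : forall q, orthocompl Qh Hh q ->
     sup [set b v q / `|v| | v in Vh `\ 0] >= beta * `|q|)
  (infsupV : forall v, orthocompl Vh Kh v ->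
     sup [set b v q / `|q| | q in Qh `\ 0] >= beta * `|v|).

Let na := form_norm a.
Let nc := form_norm c.
Let na0 : 0 <= na. Proof. exact: form_norm_ge0. Qed.
Let nc0 : 0 <= nc. Proof. exact: form_norm_ge0. Qed.
Let sV := fin_dim_subspace_subspace fV.
Let sQ := fin_dim_subspace_subspace fQ.

Variables (u : R -> V) (p : R -> Q) (F : R -> V -> R) (G : R -> Q -> R).
Hypotheses (bu : bochner_L1 T Vh u) (bp : bochner_L1 T Qh p)
  (FV : forall v, Vh v -> ae_measurable T (F^~ v))
  (GQ : forall q, Qh q -> ae_measurable T (G^~ q))
  (linF : {ae mu, forall t, `[0, T]%classic t -> linear_on Vh (F t)})
  (linG : {ae mu, forall t, `[0, T]%classic t -> linear_on Qh (G t)})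
  (eqn : {ae mu, forall t, `[0, T]%classic t -> forall v q, Vh v -> Qh q ->
    a (u t) v + b v (p t) = F t v + memory_V a b k1 k2 u p t v /\
    b (u t) q - c (p t) q = G t q + memory_Q b c k3 k4 u p t q}).

Let DF t := dnorm Vh (F t).
Let DG t := dnorm Qh (G t).
Let N1 t := dnorm Vh (b^~ (p t)).
Let N2 t := dnorm Qh (b (u t)).
(* The dual norms of [b _ (p t)] and [b (u t) _] are part of the quantity to
   which Gronwall's inequality is applied: bounding the memory terms with
   [form_norm b] instead would make the constants depend on it. *)
Let M t := `|u t| + `|p t| + (N1 t + N2 t).
Let A1 := amplification alpha beta gamma na nc.
Let L := memory_rate na nc Ck1 Ck2 Ck3 Ck4.

Let DF0 t : 0 <= DF t. Proof. exact: Defs.dnorm_ge0. Qed.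
Let DG0 t : 0 <= DG t. Proof. exact: Defs.dnorm_ge0. Qed.
Let N10 t : 0 <= N1 t. Proof. exact: Defs.dnorm_ge0. Qed.
Let N20 t : 0 <= N2 t. Proof. exact: Defs.dnorm_ge0. Qed.
Let M0 t : 0 <= M t. Proof. by rewrite !addr_ge0. Qed.

Let linb1 t : linear_on Vh (b^~ (p t)).
Proof. by move=> k x y _ _; rewrite bilinear_linearl. Qed.

Let linb2 t : linear_on Qh (b (u t)).
Proof. by move=> k x y _ _; rewrite (bilinear_linearr b k x y). Qed.

(** Here, and for [N2], [form_norm b] serves to prove integrability only; it does not pass into a
    constant. *)
Let N1i : ae_integrable T N1.
Proof.
apply: (@ae_integrable_le _ _ _ (fun t => form_norm b * `|p t|)).
- apply: ae_measurable_dnorm => //; first by apply: aeW => t _; exact: linb1.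
  by move=> v _; apply: ae_integrable_measurable; exact: ae_integrable_formr cb bp.
- apply: aeW => t _; rewrite ger0_norm//; apply: dnorm_le_on.
    by rewrite mulr_ge0// form_norm_ge0.
  by move=> v _; rewrite -mulrA [`|p t| * _]mulrC le_form_norm.
- exact/ae_integrableZ/(bochner_norm bp).
Qed.

Let N2i : ae_integrable T N2.
Proof.
apply: (@ae_integrable_le _ _ _ (fun t => form_norm b * `|u t|)).
- apply: ae_measurable_dnorm => //; first by apply: aeW => t _; exact: linb2.
  by move=> v _; apply: ae_integrable_measurable; exact: ae_integrable_forml cb bu.
- apply: aeW => t _; rewrite ger0_norm//; apply: dnorm_le_on.
    by rewrite mulr_ge0// form_norm_ge0.
  by move=> v _; rewrite -mulrA le_form_norm.
- exact/ae_integrableZ/(bochner_norm bu).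
Qed.

Let Mi : ae_integrable T M.
Proof.
apply: ae_integrableD (ae_integrableD N1i N2i).
exact: ae_integrableD (bochner_norm bu) (bochner_norm bp).
Qed.

Let L0 : 0 <= L.
Proof.
have := bounded_kernel_ge0 T0 bk1; have := bounded_kernel_ge0 T0 bk2.
have := bounded_kernel_ge0 T0 bk3; have := bounded_kernel_ge0 T0 bk4.
by move=> *; rewrite /L /memory_rate !addr_ge0// mulr_ge0.
Qed.

Let A10 : 0 < A1. Proof. exact: amplification_gt0. Qed.

Let memory_le t v q : t <= T -> Vh v -> Qh q ->
  `|memory_V a b k1 k2 u p t v| <= L * \int[mu]_(s in `[0, t]) M s * `|v| /\
  `|memory_Q b c k3 k4 u p t q| <= L * \int[mu]_(s in `[0, t]) M s * `|q|.
Proof.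
move=> tT Vv Qq; rewrite -(Rintegral_aeZ tT _ Mi).
have K1 := bounded_kernel_ge0 T0 bk1; have K2 := bounded_kernel_ge0 T0 bk2.
have K3 := bounded_kernel_ge0 T0 bk3; have K4 := bounded_kernel_ge0 T0 bk4.
have le1 s : Ck1 * (na * `|u s|) <= Ck1 * na * M s.
  by rewrite mulrA ler_wpM2l ?mulr_ge0// /M -addrA lerDl addr_ge0// addr_ge0.
have le2 s : Ck2 * N1 s <= Ck2 * M s.
  by rewrite ler_wpM2l// /M addrCA lerDl addr_ge0// addr_ge0.
have le3 s : Ck3 * N2 s <= Ck3 * M s.
  by rewrite ler_wpM2l// /M addrA lerDr addr_ge0// addr_ge0.
have le4 s : Ck4 * (nc * `|p s|) <= Ck4 * nc * M s.
  by rewrite mulrA ler_wpM2l ?mulr_ge0// /M -addrA addrCA lerDl !addr_ge0.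
have LM s : L * M s = Ck1 * na * M s + Ck2 * M s + Ck3 * M s + Ck4 * nc * M s.
  by rewrite /L /memory_rate; ring.
have p1 s : 0 <= Ck1 * na * M s by rewrite !mulr_ge0.
have p2 s : 0 <= Ck2 * M s by rewrite !mulr_ge0.
have p3 s : 0 <= Ck3 * M s by rewrite !mulr_ge0.
have p4 s : 0 <= Ck4 * nc * M s by rewrite !mulr_ge0.
apply: (normr_memory T0 ca cb cc bk1 bk2 bk3 bk4 bu bp (ae_integrableZ L Mi) tT).
- apply: aeW => s _.
  apply: (@le_trans _ _ ((Ck1 * (na * `|u s|) + Ck2 * N1 s) * `|v|)).
    rewrite mulrDl -!mulrA lerD// ler_wpM2l//; first exact: le_form_norm.
    exact: (dnorm_bound fV (linb1 s) Vv).
  rewrite ler_wpM2r// LM; have := le1 s; have := le2 s; have := p3 s.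
  have := p4 s; lra.
- apply: aeW => s _.
  apply: (@le_trans _ _ ((Ck3 * N2 s + Ck4 * (nc * `|p s|)) * `|q|)).
    rewrite mulrDl -!mulrA lerD// ler_wpM2l//; last exact: le_form_norm.
    exact: (dnorm_bound fQ (linb2 s) Qq).
  rewrite ler_wpM2r// LM; have := le3 s; have := le4 s; have := p1 s.
  have := p2 s; lra.
Qed.

Let M_le : {ae mu, forall t, `[0, T]%classic t ->
  M t <= A1 * (DF t + DG t) + A1 * L * \int[mu]_(s in `[0, t]) M s}.
Proof.
have [_ uV _] := bu; have [_ pQ _] := bp.
have up : {ae mu, forall t, `[0, T]%classic t -> Vh (u t) /\ Qh (p t)}.
  by apply: (ae_imp2 uV pQ) => t {}uV {}pQ Jt; split; [exact: uV|exact: pQ].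
have FG : {ae mu, forall t, `[0, T]%classic t -> linear_on Vh (F t) /\ linear_on Qh (G t)}.
  by apply: (ae_imp2 linF linG) => t lF lG Jt; split; [exact: lF|exact: lG].
apply: (ae_imp2 (ae_imp2 up FG (fun _ x y => conj x y)) eqn) => t [hup hFG] heq Jt.
have [Vu Qp] := hup Jt; have [lF lG] := hFG Jt; have {}heq := heq Jt.
have tT : t <= T by move: Jt; rewrite /= in_itv /= => /andP[].
set I := \int[mu]_(s in `[0, t]) M s.
have I0 : 0 <= I by apply: Rintegral_ge0 => s _; exact: M0.
(* At a fixed time the memory is part of the data; [d] bounds the right-hand sides of both
   equations, as the static estimate takes one data size. *)
pose d := DF t + DG t + L * I.
have d0 : 0 <= d by rewrite !addr_ge0// mulr_ge0.
have V0 : Vh 0 by case: sV.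
have Q0 : Qh 0 by case: sQ.
have hV v : Vh v -> a (u t) v + b v (p t) = F t v + memory_V a b k1 k2 u p t v.
  by move=> Vv; have [] := heq v 0 Vv Q0.
have hQ q : Qh q -> b (u t) q - c (p t) q = G t q + memory_Q b c k3 k4 u p t q.
  by move=> Qq; have [] := heq 0 q V0 Qq.
have hF v : Vh v -> `|F t v + memory_V a b k1 k2 u p t v| <= d * `|v|.
  move=> Vv; have [mV _] := memory_le tT Vv Q0.
  have Fv : `|F t v| <= DF t * `|v| by exact: dnorm_bound.
  have Gv : 0 <= DG t * `|v| by rewrite mulr_ge0.
  apply: (le_trans (ler_normD _ _)); rewrite -/I in mV; rewrite /d; nra.
have hG q : Qh q -> `|G t q + memory_Q b c k3 k4 u p t q| <= d * `|q|.
  move=> Qq; have [_ mQ] := memory_le tT V0 Qq.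
  have Gq : `|G t q| <= DG t * `|q| by exact: dnorm_bound.
  have Fq : 0 <= DF t * `|q| by rewrite mulr_ge0.
  apply: (le_trans (ler_normD _ _)); rewrite -/I in mQ; rewrite /d; nra.
have := static_stability ca cc pa pc fV fQ alpha0 cK gamma0 cH beta0
  infsupQ infsupV Vu Qp d0 hF hG hV hQ.
rewrite -/na -/nc; set S := static_const _ _ _ _ _ => hS.
(* The first equation gives the dual norm of [b _ (p t)] in terms of data and [a]; the second does
   the same for [b (u t) _] below. *)
have hN1 : N1 t <= d + na * `|u t|.
  apply: dnorm_le_on => [|v Vv]; first by rewrite addr_ge0// mulr_ge0.
  have -> : b v (p t) = (F t v + memory_V a b k1 k2 u p t v) - a (u t) v.
    by rewrite -hV//; ring.
  apply: (le_trans (ler_normB _ _)); rewrite mulrDl lerD//; first exact: hF.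
  by rewrite -mulrA le_form_norm.
have hN2 : N2 t <= d + nc * `|p t|.
  apply: dnorm_le_on => [|q Qq]; first by rewrite addr_ge0// mulr_ge0.
  have -> : b (u t) q = (G t q + memory_Q b c k3 k4 u p t q) + c (p t) q.
    by rewrite -hQ//; ring.
  apply: (le_trans (ler_normD _ _)); rewrite mulrDl lerD//; first exact: hG.
  by rewrite -mulrA le_form_norm.
have -> : A1 * (DF t + DG t) + A1 * L * I = A1 * d by rewrite /d; ring.
rewrite /M /A1 /amplification -/S.
have hu : na * `|u t| <= na * (S * d).
  by rewrite ler_wpM2l//; have := normr_ge0 (p t); lra.
have hp : nc * `|p t| <= nc * (S * d).
  by rewrite ler_wpM2l//; have := normr_ge0 (u t); lra.
have -> : ((1 + na + nc) * S + 2) * d = S * d + na * (S * d) + nc * (S * d) + 2 * d.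
  by ring.
lra.
Qed.

Theorem evolution_stability :
  (L1norm T u + L1norm T p <=
   (stability_const alpha beta gamma na nc Ck1 Ck2 Ck3 Ck4 T)%:E *
     (int_J T DF + int_J T DG))%E.
Proof.
have DFm : ae_measurable T DF by exact: ae_measurable_dnorm.
have DGm : ae_measurable T DG by exact: ae_measurable_dnorm.
have St0 : 0 < stability_const alpha beta gamma na nc Ck1 Ck2 Ck3 Ck4 T.
  exact: stability_const_gt0.
have un := ae_integrable_measurable (bochner_norm bu).
have pn := ae_integrable_measurable (bochner_norm bp).
have FGm := ae_measurableD DFm DGm.
have FG0 t : 0 <= DF t + DG t by rewrite addr_ge0.
rewrite -(int_JD DF0 DG0 DFm DGm).
(* If the dual norms of the data have infinite integral, so is the right-hand side, because the
   constant is positive. *)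
have [FGoo|] := eqVneq (int_J T (fun t => DF t + DG t)) +oo%E.
  by rewrite FGoo gt0_muley ?leey// lte_fin.
rewrite -ltey => FGoo.
have FGi : ae_integrable T (fun t => DF t + DG t).
  apply: ae_integrableP => //.
  by under eq_fun do rewrite ger0_norm//.
have AL0 : 0 <= A1 * L by rewrite mulr_ge0// ltW.
have AFG0 t : 0 <= A1 * (DF t + DG t) by rewrite mulr_ge0// ltW.
have := gronwall_int_J AL0 M0 AFG0 Mi (ae_integrableZ A1 FGi) M_le T0.
rewrite (int_JZ (ltW A10) FG0 FGm) muleA -EFinM; apply: le_trans.
rewrite /L1norm -int_JD//; apply: le_int_J => //.
by apply: aeW => t _; rewrite /M lerDl addr_ge0.
Qed.

End Stability.


(** * Existence of the discrete solution *)

Section DiscreteExistence.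
Context {R : realType} {V Q : hilbertType R}.
Local Notation mu := (@lebesgue_measure R).

Lemma linear_on0 (W : hilbertType R) (A : set W) (l : W -> R) :
  subspace A -> linear_on A l -> l 0 = 0.
Proof.
move=> [A0 _] lA; have := lA (-1) 0 0 A0 A0.
by rewrite scaler0 addr0 mulN1r addNr.
Qed.

Variables (a : {bilinear V -> V -> R^o}) (b : {bilinear V -> Q -> R^o})
  (c : {bilinear Q -> Q -> R^o}) (k1 k2 k3 k4 : R -> R -> R)
  (Ck1 Ck2 Ck3 Ck4 T alpha beta gamma : R) (Vh : set V) (Qh : set Q).
Hypotheses (T0 : 0 <= T) (ca : form_continuous a) (cb : form_continuous b)
  (cc : form_continuous c) (pa : sym_psd a) (pc : sym_psd c)
  (bk1 : bounded_kernel T k1 Ck1) (bk2 : bounded_kernel T k2 Ck2)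
  (bk3 : bounded_kernel T k3 Ck3) (bk4 : bounded_kernel T k4 Ck4)
  (fV : fin_dim_subspace Vh) (fQ : fin_dim_subspace Qh).
Let Kh := kernel_l b Vh Qh.
Let Hh := kernel_r b Vh Qh.
Hypotheses (alpha0 : 0 < alpha) (cK : coercive_on a Kh alpha)
  (gamma0 : 0 < gamma) (cH : coercive_on c Hh gamma) (beta0 : 0 < beta)
  (infsupQ : forall q, orthocompl Qh Hh q ->
     sup [set b v q / `|v| | v in Vh `\ 0] >= beta * `|q|)
  (infsupV : forall v, orthocompl Vh Kh v ->
     sup [set b v q / `|q| | q in Qh `\ 0] >= beta * `|v|).
Let sV := fin_dim_subspace_subspace fV.
Let sQ := fin_dim_subspace_subspace fQ.

(** The matrix of the form obtained by adding the left-hand sides of both equations. Rows index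
    trial pairs and columns test pairs, so coordinates multiply it from the left as row vectors. *)
Definition saddle_matrix N (v : 'I_N -> V) (q : 'I_N -> Q) : 'M[R]_N :=
  \matrix_(j, l) (a (v j) (v l) + b (v l) (q j) + (b (v j) (q l) - c (q j) (q l))).

Lemma saddle_matrix_mul N (v : 'I_N -> V) (q : 'I_N -> Q) (x : 'I_N -> R) l :
  let u := \sum_j x j *: v j in let p := \sum_j x j *: q j in
  \sum_j x j * saddle_matrix v q j l =
  a u (v l) + b (v l) p + (b u (q l) - c p (q l)).
Proof.
move=> u p.
have -> : a u (v l) = \sum_j x j * a (v j) (v l).
  apply: (@linear_on_sum _ _ setT (fun w => a w (v l))) => //.
  by move=> k y z _ _; rewrite bilinear_linearl.
have -> : b (v l) p = \sum_j x j * b (v l) (q j).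
  apply: (@linear_on_sum _ _ setT (b (v l))) => //.
  by move=> k y z _ _; rewrite (bilinear_linearr b k y z).
have -> : b u (q l) = \sum_j x j * b (v j) (q l).
  apply: (@linear_on_sum _ _ setT (fun w => b w (q l))) => //.
  by move=> k y z _ _; rewrite bilinear_linearl.
have -> : c p (q l) = \sum_j x j * c (q j) (q l).
  apply: (@linear_on_sum _ _ setT (fun w => c w (q l))) => //.
  by move=> k y z _ _; rewrite bilinear_linearl.
rewrite -sumrB -!big_split /=; apply: eq_bigr => j _; rewrite mxE; ring.
Qed.

(* Both spaces are indexed by one family, with one of [v l] and [q l] equal to 0
   for every [l]: this makes the coupled system a single square one. *)
Lemma saddle_matrix_unit : exists N (v : 'I_N -> V) (q : 'I_N -> Q),
  [/\ forall l, Vh (v l) /\ Qh (q l), forall l, `|v l| <= 1 /\ `|q l| <= 1,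
      saddle_matrix v q \in unitmx &
      forall E1 E2, linear_on Vh E1 -> linear_on Qh E2 ->
        (forall l, E1 (v l) + E2 (q l) = 0) ->
        (forall w, Vh w -> E1 w = 0) /\ (forall w, Qh w -> E2 w = 0)].
Proof.
have [n [e [eo eV eb]]] := orthonormal_basis_exists fV sV (@subset_refl _ _).
have [m [g [go gQ gb]]] := orthonormal_basis_exists fQ sQ (@subset_refl _ _).
pose v (l : 'I_(n + m)) : V := if fintype.split l is inl i then e i else 0.
pose q (l : 'I_(n + m)) : Q := if fintype.split l is inr j then g j else 0.
have V0 : Vh 0 by case: sV.
have Q0 : Qh 0 by case: sQ.
have norm1 (W : hilbertType R) (w : W) : inner w w = 1 -> `|w| <= 1.
  by rewrite inner_normE => /eqP; rewrite sqrp_eq1// => /eqP ->.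
have vq l : Vh (v l) /\ Qh (q l).
  by rewrite /v /q; case: (fintype.split l) => i.
have vq1 l : `|v l| <= 1 /\ `|q l| <= 1.
  rewrite /v /q; case: (fintype.split l) => i; rewrite normr0 ler01; split => //.
    by apply: norm1; rewrite eo eqxx.
  by apply: norm1; rewrite go eqxx.
have ext E1 E2 : linear_on Vh E1 -> linear_on Qh E2 ->
    (forall l, E1 (v l) + E2 (q l) = 0) ->
    (forall w, Vh w -> E1 w = 0) /\ (forall w, Qh w -> E2 w = 0).
  move=> l1 l2 El; split=> w Ww.
    rewrite (eb w Ww) (linear_on_sum _ _ sV l1 eV) big1// => i _.
    have := El (unsplit (inl i)); rewrite /v /q unsplitK.
    by rewrite (linear_on0 sQ l2) addr0 => ->; rewrite mulr0.
  rewrite (gb w Ww) (linear_on_sum _ _ sQ l2 gQ) big1// => i _.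
  have := El (unsplit (inr i)); rewrite /v /q unsplitK.
  by rewrite (linear_on0 sV l1) add0r => ->; rewrite mulr0.
exists (n + m)%N, v, q; split => //.
rewrite -row_free_unit; apply: inj_row_free => x xA.
pose u := \sum_j x 0 j *: v j; pose p := \sum_j x 0 j *: q j.
have l1 : linear_on Vh (fun w => a u w + b w p).
  move=> k y z _ _; rewrite (bilinear_linearr a k y z) (bilinear_linearl b k y z).
  by ring.
have l2 : linear_on Qh (fun w => b u w - c p w).
  move=> k y z _ _; rewrite (bilinear_linearr b k y z) (bilinear_linearr c k y z).
  by ring.
have [|eV0 eQ0] := ext _ _ l1 l2.
  move=> l; rewrite /u /p -saddle_matrix_mul.
  by have /rowP/(_ l) := xA; rewrite !mxE.
have Vu : Vh u by apply: subspace_sum => // j; apply: subspaceZ => //; case: (vq j).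
have Qp : Qh p by apply: subspace_sum => // j; apply: subspaceZ => //; case: (vq j).
(* A square matrix is invertible once it is injective, and injectivity is the static estimate with
   zero data. *)
have := static_stability ca cc pa pc fV fQ alpha0 cK gamma0 cH beta0
  infsupQ infsupV Vu Qp (lexx 0) (Phi := fun=> 0) (Gam := fun=> 0).
rewrite mulr0 => h.
have {}h : `|u| + `|p| <= 0.
  by apply: h => // w _; rewrite normr0 mul0r.
have [u0 p0] : u = 0 /\ p = 0.
  have := normr_ge0 u; have := normr_ge0 p => p0 u0.
  by split; apply/eqP; rewrite -normr_le0; lra.
apply/rowP => l; rewrite mxE.
have : inner (v l) u + inner (q l) p = x 0 l.
  rewrite !inner_sumr -big_split (bigD1 l)//= big1 => [|j jl].
    rewrite addr0 !innerZr -mulrDr.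
    suff -> : inner (v l) (v l) + inner (q l) (q l) = 1 by rewrite mulr1.
    by rewrite /v /q; case: (fintype.split l) => i;
      rewrite ?eo ?go eqxx inner0r ?addr0 ?add0r.
  rewrite !innerZr -mulrDr; apply/eqP; rewrite mulf_eq0; apply/orP; right.
  move: jl; rewrite -(splitK l) -(splitK j) /v /q !unsplitK.
  rewrite (inj_eq (can_inj unsplitK)).
  case: (fintype.split l) => i; case: (fintype.split j) => i' ne;
    rewrite ?inner0r ?(innerC 0) ?inner0r ?addr0 ?add0r// ?eo ?go.
    by case: (eqVneq i i') ne => [->|_ _]; rewrite eqxx.
  by case: (eqVneq i i') ne => [->|_ _]; rewrite eqxx.
by rewrite u0 p0 !inner0r addr0 => <-.
Qed.

Lemma ae_integrable_dual (W : normedModType R) (f : R -> dual W) w :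
  bochner_L1 T setT f -> ae_integrable T (fun t => f t w).
Proof.
move=> bf; have [sf _ _] := bf.
have le (l : dual W) : `|l w| <= `|w| * `|l|.
  by rewrite mulrC; exact: Defs.dnorm_ub.
apply: (@ae_integrable_le _ _ _ (fun t => `|w| * `|f t|)).
- apply: (ae_measurable_continuous (h := fun l : dual W => (l w : R)) _ sf).
  exact: (@bounded_linear_continuous _ _ (fun l : dual W => (l w : R)) `|w|).
- by apply: aeW => t _; exact: le.
- exact/ae_integrableZ/(bochner_norm bf).
Qed.

Lemma bochner_L1_combination (W : normedModType R) (A : set W) N
    (x : 'I_N -> R -> R) (w : 'I_N -> W) : A 0 ->
  (forall k y z, A y -> A z -> A (k *: y + z)) -> (forall l, A (w l)) ->
  (forall l, ae_integrable T (x l)) ->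
  bochner_L1 T A (fun t => \sum_l x l t *: w l).
Proof.
move=> A0 AD Aw xi.
have AZ k y : A y -> A (k *: y) by move=> Ay; rewrite -[_ *: _]addr0; exact: AD.
have AA y z : A y -> A z -> A (y + z).
  by move=> Ay Az; rewrite -[y]scale1r; exact: AD.
apply: (@bochner_L1_le _ _ _ _ _ (fun t => \sum_l `|w l| * `|x l t|)).
- apply: strongly_measurable_sum => // l; apply: strongly_measurableZ.
    by move=> k; exact: AZ.
  exact: ae_integrable_measurable.
- by apply: aeW => t _; elim/big_ind: _ => // l _; exact: AZ.
- apply: aeW => t _; apply: (le_trans (ler_norm_sum _ _ _)); apply: ler_sum => l _.
  by rewrite normrZ mulrC.
- by apply: ae_integrable_sum => l; exact/ae_integrableZ/ae_integrable_norm.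
Qed.

Theorem discrete_solution_exists (f : R -> dual V) (g : R -> dual Q) :
  bochner_L1 T setT f -> bochner_L1 T setT g ->
  exists (u : R -> V) (p : R -> Q), [/\ bochner_L1 T Vh u, bochner_L1 T Qh p &
    is_solution a b c k1 k2 k3 k4 T Vh Qh f g u p].
Proof.
move=> bf bg; have [N [v [q [vq vq1 uA ext]]]] := saddle_matrix_unit.
have K1 := bounded_kernel_ge0 T0 bk1; have K2 := bounded_kernel_ge0 T0 bk2.
have K3 := bounded_kernel_ge0 T0 bk3; have K4 := bounded_kernel_ge0 T0 bk4.
have c1 := continuous_kernel_clamp T0 bk1; have c2 := continuous_kernel_clamp T0 bk2.
have c3 := continuous_kernel_clamp T0 bk3; have c4 := continuous_kernel_clamp T0 bk4.
set h1 := clamp_kernel T k1 in c1; set h2 := clamp_kernel T k2 in c2.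
set h3 := clamp_kernel T k3 in c3; set h4 := clamp_kernel T k4 in c4.
(* The matrix of the memory term in the chosen families, built from the extended kernels; since the
   families have norm at most 1, the norms of the forms bound its entries. *)
pose K l j t s := h1 t s * a (v j) (v l) + h2 t s * b (v l) (q j) +
  (h3 t s * b (v j) (q l) - h4 t s * c (q j) (q l)).
pose C := Ck1 * form_norm a + Ck2 * form_norm b +
  (Ck3 * form_norm b + Ck4 * form_norm c).
have le1 (X Y : normedModType R) (F : {bilinear X -> Y -> R^o}) (k Ck : R) x y :
    form_continuous F -> `|k| <= Ck -> `|x| <= 1 -> `|y| <= 1 ->
    `|k * F x y| <= Ck * form_norm F.
  move=> cF kC x1 y1; rewrite normrM ler_pM//.
  by rewrite (le_trans (le_form_normM cF x1 y1))// mulr1 mulr1.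
have cKk l j : continuous_kernel (K l j) C.
  have [c1c c1b] := c1; have [c2c c2b] := c2.
  have [c3c c3b] := c3; have [c4c c4b] := c4.
  split => [x|t s]; last first.
    have [vl ql] := vq1 l; have [vj qj] := vq1 j.
    apply: (le_trans (ler_normD _ _)); apply: lerD.
      by apply: (le_trans (ler_normD _ _)); apply: lerD; apply: le1.
    by apply: (le_trans (ler_normB _ _)); apply: lerD; apply: le1.
  apply: cvgD.
    by apply: cvgD; (apply: cvgM; last exact: cvg_cst); [exact: c1c|exact: c2c].
  by apply: cvgB; (apply: cvgM; last exact: cvg_cst); [exact: c3c|exact: c4c].
have ri l : ae_integrable T (fun t => f t (v l) + g t (q l)).
  by apply: ae_integrableD; exact: ae_integrable_dual.
have /choice[r rP] := ri.
have rm l : measurable_fun [set: R] (r l) by case: (rP l).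
have rint l : mu.-integrable `[0, T] (EFin \o r l) by case: (rP l).
have re : {ae mu, forall t, forall l, `[0, T]%classic t ->
    f t (v l) + g t (q l) = r l t}.
  (* A null set common to all indices comes from a countable intersection over [nat], so the index
     [l] is encoded by its value. *)
  have : {ae mu, forall t, forall n : nat, forall l : 'I_N, val l = n ->
      `[0, T]%classic t -> f t (v l) + g t (q l) = r l t}.
    apply: ae_foralln => n; have [nN|Nn] := ltnP n N; last first.
      by apply: aeW => t l ln; move: (ltn_ord l); rewrite ln ltnNge Nn.
    have [_ _ h] := rP (Ordinal nN); apply: (ae_imp h) => t ht l ln.
    by have -> : l = Ordinal nN by exact: val_inj.
  by move=> h; apply: (ae_imp h) => t ht l; exact: (ht (val l)).
(* Multiplying the system for the coordinates by the inverse of the saddle matrix puts it in the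
   form solved by [volterra_solution]. *)
have [x [xm xi xE]] :=
  @volterra_solution _ _ _ _ _ (invmx (saddle_matrix v q)) _ cKk rm rint.
have xae l : ae_integrable T (x l) by exists (x l); split => //; exact: aeW.
pose u t := \sum_l x l t *: v l; pose p t := \sum_l x l t *: q l.
have bu : bochner_L1 T Vh u.
  by case: sV => V0 VD; apply: bochner_L1_combination => // l; case: (vq l).
have bp : bochner_L1 T Qh p.
  by case: sQ => Q0 QD; apply: bochner_L1_combination => // l; case: (vq l).
exists u, p; split => //.
apply: (ae_imp re) => t {}re Jt.
have tT : 0 <= t <= T by move: Jt; rewrite /= in_itv.
have tT' : t <= T by case/andP: tT.
have [mV mQ] := memory_linear T0 ca cb cc bk1 bk2 bk3 bk4 bu bp tT'.
have eqnl l : a (u t) (v l) + b (v l) (p t) + (b (u t) (q l) - c (p t) (q l)) =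
    r l t + \sum_j \int[mu]_(s in `[0, t]) (K l j t s * x j s).
  rewrite /u /p -saddle_matrix_mul.
  pose y := \row_l (r l t + \sum_j \int[mu]_(s in `[0, t]) (K l j t s * x j s)).
  have -> : r l t + \sum_j \int[mu]_(s in `[0, t]) (K l j t s * x j s) = y 0 l.
    by rewrite mxE.
  rewrite -(mulmxKV uA y) mxE; apply: eq_bigr => j _; congr (_ * _).
  by rewrite xE// mxE; apply: eq_bigr => i _; rewrite mxE.
have meml l : \sum_j \int[mu]_(s in `[0, t]) (K l j t s * x j s) =
    memory_V a b k1 k2 u p t (v l) + memory_Q b c k3 k4 u p t (q l).
  have [xa xb ya yb] := ae_integrable_memory_args ca cb cc bu bp (v l) (q l).
  rewrite memory_VE memory_QE (scalar_memoryE T0 bk1 bk2)//.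
  rewrite (scalar_memoryE T0 bk3 bk4)// -/h1 -/h2 -/h3 -/h4.
  have i1 := ae_integrable_kernel t c1 xa; have i2 := ae_integrable_kernel t c2 xb.
  have i3 := ae_integrable_kernel t c3 ya; have i4 := ae_integrable_kernel t c4 yb.
  rewrite -(Rintegral_aeD tT' i1 i2) -(Rintegral_aeD tT' i3 i4).
  rewrite -(Rintegral_aeD tT' (ae_integrableD i1 i2) (ae_integrableD i3 i4)).
  rewrite -(Rintegral_ae_sum tT'); last first.
    by move=> j; exact: ae_integrable_kernel (cKk l j) (xae j).
  apply: eq_Rintegral => s _.
  have linr (X Y : hilbertType R) (F : {bilinear X -> Y -> R^o}) (w : 'I_N -> X) z :
      F (\sum_j x j s *: w j) z = \sum_j x j s * F (w j) z.
    apply: (@linear_on_sum _ _ setT (fun w => F w z)) => //.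
    by move=> k y y' _ _; rewrite bilinear_linearl.
  have -> : b (v l) (p s) = \sum_j x j s * b (v l) (q j).
    apply: (@linear_on_sum _ _ setT (b (v l))) => //.
    by move=> k y y' _ _; rewrite (bilinear_linearr b k y y').
  rewrite !linr -sumrN !mulr_sumr -!big_split /=.
  by apply: eq_bigr => j _; rewrite /K; ring.
(* The residuals of the two equations are linear functionals whose sum vanishes on every pair
   [(v l, q l)]; since one entry of each pair is 0, both vanish on the whole discrete spaces. *)
have [|||h1' h2'] := ext
  (fun w => a (u t) w + b w (p t) - (f t w + memory_V a b k1 k2 u p t w))
  (fun w => b (u t) w - c (p t) w - (g t w + memory_Q b c k3 k4 u p t w)).
- move=> k y z _ _; rewrite (bilinear_linearr a k y z) (bilinear_linearl b k y z).
  rewrite mV// (dual_linear (f t) k y z) /GRing.scale /=; ring.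
- move=> k y z _ _; rewrite (bilinear_linearr b k y z) (bilinear_linearr c k y z).
  rewrite mQ// (dual_linear (g t) k y z) /GRing.scale /=; ring.
- move=> l; have := eqnl l; rewrite meml -re//.
  by move=> h; apply/eqP; rewrite -subr_eq0 in h *; lra.
move=> w z Vw Qz; split; apply/eqP; rewrite -subr_eq0; apply/eqP.
- exact: h1'.
- exact: h2'.
Qed.

End DiscreteExistence.


(** * Uniqueness, error bounds and quasi-optimality *)

Section ErrorAnalysis.
Context {R : realType} {V Q : hilbertType R}.
Local Notation mu := (@lebesgue_measure R).

(** Near-minimisers for the two infima are chosen independently. They exist because both infima are
    finite, being bounded below by 0 and above by a finite element. *)
Lemma le_ereal_infD (A B : set (\bar R)) (X : \bar R) :
  (forall x, A x -> (0 <= x)%E) -> (forall y, B y -> (0 <= y)%E) ->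
  (exists2 x, A x & (x < +oo)%E) -> (exists2 y, B y & (y < +oo)%E) ->
  (forall x y, A x -> B y -> (X <= x + y)%E) ->
  (X <= ereal_inf A + ereal_inf B)%E.
Proof.
have fininf (S : set (\bar R)) : (forall x, S x -> (0 <= x)%E) ->
    (exists2 x, S x & (x < +oo)%E) -> ereal_inf S \is a fin_num.
  move=> S0 [x Sx xoo]; rewrite ge0_fin_numE; last exact: le_ereal_inf_tmp.
  by apply: le_lt_trans xoo; exact: ereal_inf_lbound.
move=> A0 B0 A1 B1 XAB; have fA := fininf _ A0 A1; have fB := fininf _ B0 B1.
apply/lee_addgt0Pr => e e0; have e20 : 0 < e / 2 by rewrite divr_gt0.
have [x Ax xA] := lb_ereal_inf_adherent e20 fA.
have [y By yB] := lb_ereal_inf_adherent e20 fB.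
apply: (le_trans (XAB x y Ax By)); rewrite (splitr e) EFinD addeACA.
by apply: leeD; exact: ltW.
Qed.

Lemma lee_mulD4 (k : R) (X Y x1 x2 y1 y2 : \bar R) : 0 <= k ->
  (0 <= x1)%E -> (0 <= x2)%E -> (0 <= y1)%E -> (0 <= y2)%E ->
  (X <= x1 + x2)%E -> (Y <= y1 + y2)%E ->
  (k%:E * (X + Y) <= k%:E * x1 + k%:E * x2 + k%:E * y1 + k%:E * y2)%E.
Proof.
move=> k0 x10 x20 y10 y20 hX hY.
rewrite -ge0_muleDr// -ge0_muleDr ?adde_ge0// -ge0_muleDr ?adde_ge0//.
by apply: lee_wpmul2l; rewrite ?lee_fin// -addeA leeD.
Qed.

Lemma le_weighted_sum (l1 l2 l3 l4 x y z : R) :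
  0 <= l1 -> 0 <= l2 -> 0 <= l3 -> 0 <= l4 -> 0 <= z -> x <= z -> y <= z ->
  l1 * x + l2 * y <= (l1 + l2 + l3 + l4) * z /\
  l3 * x + l4 * y <= (l1 + l2 + l3 + l4) * z.
Proof.
move=> l10 l20 l30 l40 z0 xz yz.
have := mulr_ge0 l10 z0; have := mulr_ge0 l20 z0.
have := mulr_ge0 l30 z0; have := mulr_ge0 l40 z0.
have := ler_wpM2l l10 xz; have := ler_wpM2l l20 yz.
have := ler_wpM2l l30 xz; have := ler_wpM2l l40 yz.
by split; lra.
Qed.

Lemma int_J_cst (T k : R) : 0 <= T -> 0 <= k -> int_J T (fun=> k) = (k * T)%:E.
Proof.
move=> T0 k0; rewrite /int_J -(Rintegral_ae_EFin (lexx T))//.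
  by rewrite Rintegral_itv_cst.
exact: ae_integrable_cst.
Qed.

Lemma bochner_L1_cst0 (W : normedModType R) (A : set W) (T : R) : A 0 ->
  bochner_L1 T A (fun=> 0).
Proof.
move=> A0; apply: (@bochner_L1_le _ _ _ _ _ (fun=> 0)).
- exact: strongly_measurable_cst.
- exact: aeW.
- by apply: aeW => t _; rewrite normr0.
- exact: ae_integrable0.
Qed.

(** Stability bounds the error by the dual norms of the whole functionals; the triangle inequality
    over the two orthogonal components turns these into the separate terms of the error bounds. *)
Lemma int_J_dnorm_component (W : hilbertType R) (A K : set W) (T : R)
    (F : R -> W -> R) :
  fin_dim_subspace A -> subspace K -> K `<=` A ->
  {ae mu, forall t, `[0, T]%classic t -> linear_on setT (F t)} ->
  (forall v, ae_measurable T (F^~ v)) ->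
  (int_J T (fun t => dnorm A (F t)) <=
   int_J T (fun t => dnorm A (fun v => F t (component (orthocompl A K) K v))) +
   int_J T (fun t => dnorm A (fun v => F t (component K (orthocompl A K) v))))%E.
Proof.
move=> fA sK KA lF mF; set Kp := orthocompl A K.
have lin1 : {ae mu, forall t, `[0, T]%classic t ->
    linear_on A (fun v => F t (component Kp K v))}.
  apply: (ae_imp lF) => t {}lF Jt k x y Ax Ay.
  by have [_ ->] := component_linear fA sK KA k Ax Ay; exact: lF.
have lin2 : {ae mu, forall t, `[0, T]%classic t ->
    linear_on A (fun v => F t (component K Kp v))}.
  apply: (ae_imp lF) => t {}lF Jt k x y Ax Ay.
  by have [-> _] := component_linear fA sK KA k Ax Ay; exact: lF.
rewrite -int_JD; last 4 first.
- by move=> t; exact: Defs.dnorm_ge0.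
- by move=> t; exact: Defs.dnorm_ge0.
- by apply: ae_measurable_dnorm.
- by apply: ae_measurable_dnorm.
apply: le_int_J => [t|t|]; rewrite ?addr_ge0 ?Defs.dnorm_ge0//.
apply: (ae_imp2 (ae_imp2 lin1 lin2 (fun _ x y => conj x y)) lF) => t [l1 l2] lt Jt.
apply: dnorm_le_on => [|v Av]; first by rewrite addr_ge0 ?Defs.dnorm_ge0.
have [_ _ e] := component_spec fA sK KA Av.
have -> : F t v = F t (component Kp K v) + F t (component K Kp v).
  by rewrite -{1}e -{1}[component K Kp v]scale1r lt//; ring.
rewrite (le_trans (ler_normD _ _))// mulrDl lerD//.
  exact: (dnorm_bound fA (l1 Jt) Av).
exact: (dnorm_bound fA (l2 Jt) Av).
Qed.

Variables (a : {bilinear V -> V -> R^o}) (b : {bilinear V -> Q -> R^o})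
  (c : {bilinear Q -> Q -> R^o}) (k1 k2 k3 k4 : R -> R -> R)
  (Ck1 Ck2 Ck3 Ck4 T alpha beta gamma : R) (Vh : set V) (Qh : set Q).
Hypotheses (T0 : 0 <= T) (ca : form_continuous a) (cb : form_continuous b)
  (cc : form_continuous c) (pa : sym_psd a) (pc : sym_psd c)
  (bk1 : bounded_kernel T k1 Ck1) (bk2 : bounded_kernel T k2 Ck2)
  (bk3 : bounded_kernel T k3 Ck3) (bk4 : bounded_kernel T k4 Ck4)
  (fV : fin_dim_subspace Vh) (fQ : fin_dim_subspace Qh).
Let Kh := kernel_l b Vh Qh.
Let Hh := kernel_r b Vh Qh.
Let Khp := orthocompl Vh Kh.
Let Hhp := orthocompl Qh Hh.
Hypotheses (alpha0 : 0 < alpha) (cK : coercive_on a Kh alpha)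
  (gamma0 : 0 < gamma) (cH : coercive_on c Hh gamma) (beta0 : 0 < beta)
  (infsupQ : forall q, Hhp q ->
     sup [set b v q / `|v| | v in Vh `\ 0] >= beta * `|q|)
  (infsupV : forall v, Khp v ->
     sup [set b v q / `|q| | q in Qh `\ 0] >= beta * `|v|).
Let sV := fin_dim_subspace_subspace fV.
Let sQ := fin_dim_subspace_subspace fQ.
Let C := stability_const alpha beta gamma (form_norm a) (form_norm c)
  Ck1 Ck2 Ck3 Ck4 T.

Lemma discrete_solution_unique (f : R -> dual V) (g : R -> dual Q)
    (u u' : R -> V) (p p' : R -> Q) :
  bochner_L1 T Vh u -> bochner_L1 T Qh p ->
  bochner_L1 T Vh u' -> bochner_L1 T Qh p' ->
  is_solution a b c k1 k2 k3 k4 T Vh Qh f g u p ->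
  is_solution a b c k1 k2 k3 k4 T Vh Qh f g u' p' ->
  {ae mu, forall t, `[0, T]%classic t -> u' t = u t /\ p' t = p t}.
Proof.
move=> bu bp bu' bp' su su'.
have bdu : bochner_L1 T Vh (fun t => u' t - u t).
  by apply: bochner_L1B bu' bu => x y; exact: subspaceB.
have bdp : bochner_L1 T Qh (fun t => p' t - p t).
  by apply: bochner_L1B bp' bp => x y; exact: subspaceB.
have eqn : {ae mu, forall t, `[0, T]%classic t -> forall v q, Vh v -> Qh q ->
    a (u' t - u t) v + b v (p' t - p t) = 0 +
      memory_V a b k1 k2 (fun s => u' s - u s) (fun s => p' s - p s) t v /\
    b (u' t - u t) q - c (p' t - p t) q = 0 +
      memory_Q b c k3 k4 (fun s => u' s - u s) (fun s => p' s - p s) t q}.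
  apply: (ae_imp2 su su') => t {}su {}su' Jt v q Vv Qq.
  have [e1 e2] := su Jt v q Vv Qq; have [e1' e2'] := su' Jt v q Vv Qq.
  have tT : t <= T by move: Jt; rewrite /= in_itv /= => /andP[].
  have [-> ->] := memory_sub T0 ca cb cc bk1 bk2 bk3 bk4 v q bu' bp' bu bp tT.
  rewrite (bilinearBl a) (bilinearBr b) (bilinearBl b) (bilinearBl c).
  by split; lra.
have := @evolution_stability _ _ _ a b c k1 k2 k3 k4 Ck1 Ck2 Ck3 Ck4 T alpha beta
  gamma Vh Qh T0 ca cb cc pa pc bk1 bk2 bk3 bk4 fV fQ alpha0 cK gamma0 cH beta0
  infsupQ infsupV _ _ (fun _ _ => 0) (fun _ _ => 0) bdu bdp.
have z0 (W : hilbertType R) (A : set W) :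
    int_J T (fun=> dnorm A (fun=> 0 : R)) = 0%E.
  have -> : dnorm A (fun=> 0 : R) = 0.
    apply/eqP; rewrite eq_le Defs.dnorm_ge0 andbT; apply: dnorm_le_on => // v _.
    by rewrite normr0 mul0r.
  by rewrite int_J_cst// mul0r.
rewrite !z0 adde0 mule0 => h.
have {}h : (L1norm T (fun t => (u' t - u t)%R) + L1norm T (fun t => (p' t - p t)%R) <= 0)%E.
  apply: h => //.
  - by move=> v _; exact: ae_measurable_cst.
  - by move=> v _; exact: ae_measurable_cst.
  - by apply: aeW => t _ k x y _ _; rewrite mulr0 addr0.
  - by apply: aeW => t _ k x y _ _; rewrite mulr0 addr0.
have nu0 : (0 <= L1norm T (fun t => (u' t - u t)%R))%E by exact: int_J_ge0.
have np0 : (0 <= L1norm T (fun t => (p' t - p t)%R))%E by exact: int_J_ge0.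
have nu : L1norm T (fun t => (u' t - u t)%R) = 0%E.
  by apply/eqP; rewrite eq_le nu0 andbT (le_trans _ h)// leeDl.
have np : L1norm T (fun t => (p' t - p t)%R) = 0%E.
  by apply/eqP; rewrite eq_le np0 andbT (le_trans _ h)// leeDr.
have un := int_J_eq0 _ (ae_integrable_measurable (bochner_norm bdu)) nu.
have pn := int_J_eq0 _ (ae_integrable_measurable (bochner_norm bdp)) np.
apply: (ae_imp2 (un _) (pn _)) => // t {}un {}pn Jt.
by split; apply/eqP; rewrite -subr_eq0 -normr_eq0 ?un ?pn.
Qed.

Section Error.
Variables (f : R -> dual V) (g : R -> dual Q) (uh u uI : R -> V) (ph p pI : R -> Q).
Hypotheses (buh : bochner_L1 T Vh uh) (bph : bochner_L1 T Qh ph)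
  (bu : bochner_L1 T setT u) (bp : bochner_L1 T setT p)
  (buI : bochner_L1 T Vh uI) (bpI : bochner_L1 T Qh pI)
  (sh : is_solution a b c k1 k2 k3 k4 T Vh Qh f g uh ph)
  (s : is_solution a b c k1 k2 k3 k4 T setT setT f g u p).

Let xiu t := uh t - uI t.
Let xip t := ph t - pI t.
Let etau t := u t - uI t.
Let etap t := p t - pI t.
Let F := functional_F a b k1 k2 etau etap.
Let G := functional_G b c k3 k4 etau etap.

Let bxiu : bochner_L1 T Vh xiu.
Proof. by apply: bochner_L1B buh buI => x y; exact: subspaceB. Qed.

Let bxip : bochner_L1 T Qh xip.
Proof. by apply: bochner_L1B bph bpI => x y; exact: subspaceB. Qed.

Let betau : bochner_L1 T setT etau.
Proof. by apply: bochner_L1B bu buI. Qed.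

Let betap : bochner_L1 T setT etap.
Proof. by apply: bochner_L1B bp bpI. Qed.

Let linF : {ae mu, forall t, `[0, T]%classic t -> linear_on setT (F t)}.
Proof.
apply: aeW => t; rewrite /= in_itv /= => /andP[_ tT] k x y _ _.
have [mV _] := memory_linear T0 ca cb cc bk1 bk2 bk3 bk4 betau betap tT.
rewrite /F /functional_F mV// (bilinear_linearr a k x y) (bilinear_linearl b k x y).
by ring.
Qed.

Let linG : {ae mu, forall t, `[0, T]%classic t -> linear_on setT (G t)}.
Proof.
apply: aeW => t; rewrite /= in_itv /= => /andP[_ tT] k x y _ _.
have [_ mQ] := memory_linear T0 ca cb cc bk1 bk2 bk3 bk4 betau betap tT.
rewrite /G /functional_G mQ// (bilinear_linearr b k x y) (bilinear_linearr c k x y).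
by ring.
Qed.

Let mF v : ae_measurable T (F^~ v).
Proof.
have [xa xb _ _] := ae_integrable_memory_args ca cb cc betau betap v 0.
have [mV _] := ae_measurable_memoryVQ T0 ca cb cc bk1 bk2 bk3 bk4 betau betap v 0.
apply: (ae_measurableB _ mV); apply: ae_measurableD; exact: ae_integrable_measurable.
Qed.

Let mG q : ae_measurable T (G^~ q).
Proof.
have [_ _ ya yb] := ae_integrable_memory_args ca cb cc betau betap 0 q.
have [_ mQ] := ae_measurable_memoryVQ T0 ca cb cc bk1 bk2 bk3 bk4 betau betap 0 q.
apply: (ae_measurableB _ mQ); apply: ae_measurableD; exact: ae_integrable_measurable.
Qed.

Let error_stability :
  (L1norm T xiu + L1norm T xip <=
   C%:E * (int_J T (fun t => dnorm Vh (F t)) + int_J T (fun t => dnorm Qh (G t))))%E.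
Proof.
apply: (@evolution_stability _ _ _ a b c k1 k2 k3 k4) => //.
- by apply: (ae_imp linF) => t lF Jt k x y _ _; exact: lF.
- by apply: (ae_imp linG) => t lG Jt k x y _ _; exact: lG.
(* Galerkin orthogonality: on discrete test vectors both solutions satisfy the same equations, so
   [f] and [g] cancel and only the terms in [etau] and [etap] are left as data. *)
apply: (ae_imp2 sh s) => t sht st Jt v q Vv Qq.
have [e1 e2] := sht Jt v q Vv Qq; have [e1' e2'] := st Jt v q Logic.I Logic.I.
have tT : t <= T by move: Jt; rewrite /= in_itv /= => /andP[].
rewrite /F /G /functional_F /functional_G.
have [-> ->] := memory_sub T0 ca cb cc bk1 bk2 bk3 bk4 v q buh bph buI bpI tT.
have [-> ->] := memory_sub T0 ca cb cc bk1 bk2 bk3 bk4 v q bu bp buI bpI tT.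
rewrite /xiu /xip /etau /etap.
rewrite !(bilinearBl a) !(bilinearBr b) !(bilinearBl b) !(bilinearBl c).
by split; lra.
Qed.

(** A component is no longer than the vector, so the bound on the sum of both full errors serves all
    four components with the same constant. *)
Lemma error_components (D : \bar R) :
  D = (C%:E * int_J T (fun t => dnorm Vh (fun v => F t (component Khp Kh v)))
     + C%:E * int_J T (fun t => dnorm Vh (fun v => F t (component Kh Khp v)))
     + C%:E * int_J T (fun t => dnorm Qh (fun q => G t (component Hhp Hh q)))
     + C%:E * int_J T (fun t => dnorm Qh (fun q => G t (component Hh Hhp q))))%E ->
  [/\ (L1norm T (fun t => component Khp Kh (xiu t)) <= D)%E,
      (L1norm T (fun t => component Kh Khp (xiu t)) <= D)%E,
      (L1norm T (fun t => component Hhp Hh (xip t)) <= D)%E &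
      (L1norm T (fun t => component Hh Hhp (xip t)) <= D)%E].
Proof.
move=> eD.
have sK : subspace Kh by exact: kernel_l_subspace.
have sH : subspace Hh by exact: kernel_r_subspace.
have KV : Kh `<=` Vh by move=> x [].
have HQ : Hh `<=` Qh by move=> x [].
have C0 : 0 < C by apply: stability_const_gt0 => //; exact: form_norm_ge0.
have J0 (W : hilbertType R) (A : set W) (l : R -> W -> R) :
    (0 <= int_J T (fun t => dnorm A (l t)))%E.
  by apply: int_J_ge0 => t; exact: Defs.dnorm_ge0.
have xiD : (L1norm T xiu + L1norm T xip <= D)%E.
  apply: (le_trans error_stability); rewrite eD.
  apply: lee_mulD4; [exact: ltW|exact: J0|exact: J0|exact: J0|exact: J0| |].
    exact: (int_J_dnorm_component fV sK KV linF mF).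
  exact: (int_J_dnorm_component fQ sH HQ linG mG).
have nu0 : (0 <= L1norm T xiu)%E by exact: int_J_ge0.
have np0 : (0 <= L1norm T xip)%E by exact: int_J_ge0.
have uD : (L1norm T xiu <= D)%E by apply: le_trans xiD; rewrite leeDl.
have pD : (L1norm T xip <= D)%E by apply: le_trans xiD; rewrite leeDr.
have [_ Vxi _] := bxiu; have [_ Qxi _] := bxip.
have le1 : {ae mu, forall t, `[0, T]%classic t ->
    `|component Kh Khp (xiu t)| <= `|xiu t| /\ `|component Khp Kh (xiu t)| <= `|xiu t|}.
  by apply: (ae_imp Vxi) => t {}Vxi Jt; apply: norm_component => //; exact: Vxi.
have le2 : {ae mu, forall t, `[0, T]%classic t ->
    `|component Hh Hhp (xip t)| <= `|xip t| /\ `|component Hhp Hh (xip t)| <= `|xip t|}.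
  by apply: (ae_imp Qxi) => t {}Qxi Jt; apply: norm_component => //; exact: Qxi.
split; [apply: le_trans uD|apply: le_trans uD|apply: le_trans pD|apply: le_trans pD];
  apply: le_int_J => //.
- by apply: (ae_imp le1) => t h /h[].
- by apply: (ae_imp le1) => t h /h[].
- by apply: (ae_imp le2) => t h /h[].
- by apply: (ae_imp le2) => t h /h[].
Qed.

(** The outer 2 counts the functionals F and G, the inner 2 the instantaneous terms of each, and the
    factor [T] comes from integrating a memory bound that is constant in time. *)
Definition consistency_const (na nb nc Ck1 Ck2 Ck3 Ck4 T : R) : R :=
  2 * ((na + nb + nc) * (2 + (Ck1 + Ck2 + Ck3 + Ck4) * T)).

Let B := form_norm a + form_norm b + form_norm c.
Let K := Ck1 + Ck2 + Ck3 + Ck4.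
Let h t := `|etau t| + `|etap t|.

Let na0 : 0 <= form_norm a. Proof. exact: form_norm_ge0. Qed.
Let nb0 : 0 <= form_norm b. Proof. exact: form_norm_ge0. Qed.
Let nc0 : 0 <= form_norm c. Proof. exact: form_norm_ge0. Qed.
Let B0 : 0 <= B. Proof. by rewrite !addr_ge0. Qed.
Let h0 t : 0 <= h t. Proof. by rewrite addr_ge0. Qed.
Let hi : ae_integrable T h.
Proof. exact: ae_integrableD (bochner_norm betau) (bochner_norm betap). Qed.

Let form_h (X Y : normedModType R) (l : {bilinear X -> Y -> R^o}) x y t :
  form_continuous l -> form_norm l <= B -> `|x| <= h t ->
  `|l x y| <= B * h t * `|y|.
Proof.
move=> cf fB xh; rewrite (le_trans (le_form_norm _ _ cf))// mulrA.
by rewrite ler_wpM2r// ler_pM// form_norm_ge0.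
Qed.

Let form_h' (X Y : normedModType R) (l : {bilinear X -> Y -> R^o}) x y t :
  form_continuous l -> form_norm l <= B -> `|y| <= h t ->
  `|l x y| <= B * h t * `|x|.
Proof.
move=> cf fB xh; rewrite (le_trans (le_form_norm _ _ cf))// [`|x| * _]mulrC mulrA.
by rewrite ler_wpM2r// ler_pM// form_norm_ge0.
Qed.

Let uh_le t : `|etau t| <= h t. Proof. by rewrite lerDl. Qed.
Let ph_le t : `|etap t| <= h t. Proof. by rewrite lerDr. Qed.
Let aB : form_norm a <= B. Proof. by rewrite /B -addrA lerDl addr_ge0. Qed.
Let bB : form_norm b <= B. Proof. by rewrite /B addrAC lerDr addr_ge0. Qed.
Let cB : form_norm c <= B. Proof. by rewrite /B lerDr addr_ge0. Qed.

(** The functionals act on the known interpolation error, so the memory is bounded directly by the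
    integral of [h] over all of [[0, T]]. This is where [form_norm b] enters a constant. *)
Let consistency : {ae mu, forall t, `[0, T]%classic t ->
  dnorm Vh (F t) + dnorm Qh (G t) <=
  2 * (2 * B * h t + K * B * \int[mu]_(s in `[0, T]) h s)}.
Proof.
have K1 := bounded_kernel_ge0 T0 bk1; have K2 := bounded_kernel_ge0 T0 bk2.
have K3 := bounded_kernel_ge0 T0 bk3; have K4 := bounded_kernel_ge0 T0 bk4.
have KB0 : 0 <= K * B by rewrite mulr_ge0// !addr_ge0.
apply: aeW => t; rewrite /= in_itv /= => /andP[t0 tT].
have Ile : \int[mu]_(s in `[0, t]) (K * B * h s) <=
    K * B * \int[mu]_(s in `[0, T]) h s.
  by rewrite (Rintegral_aeZ tT _ hi) ler_wpM2l//; exact: le_Rintegral_itv hi.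
have I0 : 0 <= \int[mu]_(s in `[0, T]) h s by apply: Rintegral_ge0 => r _; exact: h0.
have mem v q : `|memory_V a b k1 k2 etau etap t v| <=
      \int[mu]_(s in `[0, t]) (K * B * h s) * `|v| /\
    `|memory_Q b c k3 k4 etau etap t q| <=
      \int[mu]_(s in `[0, t]) (K * B * h s) * `|q|.
  apply: (normr_memory T0 ca cb cc bk1 bk2 bk3 bk4 betau betap _ tT).
  - exact: ae_integrableZ.
  - apply: aeW => r _; have := form_h v ca aB (uh_le r).
    have := form_h' v cb bB (ph_le r); set z := B * h r * `|v|.
    have -> : K * B * h r * `|v| = K * z by rewrite /z; ring.
    have z0 : 0 <= z by rewrite !mulr_ge0.
    by move=> x2 x1; have [h1 _] := le_weighted_sum K1 K2 K3 K4 z0 x1 x2.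
  - apply: aeW => r _; have := form_h q cb bB (uh_le r).
    have := form_h q cc cB (ph_le r); set z := B * h r * `|q|.
    have -> : K * B * h r * `|q| = K * z by rewrite /z; ring.
    have z0 : 0 <= z by rewrite !mulr_ge0.
    by move=> x2 x1; have [_ h1] := le_weighted_sum K1 K2 K3 K4 z0 x1 x2.
set X := 2 * B * h t + _.
have X0 : 0 <= X by rewrite addr_ge0// mulr_ge0// ?mulr_ge0.
suff [hF hG] : dnorm Vh (F t) <= X /\ dnorm Qh (G t) <= X by lra.
split; apply: dnorm_le_on => // v _.
  have [m _] := mem v 0; have x1 := form_h v ca aB (uh_le t).
  have x2 := form_h' v cb bB (ph_le t).
  have := ler_wpM2r (normr_ge0 v) Ile; rewrite /F /functional_F.
  have := ler_normB (a (etau t) v + b v (etap t)) (memory_V a b k1 k2 etau etap t v).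
  have := ler_normD (a (etau t) v) (b v (etap t)).
  have -> : X * `|v| = B * h t * `|v| + B * h t * `|v| +
      K * B * \int[mu]_(s in `[0, T]) h s * `|v| by rewrite /X; ring.
  lra.
have [_ m] := mem 0 v; have x1 := form_h v cb bB (uh_le t).
have x2 := form_h v cc cB (ph_le t).
have := ler_wpM2r (normr_ge0 v) Ile; rewrite /G /functional_G.
have := ler_normB (b (etau t) v - c (etap t) v) (memory_Q b c k3 k4 etau etap t v).
have := ler_normB (b (etau t) v) (c (etap t) v).
have -> : X * `|v| = B * h t * `|v| + B * h t * `|v| +
    K * B * \int[mu]_(s in `[0, T]) h s * `|v| by rewrite /X; ring.
lra.
Qed.

(** Since [uh - u] is [xiu - etau], and likewise for the second unknown, stability and consistency
    bound the discrete part, and the summand 1 in the constant is the interpolation error itself. *)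
Lemma error_le_interpolation :
  (L1norm T (fun t => (uh t - u t)%R) + L1norm T (fun t => (ph t - p t)%R) <=
   (C * consistency_const (form_norm a) (form_norm b) (form_norm c)
      Ck1 Ck2 Ck3 Ck4 T + 1)%:E * (L1norm T etau + L1norm T etap))%E.
Proof.
have C0 : 0 < C by exact: stability_const_gt0.
have K0 : 0 <= K.
  have := bounded_kernel_ge0 T0 bk1; have := bounded_kernel_ge0 T0 bk2.
  have := bounded_kernel_ge0 T0 bk3; have := bounded_kernel_ge0 T0 bk4.
  by move=> *; rewrite !addr_ge0.
have mn (W : normedModType R) (A : set W) (w : R -> W) : bochner_L1 T A w ->
    ae_measurable T (fun t => `|w t|).
  by move=> bw; exact: ae_integrable_measurable (bochner_norm bw).
have n0 (W : normedModType R) (w : R -> W) t : 0 <= `|w t| by [].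
set I := \int[mu]_(s in `[0, T]) h s.
have I0 : 0 <= I by apply: Rintegral_ge0 => r _; exact: h0.
have hI : int_J T h = I%:E by rewrite /I (Rintegral_ae_EFin (lexx T)).
have eI : (L1norm T etau + L1norm T etap)%E = I%:E.
  rewrite -hI; apply/esym/int_JD; [exact: n0|exact: n0| |].
    exact: mn betau.
  exact: mn betap.
have split_error (W : normedModType R) (A A' : set W) (w w' w'' : R -> W) :
    bochner_L1 T A (fun t => w t - w'' t) -> bochner_L1 T A' (fun t => w' t - w'' t) ->
    (L1norm T (fun t => (w t - w' t)%R) <=
     L1norm T (fun t => (w t - w'' t)%R) + L1norm T (fun t => (w' t - w'' t)%R))%E.
  move=> b1 b2; rewrite /L1norm -int_JD//; [|exact: mn b1|exact: mn b2].
  apply: le_int_J => //; apply: aeW => t _.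
  have -> : w t - w' t = (w t - w'' t) - (w' t - w'' t).
    by rewrite opprB addrA subrK.
  exact: ler_normB.
have FG : (int_J T (fun t => dnorm Vh (F t)) + int_J T (fun t => dnorm Qh (G t)) <=
    (consistency_const (form_norm a) (form_norm b) (form_norm c)
      Ck1 Ck2 Ck3 Ck4 T * I)%:E)%E.
  have mDF : ae_measurable T (fun t => dnorm Vh (F t)).
    apply: ae_measurable_dnorm => //.
    by apply: (ae_imp linF) => t lF Jt k x y _ _; exact: lF.
  have mDG : ae_measurable T (fun t => dnorm Qh (G t)).
    apply: ae_measurable_dnorm => //.
    by apply: (ae_imp linG) => t lG Jt k x y _ _; exact: lG.
  have D0 t : 0 <= dnorm Vh (F t) by exact: Defs.dnorm_ge0.
  have D0' t : 0 <= dnorm Qh (G t) by exact: Defs.dnorm_ge0.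
  have hB t : 0 <= 4 * B * h t by rewrite !mulr_ge0.
  have cB0 : 0 <= 2 * K * B * I by rewrite !mulr_ge0.
  rewrite -(int_JD D0 D0' mDF mDG).
  apply: (@le_trans _ _ (int_J T (fun t => 4 * B * h t + 2 * K * B * I))).
    apply: le_int_J => [t|t|]; [by rewrite addr_ge0|by rewrite addr_ge0|].
    apply: (ae_imp consistency) => t Ht Jt; apply: (le_trans (Ht Jt)).
    by rewrite -/I; lra.
  have hm := ae_integrable_measurable hi.
  rewrite int_JD//; last 2 first.
  - exact/ae_integrable_measurable/ae_integrableZ.
  - exact: ae_measurable_cst.
  rewrite int_JZ ?mulr_ge0// int_J_cst// hI -EFinM -EFinD lee_fin.
  rewrite le_eqVlt; apply/orP; left; apply/eqP.
  by rewrite /consistency_const -/B -/K; ring.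
rewrite eI -EFinM mulrDl mul1r EFinD -eI.
apply: (le_trans (leeD (split_error _ _ _ _ _ _ bxiu betau)
  (split_error _ _ _ _ _ _ bxip betap))).
rewrite addeACA leeD//; apply: (le_trans error_stability).
rewrite -mulrA [X in (_ <= X)%E]EFinM.
by apply: lee_wpmul2l => //; rewrite lee_fin ltW.
Qed.

End Error.
End ErrorAnalysis.


(* The constants are functions of the quantities on which they are allowed to
   depend, chosen before the spaces, the forms, the kernels and the discrete
   spaces; in particular they do not depend on h. *)
Theorem theorem2p8 (R : realType) :
  exists (Ci : forall (alpha beta gamma norm_a norm_c Ck1 Ck2 Ck3 Ck4 T : R),
            nat -> R)
         (Cerr : forall (Ci : nat -> R)
            (norm_a norm_b norm_c Ck1 Ck2 Ck3 Ck4 T : R), R),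
  forall (V Q : hilbertType R)
    (a : {bilinear V -> V -> R^o}) (b : {bilinear V -> Q -> R^o})
    (c : {bilinear Q -> Q -> R^o})
    (k1 k2 k3 k4 : R -> R -> R) (Ck1 Ck2 Ck3 Ck4 : R)
    (T alpha0 gamma0 alpha beta gamma : R)
    (Vh : set V) (Qh : set Q),
  0 <= T ->
  form_continuous a -> form_continuous b -> form_continuous c ->
  sym_psd a -> sym_psd c ->
  0 < alpha0 -> coercive_on a (kernel_l b setT setT) alpha0 ->
  0 < gamma0 -> coercive_on c (kernel_r b setT setT) gamma0 ->
  bounded_kernel T k1 Ck1 -> bounded_kernel T k2 Ck2 ->
  bounded_kernel T k3 Ck3 -> bounded_kernel T k4 Ck4 ->
  fin_dim_subspace Vh -> fin_dim_subspace Qh ->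
  let Kh := kernel_l b Vh Qh in
  let Hh := kernel_r b Vh Qh in
  let Khp := orthocompl Vh Kh in
  let Hhp := orthocompl Qh Hh in
  0 < alpha -> coercive_on a Kh alpha ->
  0 < gamma -> coercive_on c Hh gamma ->
  0 < beta ->
  (forall q, Hhp q -> sup [set b v q / `|v| | v in Vh `\ 0] >= beta * `|q|) ->
  (forall v, Khp v -> sup [set b v q / `|q| | q in Qh `\ 0] >= beta * `|v|) ->
  let C := Ci alpha beta gamma (form_norm a) (form_norm c)
              Ck1 Ck2 Ck3 Ck4 T in
  let Ce := Cerr C (form_norm a) (form_norm b) (form_norm c)
              Ck1 Ck2 Ck3 Ck4 T in
  let solution := is_solution a b c k1 k2 k3 k4 T in
  (forall i, (1 <= i <= 16)%N -> 0 < C i) /\ 0 < Ce /\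
  forall (f : R -> dual V) (g : R -> dual Q),
  bochner_L1 T setT f -> bochner_L1 T setT g ->
  (exists (uh : R -> V) (ph : R -> Q),
    [/\ bochner_L1 T Vh uh, bochner_L1 T Qh ph, solution Vh Qh f g uh ph &
      forall (uh' : R -> V) (ph' : R -> Q),
        bochner_L1 T Vh uh' -> bochner_L1 T Qh ph' ->
        solution Vh Qh f g uh' ph' ->
        {ae @lebesgue_measure R, forall t, `[0, T]%classic t ->
          uh' t = uh t /\ ph' t = ph t}]) /\
  forall (uh : R -> V) (ph : R -> Q),
  bochner_L1 T Vh uh -> bochner_L1 T Qh ph -> solution Vh Qh f g uh ph ->
  forall (u : R -> V) (p : R -> Q),
  bochner_L1 T setT (fun t => (u t, p t) : V * Q) ->
  solution setT setT f g u p ->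
  (forall (uI : R -> V) (pI : R -> Q),
    bochner_L1 T Vh uI -> bochner_L1 T Qh pI ->
    let xiu t := uh t - uI t in
    let xip t := ph t - pI t in
    let xiu0 t := component Kh Khp (xiu t) in
    let xiub t := component Khp Kh (xiu t) in
    let xip0 t := component Hh Hhp (xip t) in
    let xipb t := component Hhp Hh (xip t) in
    let etau t := u t - uI t in
    let etap t := p t - pI t in
    let F := functional_F a b k1 k2 etau etap in
    let G := functional_G b c k3 k4 etau etap in
    let F0 t v := F t (component Kh Khp v) in
    let Fb t v := F t (component Khp Kh v) in
    let G0 t q := G t (component Hh Hhp q) in
    let Gb t q := G t (component Hhp Hh q) in
    let nF0 := int_J T (fun t => dnorm Vh (F0 t)) in
    let nFb := int_J T (fun t => dnorm Vh (Fb t)) in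
    let nG0 := int_J T (fun t => dnorm Qh (G0 t)) in
    let nGb := int_J T (fun t => dnorm Qh (Gb t)) in
    [/\ (L1norm T xiub <= (C 9%N)%:E * nFb + (C 13%N)%:E * nF0
                         + (C 3%N)%:E * nGb + (C 7%N)%:E * nG0)%E,
        (L1norm T xiu0 <= (C 10%N)%:E * nFb + (C 14%N)%:E * nF0
                         + (C 4%N)%:E * nGb + (C 8%N)%:E * nG0)%E,
        (L1norm T xipb <= (C 11%N)%:E * nFb + (C 15%N)%:E * nF0
                         + (C 1%N)%:E * nGb + (C 5%N)%:E * nG0)%E &
        (L1norm T xip0 <= (C 12%N)%:E * nFb + (C 16%N)%:E * nF0
                         + (C 2%N)%:E * nGb + (C 6%N)%:E * nG0)%E]) /\
  (L1norm T (fun t => (uh t - u t)%R) + L1norm T (fun t => (ph t - p t)%R) <=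
   Ce%:E *
     (ereal_inf [set L1norm T (fun t => (u t - v t)%R) | v in bochner_L1 T Vh] +
      ereal_inf [set L1norm T (fun t => (p t - q t)%R) | q in bochner_L1 T Qh]))%E.

Proof.
(* All sixteen constants are equal: the index is ignored. *)
exists (fun alpha beta gamma na nc Ck1 Ck2 Ck3 Ck4 T _ =>
  stability_const alpha beta gamma na nc Ck1 Ck2 Ck3 Ck4 T).
(* As the constants agree, [C 1%N] stands for any of them. *)
exists (fun C na nb nc Ck1 Ck2 Ck3 Ck4 T =>
  C 1%N * consistency_const na nb nc Ck1 Ck2 Ck3 Ck4 T + 1).
move=> V Q a b c k1 k2 k3 k4 Ck1 Ck2 Ck3 Ck4 T alpha0 gamma0 alpha beta gamma Vh Qh.
move=> T0 ca cb cc pa pc _ _ _ _ bk1 bk2 bk3 bk4 fV fQ Kh Hh Khp Hhp.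
move=> al0 cK ga0 cH be0 infsupQ infsupV C Ce solution.
have na0 : 0 <= form_norm a by exact: form_norm_ge0.
have nb0 : 0 <= form_norm b by exact: form_norm_ge0.
have nc0 : 0 <= form_norm c by exact: form_norm_ge0.
have C0 : 0 < C 1%N by exact: stability_const_gt0.
have Ce0 : 0 < Ce.
  have := bounded_kernel_ge0 T0 bk1; have := bounded_kernel_ge0 T0 bk2.
  have := bounded_kernel_ge0 T0 bk3; have := bounded_kernel_ge0 T0 bk4.
  move=> K4 K3 K2 K1; rewrite /Ce ltr_wpDl// mulr_ge0 ?(ltW C0)//.
  by rewrite /consistency_const !mulr_ge0 ?addr_ge0 ?mulr_ge0 ?addr_ge0.
split=> [i _|]; first exact: C0.
split=> // f g bf bg; split.
  have [uh [ph [buh bph sh]]] := discrete_solution_exists T0 ca cb cc pa pc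
    bk1 bk2 bk3 bk4 fV fQ al0 cK ga0 cH be0 infsupQ infsupV bf bg.
  exists uh, ph; split => // uh' ph' buh' bph' sh'.
  exact: (discrete_solution_unique T0 ca cb cc pa pc bk1 bk2 bk3 bk4 fV fQ
    al0 cK ga0 cH be0 infsupQ infsupV buh bph buh' bph' sh sh').
move=> uh ph buh bph sh u p bup s.
have bu := bochner_L1_fst bup; have bp := bochner_L1_snd bup.
split=> [uI pI buI bpI xiu xip xiu0 xiub xip0 xipb etau etap F G F0 Fb G0 Gb
    nF0 nFb nG0 nGb|].
  have [h1 h2 h3 h4] := error_components T0 ca cb cc pa pc bk1 bk2 bk3 bk4 fV fQ
    al0 cK ga0 cH be0 infsupQ infsupV buh bph bu bp buI bpI sh s erefl.
  by split.
have finite (W : normedModType R) (A : set W) (w v : R -> W) :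
    bochner_L1 T setT w -> bochner_L1 T A v ->
    (L1norm T (fun t => (w t - v t)%R) < +oo)%E.
  move=> bw bv; have [_ _ //] : bochner_L1 T setT (fun t => w t - v t).
  exact: bochner_L1B bw bv.
have V0 : Vh 0 by case: (fin_dim_subspace_subspace fV).
have Q0 : Qh 0 by case: (fin_dim_subspace_subspace fQ).
(* Dividing by the positive constant leaves a lower bound for a sum of infima, to be checked on each
   pair of interpolants. *)
rewrite muleC -lee_pdivrMr//; apply: le_ereal_infD.
- by move=> _ [v _ <-]; exact: int_J_ge0.
- by move=> _ [v _ <-]; exact: int_J_ge0.
- exists (L1norm T (fun t => (u t - 0)%R)); last exact: finite bu (bochner_L1_cst0 T V0).
  by exists (fun=> 0) => //; exact: bochner_L1_cst0.
- exists (L1norm T (fun t => (p t - 0)%R)); last exact: finite bp (bochner_L1_cst0 T Q0).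
  by exists (fun=> 0) => //; exact: bochner_L1_cst0.
move=> _ _ [v bv <-] [q bq <-]; rewrite lee_pdivrMr// muleC.
exact: (error_le_interpolation T0 ca cb cc pa pc bk1 bk2 bk3 bk4 fV fQ
  al0 cK ga0 cH be0 infsupQ infsupV buh bph bu bp bv bq sh s).
Qed.
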